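(* Let $(V,q)$ be a regular quadratic $\Gamma$-form over $\mathcal{O}_S$ of rank $\geq 3$ such that $(\underline{\mathbf{O}}_V^\Gamma)^0$ is the special orthogonal group of an isotropic (regular, integral) quadratic form of rank $2$ over $\mathcal{O}_S$, and such that $(\underline{\mathbf{O}}_V^\Gamma)^0$ is a semi-direct factor in $\underline{\mathbf{O}}_V^\Gamma$, while the quotient $\underline{\mathbf{O}}_V^\Gamma/(\underline{\mathbf{O}}_V^\Gamma)^0$ is a finite $\mathcal{O}_S$-group. If $-1\in(\mathbb{F}_q^\times)^2$ and $\exp(\mathrm{Pic}(\mathcal{O}_S))>2$, then the map $\psi:c_\Gamma(q)\to c(q)$ from the $\Gamma$-genus to the genus of $q$, forgetting the $\Gamma$-action, is not injective; that is, there exist two integral $\Gamma$-forms representing distinct classes in $c_\Gamma(q)$ which are $\mathcal{O}_S$-isomorphic.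
   Context: Setting: $C$ is a geometrically connected smooth projective curve over a finite field $\mathbb{F}_q$ of odd characteristic (the subscript $q$ in $\mathbb{F}_q$ is unrelated to the quadratic form), $K=\mathbb{F}_q(C)$, $\Omega$ is the set of closed points of $C$; for $\mathfrak p\in\Omega$, $v_{\mathfrak p}$ is the valuation of $K$ at $\mathfrak p$ and $\hat{\mathcal{O}}_{\mathfrak p}$ the complete discrete valuation ring. $S\subset\Omega$ is a non-empty finite set and $\mathcal{O}_S=\{x\in K: v_{\mathfrak p}(x)\ge 0\ \forall \mathfrak p\notin S\}$. $\exp$ denotes the exponent of a group. $\Gamma$ is a finite group with $|\Gamma|$ prime to $\mathrm{char}(K)$, with a faithful representation $\Gamma\hookrightarrow \mathbf{GL}(V)$, where $V$ is a projective $\mathcal{O}_S$-module of finite rank; $\Gamma$ acts on $\mathbf{GL}(V)$ by conjugation. A quadratic form $q:V\to\mathcal{O}_S$ has bilinear map $B_q(u,v)=q(u+v)-q(u)-q(v)$; it is regular if the induced map $V\to \mathrm{Hom}(V,\mathcal{O}_S)$ is an isomorphism, and isotropic if $q(v)=0$ for some non-zero $v\in V$. It is a $\Gamma$-form if $q\circ\gamma=q$ for all $\gamma\in\Gamma$. For an extension $R$ of $\mathcal{O}_S$, an $R$-isometry from $(V',q')$ to $(V,q)$ is an $R$-isomorphism $A:V'\cong V$ with $q\circ A=q'$; forms are $R$-isomorphic if an $R$-isometry exists, and $\Gamma$-forms are $\Gamma$-isomorphic over $R$ if a $\Gamma$-equivariant one exists. The genus $c(q)$ is the set of isomorphism classes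 of $\mathcal{O}_S$-forms that are $K$-isomorphic to $q$ and $\hat{\mathcal{O}}_{\mathfrak p}$-isomorphic to $q$ for every $\mathfrak p\notin S$. The $\Gamma$-genus $c_\Gamma(q)$ is the set of $\Gamma$-isomorphism classes of $\Gamma$-forms over $\mathcal{O}_S$ that are $\Gamma$-isomorphic to $q$ over $K$ and over $\hat{\mathcal{O}}_{\mathfrak p}$ for every $\mathfrak p\notin S$. $\underline{\mathbf{O}}_V$ is the $\mathcal{O}_S$-group $R\mapsto\{A\in\mathbf{GL}(V\otimes R): q\circ A=q\}$; the special orthogonal group is $\underline{\mathbf{SO}}_V=\ker[\det:\underline{\mathbf{O}}_V\to\underline{\mu}_2]$. $\underline{\mathbf{O}}_V^\Gamma$ is the subgroup of $\Gamma$-equivariant isometries (a smooth $\mathcal{O}_S$-group), and $(\underline{\mathbf{O}}_V^\Gamma)^0$ is its neutral component (the open subgroup scheme with connected fibers). That $(\underline{\mathbf{O}}_V^\Gamma)^0$ is a semi-direct factor means $\underline{\mathbf{O}}_V^\Gamma\cong(\underline{\mathbf{O}}_V^\Gamma)^0\rtimes\underline{Q}$ with $\underline{Q}$ the quotient. *)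

(* Defs.v *)
From HB Require Import structures.
From mathcomp Require Import all_boot all_order fingroup all_algebra.
From mathcomp Require Import generic_quotient ring_quotient.
From mathcomp Require Import boolp classical_sets functions cardinality.

Set Implicit Arguments.
Unset Strict Implicit.
Unset Printing Implicit Defensive.

Import Order.TTheory GRing.Theory Num.Theory.
Local Open Scope ring_scope.
Local Open Scope quotient_scope.
Local Open Scope classical_set_scope.

Section Tensor.
Variables (A R : comPzRingType) (phi : {rmorphism A -> R}).
Variables (V : lmodType A) (W : lmodType R).

(* Biadditive maps to an abelian group, balanced over A, where A acts on the
   R-module W through phi. *)
Definition balanced (X : zmodType) (f : V -> W -> X) : Prop :=
  [/\ forall u v w, f (u + v) w = f u w + f v w,
      forall v w z, f v (w + z) = f v w + f v z &
      forall a v w, f (a *: v) w = f v (phi a *: w)].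

Definition tsum (X : zmodType) (f : V -> W -> X) (s : seq (V * W)) : X :=
  \sum_(p <- s) f p.1 p.2.

(* Two formal sums of pairs denote the same tensor exactly when no balanced
   map tells them apart. *)
Definition teq (s t : seq (V * W)) : bool :=
  `[< forall (X : zmodType) (f : V -> W -> X),
        balanced f -> tsum f s = tsum f t >].

Lemma teq_refl : reflexive teq.
Proof. by move=> s; apply/asboolP. Qed.

Lemma teq_sym : symmetric teq.
Proof. by move=> s t; apply/asboolP/asboolP => h X f hf; rewrite h. Qed.

Lemma teq_trans : transitive teq.
Proof.
move=> t s u /asboolP h1 /asboolP h2; apply/asboolP => X f hf.
by rewrite h1 // h2.
Qed.

Canonical teq_equiv := EquivRel teq teq_refl teq_sym teq_trans.

Definition tensor : Type := {eq_quot teq}.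
HB.instance Definition _ := EqQuotient.on tensor.
HB.instance Definition _ := Choice.on tensor.

Lemma tensorP (s t : seq (V * W)) :
  (forall (X : zmodType) (f : V -> W -> X), balanced f -> tsum f s = tsum f t) ->
  \pi_tensor s = \pi_tensor t.
Proof. by move=> h; apply/eqquotP/asboolP. Qed.

Lemma tensorW (P : tensor -> Prop) :
  (forall s, P (\pi_tensor s)) -> forall x, P x.
Proof. by move=> h x; rewrite -[x]reprK; exact: h. Qed.

Definition tlift (X : zmodType) (f : V -> W -> X) (x : tensor) : X :=
  tsum f (repr x).

Lemma tlift_pi (X : zmodType) (f : V -> W -> X) s :
  balanced f -> tlift f (\pi_tensor s) = tsum f s.
Proof.
move=> hf; rewrite /tlift; have : repr (\pi_tensor s) = s %[mod tensor].
  by rewrite reprK.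
by move=> /eqquotP/asboolP; exact.
Qed.

Lemma tsum_cat (X : zmodType) (f : V -> W -> X) s t :
  tsum f (s ++ t) = tsum f s + tsum f t.
Proof. by rewrite /tsum big_cat. Qed.

Lemma balanced0 (X : zmodType) (f : V -> W -> X) v : balanced f -> f v 0 = 0.
Proof. by case=> _ fD _; apply: (addrI (f v 0)); rewrite -fD !addr0. Qed.

Lemma balancedN (X : zmodType) (f : V -> W -> X) v w :
  balanced f -> f v (- w) = - f v w.
Proof.
move=> hf; apply/eqP; rewrite -addr_eq0; case: (hf) => _ fD _.
by rewrite -fD addNr balanced0.
Qed.

Definition tens (v : V) (w : W) : tensor := \pi_tensor [:: (v, w)].
Definition tzero : tensor := \pi_tensor [::].
Definition tadd (x y : tensor) : tensor := \pi_tensor (repr x ++ repr y).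
Definition tscale (r : R) (x : tensor) : tensor :=
  \pi_tensor [seq (p.1, r *: p.2) | p <- repr x].
Definition topp (x : tensor) : tensor := tscale (- 1) x.

Lemma tsum_map_scale (X : zmodType) (f : V -> W -> X) r s :
  tsum f [seq (p.1, r *: p.2) | p <- s] = tsum (fun v w => f v (r *: w)) s.
Proof. by rewrite /tsum big_map. Qed.

Lemma balanced_scale (X : zmodType) (f : V -> W -> X) r :
  balanced f -> balanced (fun v w => f v (r *: w)).
Proof.
case=> h1 h2 h3; split=> [u v w|v w z|a v w] //; first by rewrite scalerDr h2.
by rewrite h3 !scalerA mulrC.
Qed.

Lemma tadd_pi s t : tadd (\pi_tensor s) (\pi_tensor t) = \pi_tensor (s ++ t).
Proof.
apply: tensorP => X f hf; rewrite !tsum_cat.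
by rewrite -![tsum f (repr _)]/(tlift f _) !tlift_pi.
Qed.

Lemma tscale_pi r s :
  tscale r (\pi_tensor s) = \pi_tensor [seq (p.1, r *: p.2) | p <- s].
Proof.
apply: tensorP => X f hf; rewrite !tsum_map_scale.
rewrite -[tsum _ (repr _)]/(tlift _ _) tlift_pi //.
exact: balanced_scale.
Qed.

Lemma taddA : associative tadd.
Proof.
move=> x y z; elim/tensorW: x => s; elim/tensorW: y => t; elim/tensorW: z => u.
by rewrite !tadd_pi catA.
Qed.

Lemma taddC : commutative tadd.
Proof.
move=> x y; elim/tensorW: x => s; elim/tensorW: y => t; rewrite !tadd_pi.
by apply: tensorP => X f hf; rewrite !tsum_cat addrC.
Qed.

Lemma tadd0 : left_id tzero tadd.
Proof. by move=> x; elim/tensorW: x => s; rewrite tadd_pi. Qed.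

Lemma taddN : left_inverse tzero topp tadd.
Proof.
move=> x; elim/tensorW: x => s; rewrite /topp tscale_pi tadd_pi.
apply: tensorP => X f hf; rewrite tsum_cat tsum_map_scale /tsum big_nil.
rewrite -big_split big1 //= => p _.
by rewrite scaleN1r balancedN // addNr.
Qed.

HB.instance Definition _ := GRing.isZmodule.Build tensor taddA taddC tadd0 taddN.

Lemma tscaleA a b x : tscale a (tscale b x) = tscale (a * b) x.
Proof.
elim/tensorW: x => s; rewrite !tscale_pi -map_comp; congr (\pi_tensor _).
by apply: eq_map => p /=; rewrite scalerA.
Qed.

Lemma tscale1 : left_id 1 tscale.
Proof.
move=> x; elim/tensorW: x => s; rewrite tscale_pi; congr (\pi_tensor _).
by rewrite -[RHS]map_id; apply: eq_map => -[v w] /=; rewrite scale1r.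
Qed.

Lemma tscaleDr : right_distributive tscale +%R.
Proof.
move=> a x y; elim/tensorW: x => s; elim/tensorW: y => t.
rewrite -[X in tscale a X]/(tadd _ _) -[RHS]/(tadd _ _).
by rewrite tadd_pi !tscale_pi tadd_pi map_cat.
Qed.

Lemma tscaleDl x : {morph tscale^~ x : a b / a + b}.
Proof.
move=> a b; elim/tensorW: x => s; rewrite -[RHS]/(tadd _ _) !tscale_pi tadd_pi.
apply: tensorP => X f hf; rewrite tsum_cat !tsum_map_scale -big_split.
by apply: eq_bigr => p _; case: hf => _ fD _; rewrite scalerDl fD.
Qed.

HB.instance Definition _ :=
  GRing.Zmodule_isLmodule.Build R tensor tscaleA tscale1 tscaleDr tscaleDl.

Lemma tens_balanced : balanced tens.
Proof.
split=> [u v w|v w z|a v w]; rewrite /tens.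
- rewrite -[RHS]/(tadd _ _) tadd_pi; apply: tensorP => X f [h _ _].
  by rewrite /tsum !big_cons !big_nil /= !addr0 h.
- rewrite -[RHS]/(tadd _ _) tadd_pi; apply: tensorP => X f [_ h _].
  by rewrite /tsum !big_cons !big_nil /= !addr0 h.
- by apply: tensorP => X f [_ _ h]; rewrite /tsum !big_seq1 /= h.
Qed.

Lemma tensZ r v w : r *: tens v w = tens v (r *: w).
Proof. by rewrite -[LHS]/(tscale _ _) tscale_pi. Qed.

Lemma tlift_tens (X : zmodType) (f : V -> W -> X) v w :
  balanced f -> tlift f (tens v w) = f v w.
Proof. by move=> hf; rewrite tlift_pi // /tsum big_seq1. Qed.

Lemma tliftD (X : zmodType) (f : V -> W -> X) :
  balanced f -> {morph tlift f : x y / x + y}.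
Proof.
move=> hf; move=> x y; elim/tensorW: x => s; elim/tensorW: y => t.
by rewrite -[X in tlift f X]/(tadd _ _) tadd_pi !tlift_pi // tsum_cat.
Qed.

Lemma tliftZ (X : zmodType) (f : V -> W -> X) r x :
  balanced f -> tlift f (r *: x) = tlift (fun v w => f v (r *: w)) x.
Proof.
move=> hf; elim/tensorW: x => s; rewrite -[r *: _]/(tscale _ _) tscale_pi.
by rewrite !tlift_pi ?tsum_map_scale //; exact: balanced_scale.
Qed.

End Tensor.

Section TensorMap.
Variables (A R : comPzRingType) (phi : {rmorphism A -> R}).
Variables (V V' : lmodType A) (W : lmodType R).

(* g tensored with the identity of W. *)
Definition tmap (g : {linear V -> V'}) : tensor phi V W -> tensor phi V' W :=
  tlift (fun v w => tens phi (g v) w).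

Lemma tmap_balanced (g : {linear V -> V'}) :
  balanced phi (fun v w => tens phi (g v) w : tensor phi V' W).
Proof.
have [h1 h2 h3] := tens_balanced phi V' W.
by split=> [u v w|v w z|a v w]; rewrite ?linearD ?linearZ /= ?h1 ?h2 ?h3.
Qed.

Lemma tmap_is_linear g : linear (tmap g).
Proof.
move=> r x y; rewrite /tmap tliftD ?tliftZ; try exact: tmap_balanced.
congr (_ + _); rewrite /tlift /tsum scaler_sumr.
by apply: eq_bigr => p _; rewrite tensZ.
Qed.

HB.instance Definition _ g :=
  GRing.isLinear.Build R (tensor phi V W) (tensor phi V' W) *:%R (tmap g)
    (tmap_is_linear g).

End TensorMap.

Record alg (A : comPzRingType) : Type := Alg {
  alg_ring :> comPzRingType;
  alg_str : {rmorphism A -> alg_ring} }.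

Definition alg_hom (A : comPzRingType) (R R' : alg A)
  (f : {rmorphism R -> R'}) : Prop := forall a, f (alg_str R a) = alg_str R' a.

Definition alg_restr (A k : comPzRingType) (phi : {rmorphism A -> k})
  (T : alg k) : alg A := Alg (alg_str T \o phi).

Definition ext (A : comPzRingType) (R : alg A) (V : lmodType A) : lmodType R :=
  tensor (alg_str R) V R^o.

Definition ext_map (A : comPzRingType) (V : lmodType A) (R R' : alg A)
    (f : {rmorphism R -> R'}) : ext R V -> ext R' V :=
  tlift (fun v (r : R^o) => tens (alg_str R') v (f r : R'^o)).

Lemma ext_map_tens (A : comPzRingType) (V : lmodType A) (R R' : alg A)
    (f : {rmorphism R -> R'}) (v : V) (r : R) : alg_hom f ->
  ext_map f (tens (alg_str R) v (r : R^o)) = tens (alg_str R') v (f r : R'^o).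
Proof.
move=> hf; rewrite /ext_map tlift_tens //.
have [h1 h2 h3] := tens_balanced (alg_str R') V R'^o.
split=> [u w s|w s t|a w s] /=; first by rewrite h1.
  by rewrite raddfD h2.
by rewrite h3 rmorphM hf.
Qed.

Section Modules.
Variable A : comPzRingType.

Definition lin_iso (V W : lmodType A) : Prop :=
  exists f : {linear V -> W}, bijective f.

(* Finitely generated projective: a direct summand of some A^n. *)
Definition fin_projective (V : lmodType A) : Prop :=
  exists n (i : {linear V -> 'rV[A]_n}) (p : {linear 'rV[A]_n -> V}),
    cancel i p.

(* V has constant rank n: its fibre over every field has dimension n. *)
Definition has_rank (V : lmodType A) (n : nat) : Prop :=
  forall (k : fieldType) (phi : {rmorphism A -> k}),
    exists f : {linear tensor phi V k^o -> 'rV[k]_n}, bijective f.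

(* d is the determinant of the endomorphism g of the finitely generated
   projective module V: that of g + id on a free module V + V'. *)
Definition has_det (V : lmodType A) (g : V -> V) (d : A) : Prop :=
  exists n (i : {linear V -> 'rV[A]_n}) (p : {linear 'rV[A]_n -> V}),
    cancel i p /\ d = \det (lin1_mx (fun x => i (g (p x)) + (x - i (p x)))).

(* Pic(A) is the group of isomorphism classes of invertible modules under the
   tensor product. *)
Definition invertible_module (L : lmodType A) : Prop :=
  exists M : lmodType A, lin_iso (tensor idfun L M) A^o.

Fixpoint tpow (L : lmodType A) (n : nat) : lmodType A :=
  if n is n'.+1 then tensor idfun L (tpow L n') else A^o.

Definition Pic_killed_by (n : nat) : Prop :=
  forall L : lmodType A, invertible_module L -> lin_iso (tpow L n) A^o.

Definition Pic_exponent (e : nat) : Prop :=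
  [/\ (0 < e)%N, Pic_killed_by e &
      forall m, (0 < m)%N -> Pic_killed_by m -> (e <= m)%N].

End Modules.

Section QForms.
Variable A : comPzRingType.

Definition polar (V : lmodType A) (q : V -> A) (u v : V) : A :=
  q (u + v) - q u - q v.

Definition quadratic (V : lmodType A) (q : V -> A) : Prop :=
  (forall a v, q (a *: v) = a ^+ 2 * q v) /\
  (forall v, scalar (polar q ^~ v)).

Definition regular_form (V : lmodType A) (q : V -> A) : Prop :=
  forall f : {scalar V}, exists! u : V, forall v, polar q u v = f v.

Definition isotropic (V : lmodType A) (q : V -> A) : Prop :=
  exists2 v : V, v != 0 & q v = 0.

Record qform : Type := QForm { qmod :> lmodType A; qf : qmod -> A }.

Definition is_qform (X : qform) : Prop :=
  fin_projective X /\ quadratic (@qf X).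

Definition isometry (Y X : qform) (f : Y -> X) : Prop :=
  [/\ linear f, bijective f & forall v, qf (f v) = qf v].

Definition isometric (Y X : qform) : Prop := exists f, @isometry Y X f.

Variable Gamma : finGroupType.

Record gform : Type := GForm {
  gq :> qform;
  gact : Gamma -> {linear gq -> gq} }.

Definition is_gform (X : gform) : Prop :=
  [/\ is_qform X,
      forall v : X, gact X 1%g v = v,
      forall g h (v : X), gact X (g * h)%g v = gact X g (gact X h v) &
      forall g (v : X), qf (gact X g v) = qf v].

Definition faithful_action (X : gform) : Prop :=
  forall g, (forall v : X, gact X g v = v) -> g = 1%g.

Definition gisometry (Y X : gform) (f : Y -> X) : Prop :=
  isometry f /\ forall g v, f (gact Y g v) = gact X g (f v).

Definition gisometric (Y X : gform) : Prop := exists f, @gisometry Y X f.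

End QForms.

Section BaseChange.
Variables (A : comPzRingType) (R : alg A).

(* The value of the extended form on a formal sum of v_i (x) r_i: it is
   \sum_i r_i^2 q(v_i) + \sum_(i < j) r_i r_j B_q(v_i, v_j). *)
Fixpoint qsum (V : lmodType A) (q : V -> A) (s : seq (V * R^o)) : R :=
  if s is p :: s' then
    (p.2 : R) ^+ 2 * alg_str R (q p.1) +
    \sum_(t <- s') (p.2 : R) * t.2 * alg_str R (polar q p.1 t.1) + qsum q s'
  else 0.

Definition qf_ext (V : lmodType A) (q : V -> A) (x : ext R V) : R :=
  qsum q (repr x).

(* The formula does not depend on the formal sum when 2 is invertible. *)
Section QsumWellDefined.
Variables (V : lmodType A) (q : V -> A) (half : A).
Hypotheses (q_quad : quadratic q) (halfE : half * 2 = 1).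

Let polarC u v : polar q u v = polar q v u.
Proof. by rewrite /polar [u + v]addrC addrAC. Qed.

Let polarP y : scalar (polar q ^~ y) := q_quad.2 y.

Let polarDl u v y : polar q (u + v) y = polar q u y + polar q v y.
Proof. by have := polarP y 1 u v; rewrite scale1r mul1r. Qed.

Let polarZl a v y : polar q (a *: v) y = a * polar q v y.
Proof.
have p0 : polar q 0 y = 0.
  by apply: (addrI (polar q 0 y)); rewrite -polarDl !addr0.
by have := polarP y a v 0; rewrite !addr0 p0 addr0.
Qed.

Let polarvv v : polar q v v = q v *+ 2.
Proof.
have -> : polar q v v = q (2 *: v) - q v - q v.
  by rewrite /polar scaler_nat mulr2n.
by rewrite q_quad.1 -natrX mulr_natl -addrA -opprD -mulr2n -mulrnBr.
Qed.

Let gram (s t : seq (V * R^o)) : R :=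
  \sum_(x <- s) \sum_(y <- t) (x.2 : R) * y.2 * alg_str R (polar q x.1 y.1).

Let gramC s t : gram s t = gram t s.
Proof.
rewrite /gram exchange_big; apply: eq_bigr => y _; apply: eq_bigr => x _.
by rewrite polarC [x.2 * _]mulrC.
Qed.

Let qsum_gram s : qsum q s *+ 2 = gram s s.
Proof.
elim: s => [|p s IHs]; first by rewrite /gram big_nil mul0rn.
have gram_cons t : gram (p :: t) (p :: s) =
    gram [:: p] [:: p] + gram [:: p] s + (gram t [:: p] + gram t s).
  rewrite /gram big_cons !big_seq1 big_cons -big_split /=; congr (_ + _).
  by apply: eq_bigr => x _; rewrite big_cons big_seq1.
rewrite gram_cons -IHs [gram s _]gramC /= /gram !big_seq1 polarvv rmorphMn.
by rewrite -expr2 mulrnAr !mulrnDl -!addrA; congr (_ + _).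
Qed.

Let gram_balanced t :
  balanced (alg_str R) (fun (v : V) (r : R^o) =>
    \sum_(y <- t) (r : R) * y.2 * alg_str R (polar q v y.1)).
Proof.
split=> [u v r|v r r'|a v r]; rewrite -?big_split; apply: eq_bigr => y _ /=.
- by rewrite polarDl rmorphD mulrDr.
- by rewrite !mulrDl.
- by rewrite polarZl rmorphM /GRing.scale /= mulrCA !mulrA.
Qed.

Lemma qf_ext_pi (s : seq (V * R^o)) : qf_ext q (\pi_(ext R V) s) = qsum q s.
Proof.
have gramE t : gram (repr (\pi_(ext R V) s)) t = gram s t.
  exact: (tlift_pi s (gram_balanced t)).
have : qf_ext q (\pi_(ext R V) s) *+ 2 = qsum q s *+ 2.
  by rewrite !qsum_gram gramE gramC gramE.
have hR : alg_str R half * 2 = 1.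
  by rewrite -(rmorph_nat (alg_str R)) -rmorphM halfE rmorph1.
have halfK (x : R) : alg_str R half * (x *+ 2) = x.
  by rewrite -(mulr_natl x) mulrA hR mul1r.
by move=> h; rewrite -[LHS]halfK h halfK.
Qed.

End QsumWellDefined.

Definition qform_ext (X : qform A) : qform R :=
  QForm (qf_ext (@qf A X)).

Definition gform_ext (Gamma : finGroupType) (X : gform A Gamma) :
    gform R Gamma :=
  @GForm R Gamma (qform_ext X)
    (fun g => @tmap A R (alg_str R) X X R^o (gact X g)).

End BaseChange.

(* Group schemes over A are given by their functors of points.  Those occurring
   here are subfunctors of R |-> End(V (x) R), the group law being
   composition. *)
Definition efunctor (A : comPzRingType) (V : lmodType A) : Type :=
  forall R : alg A, set (ext R V -> ext R V).

Section GroupFunctors.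
Variable A : comPzRingType.

(* g' is the base change of g along f. *)
Definition base_change (V : lmodType A) (R R' : alg A) (f : {rmorphism R -> R'})
    (g : ext R V -> ext R V) (g' : ext R' V -> ext R' V) : Prop :=
  forall x, g' (ext_map f x) = ext_map f (g x).

Definition subgroup_functor (V : lmodType A) (G H : efunctor V) : Prop :=
  [/\ forall R, H R `<=` G R,
      forall R, H R idfun,
      forall R g h, H R g -> H R h -> H R (g \o h),
      forall R g h, H R g -> G R h -> cancel g h -> H R h &
      forall (R R' : alg A) (f : {rmorphism R -> R'}) g g', alg_hom f ->
        H R g -> G R' g' -> base_change f g g' -> H R' g'].

(* H is an open subfunctor of G: for every point g of G over R there is an
   ideal of R (generated by I) whose open complement in Spec R is the locus
   where g lies in H. *)
Definition open_subfunctor (V : lmodType A) (G H : efunctor V) : Prop :=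
  forall (R : alg A) g, G R g -> exists I : set R,
    forall (R' : alg A) (f : {rmorphism R -> R'}) g', alg_hom f ->
      G R' g' -> base_change f g g' ->
      (H R' g' <-> exists n (c : 'I_n -> R') (a : 'I_n -> R),
         (forall i, I (a i)) /\ \sum_i c i * f (a i) = 1).

(* The field k is the residue field of Spec A at the kernel of phi. *)
Definition residue_field (k : fieldType) (phi : {rmorphism A -> k}) : Prop :=
  forall x : k, exists a b, phi b != 0 /\ x = phi a / phi b.

(* A global function on the fibre of H over k, valued in idempotents, as a
   natural transformation on k-algebras; these functions are the indicators of
   the open and closed subschemes of the fibre. *)
Definition idempotent_function (V : lmodType A) (H : efunctor V)
    (k : fieldType) (phi : {rmorphism A -> k})
    (e : forall T : alg k,
       (ext (alg_restr phi T) V -> ext (alg_restr phi T) V) -> T) : Prop :=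
  (forall T h, H (alg_restr phi T) h -> e T h ^+ 2 = e T h) /\
  (forall (T T' : alg k) (f : {rmorphism T -> T'}) h h', alg_hom f ->
     H (alg_restr phi T) h -> H (alg_restr phi T') h' ->
     @base_change V (alg_restr phi T) (alg_restr phi T') f h h' ->
     e T' h' = f (e T h)).

Definition connected_fibre (V : lmodType A) (H : efunctor V)
    (k : fieldType) (phi : {rmorphism A -> k}) : Prop :=
  forall e, @idempotent_function V H k phi e ->
    (forall T h, H (alg_restr phi T) h -> e T h = 0) \/
    (forall T h, H (alg_restr phi T) h -> e T h = 1).

Definition neutral_component (V : lmodType A) (G G0 : efunctor V) : Prop :=
  [/\ subgroup_functor G G0, open_subfunctor G G0 &
      forall (k : fieldType) (phi : {rmorphism A -> k}),
        residue_field phi -> connected_fibre G0 phi].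

Definition group_iso (V W : lmodType A) (G : efunctor V) (H : efunctor W) :
    Prop :=
  exists t : forall R : alg A, (ext R V -> ext R V) -> (ext R W -> ext R W),
  [/\ forall R, set_bij (G R) (H R) (t R),
      forall R g h, G R g -> G R h -> t R (g \o h) = t R g \o t R h &
      forall (R R' : alg A) (f : {rmorphism R -> R'}) g g', alg_hom f ->
        G R g -> G R' g' -> base_change f g g' ->
        base_change f (t R g) (t R' g')].

(* G is the semi-direct product of its normal subgroup N and its subgroup Q, so
   that the projection identifies Q with the quotient G / N. *)
Definition semidirect (V : lmodType A) (G N Q : efunctor V) : Prop :=
  [/\ subgroup_functor G N, subgroup_functor G Q,
      forall R g h n, G R g -> G R h -> cancel g h -> N R n ->
        N R (g \o n \o h),
      forall R g, N R g -> Q R g -> g = idfun &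
      forall R g, G R g -> exists n h, [/\ N R n, Q R h & g = n \o h]].

(* Q is represented by a finite A-algebra B, with universal point u in Q(B). *)
Definition finite_functor (V : lmodType A) (Q : efunctor V) : Prop :=
  exists (B : alg A) (u : ext B V -> ext B V),
  [/\ exists n (b : 'I_n -> B), forall x : B, exists c : 'I_n -> A,
        x = \sum_i alg_str B (c i) * b i,
      Q B u &
      forall (R : alg A) g, Q R g ->
        exists f : {rmorphism B -> R},
          [/\ alg_hom f, base_change f u g &
              forall f' : {rmorphism B -> R},
                alg_hom f' -> base_change f' u g -> f' =1 f]].

Definition OGamma (Gamma : finGroupType) (X : gform A Gamma) : efunctor X :=
  fun R => [set g | @gisometry R Gamma (gform_ext R X) (gform_ext R X) g].

Definition SO (X : qform A) : efunctor X :=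
  fun R => [set g | @isometry R (qform_ext R X) (qform_ext R X) g /\
                    has_det g 1].

End GroupFunctors.

Arguments OGamma [A Gamma] X R.
Arguments SO [A] X R.

(* K is the function field of a geometrically connected smooth projective curve
   over F: it is finite over F(x) for some x transcendental over F, and F is
   algebraically closed in K. *)
Definition function_field (F K : fieldType) (iota : {rmorphism F -> K}) : Prop :=
  (exists (x : K) (n : nat) (b : 'I_n -> K), ~ algebraicOver iota x /\
     forall y : K, exists (d : {poly F}) (p : 'I_n -> {poly F}), d != 0 /\
       (map_poly iota d).[x] * y = \sum_i (map_poly iota (p i)).[x] * b i) /\
  (forall x : K, algebraicOver iota x -> exists a : F, x = iota a).

(* The closed points of the curve are the normalized discrete valuations of its
   function field (over a finite field these are trivial on constants).  The
   value at 0 is a dummy: see val_ge. *)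
Record place (K : fieldType) : Type := Place {
  pval :> K -> int;
  pval0 : pval 0 = 0;
  pvalM : forall x y, x != 0 -> y != 0 -> pval (x * y) = pval x + pval y;
  pvalD : forall x y, x != 0 -> y != 0 -> x + y != 0 ->
    Num.min (pval x) (pval y) <= pval (x + y);
  pval_unif : exists2 x, x != 0 & pval x = 1 }.

Definition val_ge (K : fieldType) (v : place K) (n : nat) (x : K) : Prop :=
  x = 0 \/ n%:Z <= v x.

Section ValTheory.
Variables (K : fieldType) (v : place K).

Lemma pval1 : v 1 = 0.
Proof.
have := pvalM v (oner_neq0 K) (oner_neq0 K); rewrite mulr1 => h.
by apply: (addrI (v 1)); rewrite -h addr0.
Qed.

Lemma pvalN1 : v (- 1) = 0.
Proof.
have N1 : (- 1 : K) != 0 by rewrite oppr_eq0 oner_neq0.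
have := pvalM v N1 N1; rewrite mulrNN mulr1 pval1 => h.
by apply/eqP; rewrite -[_ == 0](mulrn_eq0 (v (- 1)) 2) mulr2n -h.
Qed.

Lemma pvalN x : v (- x) = v x.
Proof.
have [->|x0] := eqVneq x 0; first by rewrite oppr0.
by rewrite -mulN1r pvalM ?oppr_eq0 ?oner_neq0 // pvalN1 add0r.
Qed.

Lemma val_ge0 n : val_ge v n 0. Proof. by left. Qed.

Lemma val_ge1 : val_ge v 0 1. Proof. by right; rewrite pval1. Qed.

Lemma val_geN n x : val_ge v n x -> val_ge v n (- x).
Proof. by case=> [->|h]; [left; rewrite oppr0 | right; rewrite pvalN]. Qed.

Lemma val_geD n x y : val_ge v n x -> val_ge v n y -> val_ge v n (x + y).
Proof.
case=> [->|hx]; first by rewrite add0r.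
case=> [->|hy]; first by rewrite addr0; right.
have [->|x0] := eqVneq x 0; first by rewrite add0r; right.
have [->|y0] := eqVneq y 0; first by rewrite addr0; right.
have [->|xy0] := eqVneq (x + y) 0; first exact: val_ge0.
by right; apply: le_trans (pvalD v x0 y0 xy0); rewrite le_min hx.
Qed.

Lemma val_geB n x y : val_ge v n x -> val_ge v n y -> val_ge v n (x - y).
Proof. by move=> hx /val_geN; exact: val_geD. Qed.

Lemma val_geM m n x y : val_ge v m x -> val_ge v n y -> val_ge v (m + n) (x * y).
Proof.
case=> [->|hx]; first by rewrite mul0r; left.
case=> [->|hy]; first by rewrite mulr0; left.
have [->|x0] := eqVneq x 0; first by rewrite mul0r; left.
have [->|y0] := eqVneq y 0; first by rewrite mulr0; left.
by right; rewrite pvalM // PoszD lerD.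
Qed.

End ValTheory.

Section SIntegers.
Variables (K : fieldType) (S : set (place K)).

Definition S_integral : {pred K} :=
  fun x => `[< forall v : place K, ~ S v -> val_ge v 0 x >].

Lemma S_integral_subring : subring_closed S_integral.
Proof.
split=> [|x y /asboolP hx /asboolP hy|x y /asboolP hx /asboolP hy];
  apply/asboolP => v Sv.
- exact: val_ge1.
- by apply: val_geB; [exact: hx | exact: hy].
- by apply: (@val_geM _ _ 0 0); [exact: hx | exact: hy].
Qed.

HB.instance Definition _ :=
  GRing.isSubringClosed.Build K S_integral S_integral_subring.

Definition O_S : Type := {x : K | x \in S_integral}.
HB.instance Definition _ := [isSub of O_S for @sval K _].
HB.instance Definition _ := [Choice of O_S by <:].
HB.instance Definition _ := [SubChoice_isSubComNzRing of O_S by <:].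

Definition K_alg : alg O_S := @Alg O_S K (\val : O_S -> K).

End SIntegers.

(* The completion of the valuation ring of v is the inverse limit of its
   quotients by the powers m^n of its maximal ideal.  A point of it is a sequence
   x with x n an integral representative mod m^n, up to termwise congruence. *)
Section Completion.
Variables (K : fieldType) (v : place K).

Definition coherent : {pred nat -> K} :=
  fun x => `[< forall n, val_ge v 0 (x n) /\ val_ge v n (x n.+1 - x n) >].

Lemma coherent_subring : subring_closed coherent.
Proof.
split=> [|x y /asboolP hx /asboolP hy|x y /asboolP hx /asboolP hy];
  apply/asboolP => n.
- by split; [exact: val_ge1 | rewrite /= subrr; exact: val_ge0].
- have [hx0 hx1] := hx n; have [hy0 hy1] := hy n; split; first exact: val_geB.
  have -> : (x - y) n.+1 - (x - y) n = (x n.+1 - x n) - (y n.+1 - y n).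
    by rewrite /= !opprB addrACA [- y _ + _]addrC [RHS]addrACA.
  exact: val_geB.
- have [hx0 hx1] := hx n; have [hy0 hy1] := hy n; split.
    exact: (@val_geM _ _ 0 0).
  have -> : (x * y) n.+1 - (x * y) n =
      (x n.+1 - x n) * y n.+1 + x n * (y n.+1 - y n).
    by rewrite /= mulrBl mulrBr addrA subrK.
  apply: val_geD; last exact: (@val_geM _ _ 0 n).
  by have := val_geM hx1 (hy n.+1).1; rewrite addn0.
Qed.

HB.instance Definition _ :=
  GRing.isSubringClosed.Build (nat -> K) coherent coherent_subring.

Definition coherent_seq : Type := {x : nat -> K | x \in coherent}.
HB.instance Definition _ := [isSub of coherent_seq for @sval (nat -> K) _].
HB.instance Definition _ := [Choice of coherent_seq by <:].
HB.instance Definition _ := [SubChoice_isSubComNzRing of coherent_seq by <:].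

Definition null_seq : {pred coherent_seq} :=
  fun x => `[< forall n, val_ge v n (val x n) >].

Lemma null_seq_ideal : idealr_closed null_seq.
Proof.
split.
- by apply/asboolP => n; exact: val_ge0.
- apply/negP => /asboolP /(_ 1%N) [] /=.
    by move/eqP; apply/negP; exact: oner_neq0.
  by rewrite /= pval1.
- move=> a x y /asboolP hx /asboolP hy; apply/asboolP => n.
  apply: val_geD => //; apply: (@val_geM _ _ 0 n) => //.
  by have /asboolP /(_ n) [] := valP a.
Qed.

HB.instance Definition _ := isIdealr.Build coherent_seq null_seq null_seq_ideal.

Definition completion : Type := {ideal_quot null_seq}.
HB.instance Definition _ := GRing.ComNzRing.on completion.

Variables (S : set (place K)) (Sv : ~ S v).

Lemma const_coherent (x : O_S S) : (fun=> val x) \in coherent.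
Proof.
apply/asboolP => n; split; last by rewrite subrr; exact: val_ge0.
by have /asboolP := valP x; apply.
Qed.

Definition to_completion (x : O_S S) : completion :=
  \pi_({ideal_quot null_seq}) (Sub (fun=> val x) (const_coherent x)).

Lemma to_completion_is_zmod_morphism : zmod_morphism to_completion.
Proof.
move=> x y; rewrite /to_completion -[RHS]rmorphB; congr (\pi_ _ _).
by apply: val_inj; apply/funext => n.
Qed.

Lemma to_completion_is_monoid_morphism : monoid_morphism to_completion.
Proof.
split=> [|x y]; rewrite /to_completion.
  rewrite -[RHS](rmorph1 (\pi_({ideal_quot null_seq}))); congr (\pi_ _ _).
  by apply: val_inj; apply/funext => n.
rewrite -[RHS]rmorphM; congr (\pi_ _ _).
by apply: val_inj; apply/funext => n.
Qed.

HB.instance Definition _ := GRing.isZmodMorphism.Build (O_S S) completion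
  to_completion to_completion_is_zmod_morphism.
HB.instance Definition _ := GRing.isMonoidMorphism.Build (O_S S) completion
  to_completion to_completion_is_monoid_morphism.

Definition completion_alg : alg (O_S S) :=
  @Alg (O_S S) completion to_completion.

End Completion.

(* A genus is given by its representatives: Y represents a class of c(X), resp.
   of c_Gamma(X).  Its elements are the isometry classes of representatives. *)
Section Genera.
Variables (K : fieldType) (S : set (place K)).

Definition genus (X Y : qform (O_S S)) : Prop :=
  [/\ is_qform Y,
      isometric (qform_ext (K_alg S) Y) (qform_ext (K_alg S) X) &
      forall (v : place K) (Sv : ~ S v),
        isometric (qform_ext (completion_alg Sv) Y)
                  (qform_ext (completion_alg Sv) X)].

Variable Gamma : finGroupType.

Definition Gamma_genus (X Y : gform (O_S S) Gamma) : Prop :=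
  [/\ is_gform Y,
      gisometric (gform_ext (K_alg S) Y) (gform_ext (K_alg S) X) &
      forall (v : place K) (Sv : ~ S v),
        gisometric (gform_ext (completion_alg Sv) Y)
                   (gform_ext (completion_alg Sv) X)].

(* Forgetting the action of Gamma defines the map psi on isometry classes, from
   the Gamma-genus to the genus. *)
Lemma Gamma_genusW X Y : Gamma_genus X Y -> genus X Y.
Proof.
case=> -[qY _ _ _] [f [fi _]] h; split=> //; first by exists f.
by move=> v Sv; have [g [gi _]] := h v Sv; exists g.
Qed.

Lemma gisometricW (A : comPzRingType) (X Y : gform A Gamma) :
  gisometric Y X -> isometric Y X.
Proof. by case=> f [fi _]; exists f. Qed.

End Genera.

(* Main.v *)
(* Write A for O_S.  The torus SO(W) = G_m acts on V (x) K by isometries rho(a)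
   commuting with Gamma, and V is the sum of its weight parts.  Take an
   invertible fractional ideal J of A whose square is not principal, with local
   generator j_v at v.  The weight vectors of non-zero weight span hyperbolic
   planes, V is a sum of pieces L(D) x + L(-D) y of these planes and of a rest
   fixed by rho, and rho(j_v)^2 shifts D by an even multiple of J.  Such a shift
   is also effected by a rational element of SL_2, acting on the sum of the
   plane and of an anisotropic line.  So there is an isometry sg of V (x) K
   carrying V to rho(j_v)^2 V at every v outside S.

   Conjugating Gamma by sg gives a Gamma-form on the same quadratic module, in the
   Gamma-genus of q since rho commutes with Gamma.  If it were Gamma-isometric to
   V, the uniqueness of the decomposition in (O_V^Gamma)^0 x| Q, over K and over
   the valuation rings, would give u in K^* with v(u) = 2 v(j_v) for all v outside
   S, and J^2 would be principal. *)
Require Import Defs.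
From HB Require Import structures.
From mathcomp Require Import all_boot all_order fingroup all_algebra.
From mathcomp Require Import generic_quotient ring_quotient finfield.
From mathcomp Require Import boolp classical_sets functions cardinality.
From mathcomp Require Import ring zify.

Set Implicit Arguments.
Unset Strict Implicit.
Unset Printing Implicit Defensive.

Import Order.TTheory GRing.Theory Num.Theory.
Local Open Scope ring_scope.

(** * Places and fractional ideals *)

(** Why rho(j_v) is squared: SL_2 acts on a ternary space as on the trace-zero matrices, so its
    diagonal torus scales a hyperbolic pair by squares, and the rational isometries that it provides
    shift D by even multiples only. An odd shift may be obstructed by its spinor norm. An exponent
    above 2 of the Picard group is what makes some J^2 non-principal. Every local isometry of the
    construction is defined over K, with a denominator that is a unit at v; it therefore makes sense
    over the valuation ring of v and over its completion alike. Strong approximation for SL_2 is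
    replaced by explicit matrices over K. The arithmetic behind them (invertible fractional ideals,
    generators modulo c, matrices of determinant 1 with prescribed divisors) rests on one finiteness
    fact: A / cA is finite for every non-zero c in A. *)

Definition vge (K : fieldType) (v : place K) (k : int) (x : K) : bool :=
  (x == 0) || (k <= v x).

Section Valuations.
Variables (K : fieldType) (v : place K).

Lemma pvalV x : x != 0 -> v x^-1 = - v x.
Proof.
move=> x0; apply/eqP; rewrite -addr_eq0 -pvalM ?invr_eq0 //.
by rewrite mulVf // pval1.
Qed.

Lemma pvalX x n : x != 0 -> v (x ^+ n) = v x *+ n.
Proof.
move=> x0; elim: n => [|n IH]; first by rewrite expr0 pval1.
by rewrite exprS pvalM ?expf_neq0 // IH mulrS.
Qed.

Lemma pvalXz x (i : int) : x != 0 -> v (x ^ i) = i * v x.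
Proof.
move=> x0; case: i => n; first by rewrite -exprnP pvalX // -mulr_natl natz.
by rewrite NegzE -exprnN pvalV ?expf_neq0 // pvalX // mulNr -mulr_natl natz.
Qed.

Lemma vge0 k : vge v k 0. Proof. by rewrite /vge eqxx. Qed.

Lemma vgeE k x : x != 0 -> vge v k x = (k <= v x).
Proof. by rewrite /vge => /negbTE ->. Qed.

Lemma vge_val_ge n x : val_ge v n x <-> vge v n%:Z x.
Proof.
rewrite /vge; split; first by case=> [->|->]; rewrite ?eqxx ?orbT.
by case/orP=> [/eqP|]; [left|right].
Qed.

Lemma vgeN k x : vge v k (- x) = vge v k x.
Proof. by rewrite /vge oppr_eq0 pvalN. Qed.

Lemma vgeD k x y : vge v k x -> vge v k y -> vge v k (x + y).
Proof.
have [->|x0] := eqVneq x 0; first by rewrite add0r.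
have [->|y0] := eqVneq y 0; first by rewrite addr0.
have [->|xy0] := eqVneq (x + y) 0; first by rewrite vge0.
rewrite !vgeE // => hx hy.
by apply: le_trans (pvalD v x0 y0 xy0); rewrite le_min hx.
Qed.

Lemma vgeB k x y : vge v k x -> vge v k y -> vge v k (x - y).
Proof. by move=> hx hy; rewrite vgeD ?vgeN. Qed.

Lemma vge_sum k (I : Type) (r : seq I) (P : pred I) (f : I -> K) :
  (forall i, P i -> vge v k (f i)) -> vge v k (\sum_(i <- r | P i) f i).
Proof. by move=> h; elim/big_ind: _ => //; [exact: vge0 | exact: vgeD]. Qed.

Lemma vgeM k l x y : vge v k x -> vge v l y -> vge v (k + l) (x * y).
Proof.
rewrite /vge mulf_eq0; have [//|x0 /=] := eqVneq x 0.
by have [//|y0 /= hx hy] := eqVneq y 0; rewrite pvalM // lerD.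
Qed.

Lemma vgeW k l x : l <= k -> vge v k x -> vge v l x.
Proof. by rewrite /vge => lk; case: (x == 0) => //=; exact: le_trans. Qed.

Lemma vge_mulr k l x y : vge v k (x * y) -> y != 0 -> l = k - v y -> vge v l x.
Proof.
rewrite /vge mulf_eq0 => + y0 ->; rewrite (negbTE y0) orbF.
by have [//|x0 /=] := eqVneq x 0; rewrite pvalM // lerBlDr.
Qed.

(** Otherwise all the terms, hence also 1, would lie in the maximal ideal of v. This turns a
    partition of unity into a local generator. *)
Lemma vge_sum_unit (I : finType) (f : I -> K) :
  (forall i, vge v 0 (f i)) -> \sum_i f i = 1 -> exists2 i, f i != 0 & v (f i) = 0.
Proof.
move=> h s1; case: (pickP (fun i => (f i != 0) && (v (f i) == 0))) => [i /andP[? /eqP ?]|no].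
  by exists i.
have : vge v 1 (\sum_i f i).
  apply: vge_sum => i _; have := h i; rewrite /vge; have := no i.
  by have [//|/= f0] := eqVneq (f i) 0; lia.
by rewrite s1 vgeE ?oner_neq0 // pval1.
Qed.

End Valuations.

Section SArith.
Variables (K : fieldType) (S : set (place K)).
Local Notation A := (S_integral S).

Lemma inA_P x : reflect (forall v, ~ S v -> vge v 0 x) (x \in A).
Proof.
apply: (iffP (asboolP _)) => h v Sv; have := h v Sv.
  by move/vge_val_ge.
by move=> ?; apply/vge_val_ge.
Qed.

(* Fractional ideals are described by the divisors cutting them out. *)
Definition inL (D : place K -> int) (x : K) : Prop :=
  forall v, ~ S v -> vge v (D v) x.

(** An arbitrary function D may cut out an ideal that does not reach its values. The partition of
    unity certifies that L(D) is invertible with inverse L(-D). *)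
Definition is_div (D : place K -> int) : Prop :=
  exists m (a b : 'I_m -> K),
    [/\ forall k, inL D (a k), forall k, inL (fun v => - D v) (b k) &
        \sum_k a k * b k = 1].

Lemma inL0 D : inL D 0. Proof. by move=> v _; exact: vge0. Qed.

Lemma inLD D x y : inL D x -> inL D y -> inL D (x + y).
Proof. by move=> hx hy v Sv; apply: vgeD; [exact: hx | exact: hy]. Qed.

Lemma inLM D D' D'' x y : (forall v, ~ S v -> D'' v = D v + D' v) ->
  inL D x -> inL D' y -> inL D'' (x * y).
Proof. by move=> e hx hy v Sv; rewrite e //; apply: vgeM; [exact: hx | exact: hy]. Qed.

Lemma inL_A x : inL (fun=> 0) x <-> x \in A.
Proof. by split=> [h|/inA_P]; [apply/inA_P|]. Qed.

Lemma inLZ D x y : x \in A -> inL D y -> inL D (x * y).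
Proof. by move/inL_A; apply: inLM => v _; rewrite add0r. Qed.

Lemma inLMA D x y : inL D x -> inL (fun v => - D v) y -> x * y \in A.
Proof. by move=> hx hy; apply/inL_A; apply: inLM hx hy => v _; rewrite subrr. Qed.

Lemma is_divP (I : finType) D (a b : I -> K) :
  (forall k, inL D (a k)) -> (forall k, inL (fun v => - D v) (b k)) ->
  \sum_k a k * b k = 1 -> is_div D.
Proof.
move=> ha hb ab; exists #|I|, (a \o enum_val), (b \o enum_val).
split; [by move=> k; exact: ha | by move=> k; exact: hb|].
by rewrite -ab (reindex (@enum_val I xpredT)) //=; apply: onW_bij; exact: enum_val_bij.
Qed.

Lemma is_div_ext D D' : D =1 D' -> is_div D -> is_div D'.
Proof. by move=> /funext ->. Qed.

Lemma is_divN D : is_div D -> is_div (fun v => - D v).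
Proof.
move=> [m [a [b [ha hb ab]]]]; exists m, b, a; split=> //.
  by move=> k v Sv; rewrite opprK; exact: ha.
by rewrite -ab; apply: eq_bigr => k _; rewrite mulrC.
Qed.

Lemma is_divD D D' : is_div D -> is_div D' -> is_div (fun v => D v + D' v).
Proof.
move=> [m [a [b [ha hb ab]]]] [m' [a' [b' [ha' hb' ab']]]].
apply: (@is_divP ('I_m * 'I_m')%type _ (fun k => a k.1 * a' k.2) (fun k => b k.1 * b' k.2)).
- by move=> k; apply: inLM (ha _) (ha' _).
- by move=> k; apply: inLM (hb _) (hb' _) => v _; rewrite opprD.
rewrite -(pair_bigA _ (fun i j => (a i * a' j) * (b i * b' j))) /= -[RHS]ab.
apply: eq_bigr => i _; rewrite -[RHS]mulr1 -ab' mulr_sumr.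
by apply: eq_bigr => j _; rewrite mulrACA.
Qed.

Lemma is_div0 : is_div (fun=> 0).
Proof.
apply: (@is_divP unit _ (fun=> 1) (fun=> 1)); last by rewrite big_const card_unit /= mulr1 addr0.
  by move=> _; apply/inL_A; rewrite rpred1.
by move=> _ v Sv; rewrite oppr0; move: v Sv; apply/inL_A; rewrite rpred1.
Qed.

Lemma is_divZ D (i : int) : is_div D -> is_div (fun v => i * D v).
Proof.
move=> hD; have nat_case (n : nat) : is_div (fun v => n%:Z * D v).
  elim: n => [|n IH].
    by apply: is_div_ext is_div0 => v; rewrite mul0r.
  by apply: is_div_ext (is_divD hD IH) => v; rewrite intS mulrDl mul1r.
case: i => n; first exact: nat_case.
by apply: is_div_ext (is_divN (nat_case n.+1)) => v; rewrite NegzE mulNr.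
Qed.

(** Some a_k b_k is a unit at v, which turns the bounds on a_k and b_k into equalities: these are
    local generators of the ideal and of its inverse. *)
Lemma is_div_pick D v : is_div D -> ~ S v ->
  exists a b, [/\ inL D a, inL (fun v => - D v) b, a != 0, b != 0 &
                 v a = D v /\ v b = - D v].
Proof.
move=> [m [a [b [ha hb ab]]]] Sv.
have [k] : exists2 k, a k * b k != 0 & v (a k * b k) = 0.
  apply: vge_sum_unit ab => k.
  by have /inA_P := inLMA (ha k) (hb k); apply.
rewrite mulf_eq0 negb_or => /andP[a0 b0]; rewrite pvalM // => vab.
exists (a k), (b k); split => //.
have := ha k v Sv; have := hb k v Sv; rewrite !vgeE //; lia.
Qed.

Lemma inL_dual D x : is_div D -> (forall b, inL (fun v => - D v) b -> x * b \in A) ->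
  inL D x.
Proof.
move=> hD h v Sv; have [a [b [_ hb _ b0 [_ vb]]]] := is_div_pick hD Sv.
have /inA_P/(_ v Sv) := h _ hb; move/vge_mulr; apply => //.
by rewrite vb sub0r opprK.
Qed.

(** At v, the divisor is the value of an a_k whose product with b_k is a unit at v; the integrality
    of all the a_k b_l gives the bounds on the other elements. *)
Lemma div_of_inverse m (a b : 'I_m -> K) :
  (forall k l, a k * b l \in A) -> \sum_k a k * b k = 1 ->
  exists D, [/\ is_div D, forall k, inL D (a k), forall k, inL (fun v => - D v) (b k) &
    forall v, ~ S v -> exists k, [/\ a k != 0, b k != 0, v (a k) = D v & v (b k) = - D v]].
Proof.
move=> hab ab1.
have pk v : exists k : 'I_m, ~ S v -> [/\ a k != 0, b k != 0 & v (a k) + v (b k) = 0].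
  (* At a place of S the index is immaterial, but one must exist: a sum equal to 1 is not empty. *)
  have [Sv|Sv] := pselect (S v).
    case: m a b ab1 {hab} => [|m] a b; last by exists ord0.
    by rewrite big_ord0 => /esym/eqP; rewrite (negbTE (oner_neq0 _)).
  have [k] : exists2 k, a k * b k != 0 & v (a k * b k) = 0.
    by apply: vge_sum_unit ab1 => k; have /inA_P := hab k k; apply.
  rewrite mulf_eq0 negb_or => /andP[a0 b0]; rewrite pvalM // => vab.
  by exists k.
have [f fP] := choice pk.
pose D (v : place K) := v (a (f v)).
have ha k : inL D (a k).
  move=> v Sv; have [a0 b0 e] := fP v Sv.
  have /inA_P/(_ v Sv)/vge_mulr := hab k (f v); apply => //.
  by rewrite /D; lia.
have hb k : inL (fun v => - D v) (b k).
  move=> v Sv; have [a0 b0 e] := fP v Sv.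
  have /inA_P/(_ v Sv) := hab (f v) k; rewrite mulrC => /vge_mulr; apply => //.
  by rewrite /D sub0r.
exists D; split=> //; first by exists m, a, b.
move=> v Sv; have [a0 b0 e] := fP v Sv; exists (f v); split=> //.
by rewrite /D; lia.
Qed.

End SArith.

(** * Linear dependence over F[c] *)

Section LinearDependence.
Variables (F K : fieldType) (iota : {rmorphism F -> K}).
Hypothesis hK : function_field iota.

Local Notation ev p x := ((map_poly iota p).[x]).

Lemma horner_map_sum (I : Type) (r : seq I) (f : I -> {poly F}) x :
  ev (\sum_(i <- r) f i) x = \sum_(i <- r) ev (f i) x.
Proof.
elim/big_rec2: _ => [|i y p _ <-]; first by rewrite rmorph0 horner0.
by rewrite rmorphD hornerD.
Qed.

(* Dimension count: with b_j spanning K over F(x), the elements c^k y_i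
   (k <= d) lie, up to a common factor, in the space of combinations of the b_j
   whose coefficients are polynomials in x of degree O(d). *)
Lemma poly_dependence (c : K) : exists N, forall y : 'I_N -> K,
  exists P : 'I_N -> {poly F},
    (exists i, P i != 0) /\ \sum_i ev (P i) c * y i = 0.
Proof.
have [[x [n [b [xtr span]]]] _] := hK.
have ev0 (d : {poly F}) : d != 0 -> ev d x != 0.
  by move=> d0; apply/negP => /eqP e; apply: xtr; exists d => //; apply/rootP.
pose Mod (q : nat) (y : K) := exists p : 'I_n -> {poly F},
  (forall l, (size (p l) <= q)%N) /\ y = \sum_l ev (p l) x * b l.
have ModD q y z : Mod q y -> Mod q z -> Mod q (y + z).
  move=> [p [hp ->]] [p' [hp' ->]]; exists (fun l => p l + p' l); split.
    by move=> l; rewrite (leq_trans (size_polyD _ _)) // geq_max hp hp'.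
  by rewrite -big_split; apply: eq_bigr => l _; rewrite rmorphD hornerD mulrDl.
have Mod0 q : Mod q 0.
  exists (fun=> 0); split=> [l|]; first by rewrite size_poly0.
  by rewrite big1 // => l _; rewrite rmorph0 horner0 mul0r.
have Mod_sum q (I : Type) (r : seq I) (f : I -> K) :
    (forall i, Mod q (f i)) -> Mod q (\sum_(i <- r) f i).
  by move=> h; elim/big_ind: _ => //; exact: ModD.
have ModW q q' y : (q <= q')%N -> Mod q y -> Mod q' y.
  by move=> le [p [hp ->]]; exists p; split=> // l; exact: leq_trans (hp l) le.
have Modp q m y (d : {poly F}) : (size d <= m.+1)%N -> Mod q y -> Mod (q + m)%N (ev d x * y).
  move=> hd [p [hp ->]]; exists (fun l => d * p l); split.
    move=> l; rewrite (leq_trans (size_polyMleq _ _)) //.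
    by have := hp l; move: (size d) (size (p l)) hd => s s'; lia.
  by rewrite mulr_sumr; apply: eq_bigr => l _; rewrite rmorphM hornerM mulrA.
have common t (y : 'I_t -> K) : exists (d : {poly F}) q, d != 0 /\
    forall i, Mod q (ev d x * y i).
  elim: t y => [|t IH] y; first by exists 1, 0%N; split; [exact: oner_neq0 | case].
  have [d [q [d0 hd]]] := IH (fun i => y (lift ord0 i)).
  have [d1 [p [d10 hp]]] := span (y ord0).
  exists (d * d1), (maxn (q + size d1) (\max_l size (p l) + size d)).
  split; first by rewrite mulf_neq0.
  move=> i; rewrite rmorphM hornerM.
  case: (unliftP ord0 i) => [j ->|->].
    rewrite mulrAC mulrC; apply: ModW (leq_maxl _ _) _.
    by apply: Modp => //; exact: hd.
  rewrite -mulrA; apply: ModW (leq_maxr _ _) _; apply: Modp => //.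
  by exists p; split=> // l; exact: leq_bigmax.
have [d [m0 [d0 hd]]] := common n (fun j => c * b j).
pose m := maxn m0 (size d).
have Modc q y : Mod q y -> Mod (q + m)%N (ev d x * c * y).
  move=> [p [hp ->]]; rewrite mulr_sumr; apply: Mod_sum => l.
  have -> : ev d x * c * (ev (p l) x * b l) = ev (p l) x * (ev d x * (c * b l)) by ring.
  rewrite addnC; apply: Modp; first exact: leq_trans (hp l) (leqnSn _).
  exact: ModW (leq_maxl _ _) (hd l).
have Modd q y : Mod q y -> Mod (q + m)%N (ev d x * y).
  by apply: Modp; rewrite (leq_trans (leq_maxr m0 _)).
have Modk D k q y : (k <= D)%N -> Mod q y -> Mod (q + D * m)%N (ev d x ^+ D * c ^+ k * y).
  elim: D k => [|D IH] [|k] // le hy.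
  - by rewrite !expr0 !mul1r addn0.
  - have := Modd _ _ (IH 0%N (leq0n _) hy); rewrite -addnA -mulSnr.
    by congr (Mod _ _); rewrite expr0 exprS; ring.
  - have := Modc _ _ (IH k le hy); rewrite -addnA -mulSnr.
    by congr (Mod _ _); rewrite !exprS; ring.
have dep (T : finType) q (y : T -> K) : (n * q < #|T|)%N -> (forall i, Mod q (y i)) ->
    exists u : T -> F, (exists i, u i != 0) /\ \sum_i iota (u i) * y i = 0.
  move=> lt /choice [p hp].
  pose M : 'M[F]_(#|T|, n * q) :=
    \matrix_i mxvec (\matrix_(l, e) (p (enum_val i) l)`_(e : nat)).
  have [u uM u0] : exists2 u : 'rV_#|T|, u *m M = 0 & u != 0.
    have : kermx M != 0.
      rewrite -mxrank_eq0 mxrank_ker -lt0n subn_gt0.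
      exact: leq_ltn_trans (rank_leq_col M) lt.
    case/rowV0Pn => u /sub_kermxP uM u0; by exists u.
  exists (fun i => u 0 (enum_rank i)); split.
    case/rV0Pn: u0 => i ui; exists (enum_val i); by rewrite enum_valK.
  rewrite (reindex (@enum_val T xpredT)) /=; last by apply: onW_bij; exact: enum_val_bij.
  under eq_bigr => i _ do rewrite enum_valK (hp (enum_val i)).2 mulr_sumr.
  rewrite exchange_big big1 // => l _.
  under eq_bigr => i _ do rewrite mulrA.
  rewrite -mulr_suml -[RHS](mul0r (b l)); congr (_ * _).
  have : \sum_i u 0 i *: p (enum_val i) l = 0.
    apply/polyP => e; rewrite coef0 coef_sum.
    have [eq|qe] := ltnP e q; last first.
      by rewrite big1 // => i _; rewrite coefZ nth_default ?mulr0 // (leq_trans ((hp _).1 _)).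
    have /matrixP/(_ 0 (mxvec_index l (Ordinal eq))) := uM; rewrite mxE [RHS]mxE => u0'; rewrite -[RHS]u0'.
    by apply: eq_bigr => i _; rewrite coefZ [M _ _]mxE mxvecE mxE.
  move/(congr1 (fun r => ev r x)); rewrite rmorph0 horner0 horner_map_sum => u0'; rewrite -[RHS]u0'.
  by apply: eq_bigr => i _; rewrite -hornerZ -map_polyZ.
exists (n * m).+1 => y.
have [d' [q [d'0 hy]]] := common _ y.
(* This degree makes the count work: (nm + 1)(D + 1) unknowns in F against n(q + Dm) = D + nmD
   equations. *)
pose D := (n * q)%N.
have [| |u [[[i0 k0] u0] hu]] := dep ('I_(n * m).+1 * 'I_D.+1)%type (q + D * m)%N
  (fun ik => ev d x ^+ D * c ^+ ik.2 * (ev d' x * y ik.1)).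
- rewrite card_prod !card_ord mulnDr -/D mulnA mulnCA !mulSn addnC !mulnS.
  by nia.
- by move=> [i k] /=; apply: Modk; [rewrite -ltnS ltn_ord | exact: hy].
exists (fun i => \poly_(k < D.+1) u (i, inord k)); split.
  exists i0; apply/eqP => /polyP/(_ k0); rewrite coef_poly ltn_ord inord_val coef0.
  by apply/eqP.
have nz : ev d x ^+ D * ev d' x != 0 by rewrite mulf_neq0 ?expf_neq0 ?ev0.
have hu' : \sum_i \sum_k
    iota (u (i, k)) * (ev d x ^+ D * c ^+ k * (ev d' x * y i)) = 0.
  by rewrite pair_bigA -[RHS]hu; apply: eq_bigr => -[i k].
apply: (mulfI nz); rewrite mulr0 -[RHS]hu' mulr_sumr; apply: eq_bigr => i _.
rewrite poly_def horner_map_sum mulr_suml mulr_sumr; apply: eq_bigr => k _.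
have -> : map_poly iota (u (i, inord k) *: 'X^k) = iota (u (i, k)) *: 'X^k.
  by rewrite map_polyZ map_polyXn inord_val.
by rewrite hornerZ hornerXn; ring.
Qed.

End LinearDependence.

(** * Finiteness of the quotients A / cA *)

Section FiniteQuotients.
Variables (F : finFieldType) (K : fieldType) (iota : {rmorphism F -> K}).
Hypothesis hK : function_field iota.
Variable S : set (place K).
Local Notation A := (S_integral S).
Local Notation ev p x := ((map_poly iota p).[x]).

(** F being finite, a non-zero constant is a root of unity, on which every place takes the value
    0. *)
Lemma const_inA a : iota a \in A.
Proof.
apply/inA_P => v _; have [->|a0] := eqVneq a 0; first by rewrite rmorph0 vge0.
have i0 : iota a != 0 by rewrite fmorph_eq0.
have : v (iota a ^+ #|F|.-1) = 0.
  rewrite -rmorphXn; have := expf_card a; rewrite -(prednK (ltnW (finNzRing_gt1 F))) exprS.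
  by rewrite -[RHS]mulr1 => /(mulfI a0) ->; rewrite rmorph1 pval1.
rewrite pvalX // => /eqP; rewrite mulrn_eq0 vgeE // => /orP[|/eqP -> //].
by rewrite -subn1 subn_eq0 leqNgt finNzRing_gt1.
Qed.

Lemma ev_inA p c : c \in A -> ev p c \in A.
Proof.
move=> cA; apply: rpred_horner => //; apply/polyOverP => i.
by rewrite coef_map const_inA.
Qed.

(** A / cA has bounded dimension over F: a relation with coefficients in F[c] is reduced modulo c,
    after division by c as long as all the constant terms vanish. The induction is on the total size
    of the coefficients. *)
Lemma mod_dependence (c : K) : c \in A -> c != 0 ->
  exists N, forall y : 'I_N -> K, (forall i, y i \in A) ->
  exists f : 'I_N -> F, (exists i, f i != 0) /\ (\sum_i iota (f i) * y i) / c \in A.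
Proof.
move=> cA c0; have [N hN] := poly_dependence hK c; exists N => y yA.
have [P [P0 hP]] := hN y.
have [s les] := ubnP (\sum_i size (P i))%N.
elim: s P P0 hP les => // s IH P P0 hP les.
pose Q i := \poly_(j < (size (P i)).-1) (P i)`_j.+1.
have eP i : P i = ((P i)`_0)%:P + Q i * 'X.
  apply/polyP => -[|j]; rewrite coefD coefC coefMX coef_poly /= ?addr0 // add0r.
  by case: ltnP => // le; rewrite nth_default //; lia.
have eQ i : ev (P i) c = iota (P i)`_0 + ev (Q i) c * c.
  by rewrite {1}eP rmorphD rmorphM /= map_polyC map_polyX hornerD hornerM hornerC hornerX.
case: (pselect (exists i, (P i)`_0 != 0)) => [ex|none].
  exists (fun i => (P i)`_0); split=> //.
  have -> : (\sum_i iota (P i)`_0 * y i) / c =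
     - \sum_i ev (Q i) c * y i.
    apply: (mulIf c0); rewrite divfK // mulNr mulr_suml; apply/eqP; rewrite -addr_eq0 -big_split /=.
    by rewrite -[X in _ == X]hP; apply/eqP/eq_bigr => i _; rewrite eQ; ring.
  by rewrite rpredN rpred_sum // => i _; rewrite rpredM ?ev_inA.
have z0 i : (P i)`_0 = 0 by apply/eqP; apply: contrapT => /negP h; apply: none; exists i.
apply: (IH Q).
- have [i Pi0] := P0; exists i; apply: contra Pi0 => /eqP e.
  by rewrite eP z0 e mul0r addr0.
- apply: (mulIf c0); rewrite mul0r -[RHS]hP mulr_suml; apply: eq_bigr => i _.
  by rewrite eQ z0 rmorph0 add0r mulrAC.
- rewrite ltnS in les; apply: leq_trans les.
  have [i Pi0] := P0; rewrite (bigD1 i) //= [X in (_ < X)%N](bigD1 i) //= -addSn leq_add //.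
    by rewrite (leq_ltn_trans (size_poly _ _)) // prednK // lt0n size_poly_eq0.
  by apply: leq_sum => j _; rewrite (leq_trans (size_poly _ _)) // leq_pred.
Qed.

(* The quotient A / cA is finite, so powers of s repeat in it. *)
Lemma power_idempotent (c s : K) : c \in A -> c != 0 -> s \in A ->
  exists2 m, (0 < m)%N & (s ^+ (m + m) - s ^+ m) / c \in A.
Proof.
move=> cA c0 sA; have [[|N] hN] := mod_dependence cA c0.
  have [i|f [[i _] _]] := hN (fun=> 0); first by rewrite rpred0.
  by case: i.
have [|f [[i0 fi0] fc]] := hN (fun i => s ^+ i); first by move=> i; rewrite rpredX.
pose p := \poly_(i < N.+1) f (inord i).
have {}pc : ev p s / c \in A.
  move: fc; congr (_ / _ \in A); rewrite /p poly_def horner_map_sum.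
  by apply: eq_bigr => i _; rewrite map_polyZ map_polyXn hornerZ hornerXn inord_val.
have p0 : p != 0.
  apply/eqP => /polyP/(_ i0); rewrite coef_poly ltn_ord inord_val coef0; exact/eqP.
(* Pigeonhole principle: F being finite, two powers of X have the same remainder modulo p. *)
pose g (k : 'I_(#|{ffun 'I_N.+1 -> F}|).+1) : {ffun 'I_N.+1 -> F} :=
  [ffun i : 'I_N.+1 => ('X^k %% p)`_i].
have [k [l [lt_kl ekl]]] : exists k l, (k < l)%N /\ ('X^k %% p) = ('X^l %% p).
  have /injectiveP/injectivePn [k [l ne e]] : ~ injective g.
    by move=> /leq_card; rewrite card_ord ltnn.
  have {}e : 'X^k %% p = 'X^l %% p.
    apply/polyP => i; have [iN|Ni] := ltnP i N.+1.
      by have /ffunP/(_ (Ordinal iN)) := e; rewrite !ffunE.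
    have sz (q : {poly F}) : (size (q %% p)%R <= i)%N.
      by rewrite -ltnS (leq_trans (ltn_modpN0 _ p0)) // (leq_trans (size_poly _ _)) // leqW.
    by rewrite !nth_default.
  have [lt|lt|eq] := ltngtP k l; first by exists k, l.
    by exists l, k.
  by case/eqP: ne; apply: val_inj.
have step : (s ^+ l - s ^+ k) / c \in A.
  have : p %| 'X^l - 'X^k by rewrite /dvdp modpD modpN ekl subrr.
  case/dvdpP => q e.
  have <- : ev ('X^l - 'X^k) s = s ^+ l - s ^+ k.
    by rewrite rmorphB /= !map_polyXn hornerD hornerN !hornerXn.
  by rewrite e rmorphM hornerM -mulrA rpredM ?ev_inA.
pose r := (l - k)%N.
have step' j t : (k <= j)%N -> (s ^+ (j + t * r) - s ^+ j) / c \in A.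
  move=> kj; elim: t => [|t IH]; first by rewrite mul0n addn0 subrr mul0r rpred0.
  have -> : (s ^+ (j + t.+1 * r) - s ^+ j) / c =
      s ^+ (j + t * r - k) * ((s ^+ l - s ^+ k) / c) + (s ^+ (j + t * r) - s ^+ j) / c.
    rewrite mulrA -mulrDl; congr (_ / _); rewrite mulrBr -!exprD subnK; last by lia.
    have -> : (j + t * r - k + l = j + t.+1 * r)%N by rewrite /r; nia.
    by rewrite addrA subrK.
  by apply: rpredD IH; apply: rpredM step; exact: rpredX.
(* A multiple of the period r that is at least k, where the periodicity starts. *)
exists (k.+1 * r)%N; first by rewrite muln_gt0 subn_gt0.
by apply: step'; rewrite /r; nia.
Qed.

End FiniteQuotients.

(** * Arithmetic of the ring of S-integers *)

Section Integrality.
Variables (K : fieldType) (v : place K).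

(** A pole of y would grow with the powers of y, and c can cancel only |v c| of it: a discrete
    valuation ring is completely integrally closed. *)
Lemma vge_bounded_powers c y : c != 0 -> (forall m, vge v 0 (c * y ^+ m)) -> vge v 0 y.
Proof.
move=> c0 h; have [->|y0] := eqVneq y 0; first exact: vge0.
rewrite vgeE // leNgt; apply/negP => vy.
have := h `|v c|.+1; rewrite vgeE ?mulf_neq0 ?expf_neq0 // pvalM ?expf_neq0 // pvalX //.
by rewrite -mulr_natl natz; move: (v c) (v y) vy => a b; nia.
Qed.

Lemma vge_integral n (a : 'I_n -> K) y : (forall i, vge v 0 (a i)) ->
  y ^+ n = \sum_i a i * y ^+ i -> vge v 0 y.
Proof.
move=> ha e; have [->|y0] := eqVneq y 0; first exact: vge0.
rewrite vgeE // leNgt; apply/negP => vy.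
have : vge v ((n%:Z - 1) * v y) (y ^+ n).
  rewrite e; apply: vge_sum => i _; rewrite -[_ * _]add0r; apply: vgeM => //.
  rewrite vgeE ?expf_neq0 // pvalX // -mulr_natl natz.
  by have := ltn_ord i; move: (v y) vy => b; nia.
by rewrite vgeE ?expf_neq0 // pvalX // -mulr_natl natz; move: (v y) vy => b; nia.
Qed.

End Integrality.

Section Dedekind.
Variables (F : finFieldType) (K : fieldType) (iota : {rmorphism F -> K}).
Hypothesis hK : function_field iota.
Variable S : set (place K).
Local Notation A := (S_integral S).
Local Notation ev p x := ((map_poly iota p).[x]).
Lemma sqr_inA x : x ^+ 2 \in A -> x \in A.
Proof.
move=> /inA_P h; apply/inA_P => v Sv; have := h v Sv.
have [->|x0] := eqVneq x 0; first by rewrite vge0.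
by rewrite !vgeE ?expf_neq0 // pvalX //; lia.
Qed.

Variable z : K.
Hypotheses (zA : z \in A) (zVA : z^-1 \notin A).

(** Elements algebraic over F are constants, so they and their inverses lie in A. The non-unit z
    records that A is not a field; it will come from the non-trivial class in the Picard group. *)
Lemma nonunit_transcendental : ~ algebraicOver iota z.
Proof.
move/(hK.2) => [a e]; move: zVA; rewrite e -fmorphV.
by rewrite const_inA.
Qed.

(** The powers of y satisfy a relation over F[z]. With d its leading coefficient, d y is integral
    over F[z], and valuation rings are integrally closed. *)
Lemma frac_A y : exists2 d, (d \in A) && (d != 0) & d * y \in A.
Proof.
have [[|N] hN] := poly_dependence hK z; first by have [P [[[]]]] := hN (fun=> 0).
have [P [[i0 P0] hP]] := hN (fun i => y ^+ i).
have [h Ph hmax] := @arg_maxnP _ i0 (fun i => P i != 0) (fun i => i : nat) P0.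
have evn0 (p : {poly F}) : p != 0 -> ev p z != 0.
  by move=> p0; apply/negP => /eqP e; apply: nonunit_transcendental; exists p => //; apply/rootP.
set d := ev (P h) z; have d0 : d != 0 by exact: evn0.
exists d; first by rewrite d0 ev_inA.
have e : \sum_(i < h.+1) ev (P (inord i)) z * y ^+ i = 0.
  rewrite (big_ord_widen N.+1 (fun i => ev (P (inord i)) z * y ^+ i)) //.
  rewrite big_mkcond -[RHS]hP; apply: eq_bigr => i _; rewrite inord_val.
  case: ltnP => // lt; have [->|/hmax] := eqVneq (P i) 0; last by rewrite /= leqNgt lt.
  by rewrite rmorph0 horner0 mul0r.
rewrite big_ord_recr /= inord_val -/d in e.
apply/inA_P => v Sv.
apply: (@vge_integral _ v h (fun i => - (ev (P (inord i)) z * d ^+ (h - i.+1)))).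
  move=> i; rewrite vgeN; have /inA_P -> // : ev (P (inord i)) z * d ^+ (h - i.+1) \in A.
  by rewrite rpredM ?rpredX ?ev_inA.
move/eqP: e; rewrite addrC addr_eq0 => /eqP e.
case: (h : nat) e => [|h'] e; first by move/eqP: e; rewrite big_ord0 oppr0 mulr1 (negbTE d0).
rewrite exprMn (exprS d) mulrAC e mulNr mulr_suml -sumrN; apply: eq_bigr => i _.
have -> : d ^+ h' = d ^+ (h' - i) * d ^+ i by rewrite -exprD subnK // -ltnS.
by rewrite subSS exprMn; ring.
Qed.

Lemma common_denominator m (y : 'I_m -> K) :
  exists2 d, (d \in A) && (d != 0) & forall i, d * y i \in A.
Proof.
have /choice [d hd] : forall i, exists d, [&& d \in A, d != 0 & d * y i \in A].
  by move=> i; have [d /andP[dA d0] dy] := frac_A (y i); exists d; apply/and3P.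
exists (\prod_i d i).
  rewrite rpred_prod; last by move=> i _; case/and3P: (hd i).
  by apply/prodf_neq0 => i _; case/and3P: (hd i).
move=> i; rewrite (bigD1 i) //= mulrAC rpredM //; first by case/and3P: (hd i).
by apply: rpred_prod => j _; case/and3P: (hd j).
Qed.

Section Annihilator.
Variables (I : K -> Prop) (c : K).
Hypotheses (IA : forall x, I x -> x \in A)
  (ID : forall x y, I x -> I y -> I (x + y))
  (IZ : forall a x, a \in A -> I x -> I (a * x))
  (Ic : I c) (c0 : c != 0).

Let cA : c \in A. Proof. exact: IA. Qed.

(** The g are elements of I independent over F modulo c, in a number that cannot be increased;
    [mod_dependence] bounds such families. *)
Lemma ideal_generators_mod : exists d (g : 'I_d -> K), (forall i, I (g i)) /\
  forall y, I y -> exists f : 'I_d -> F, (y - \sum_i iota (f i) * g i) / c \in A.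
Proof.
pose P d := exists g : 'I_d -> K, (forall i, I (g i)) /\
  forall f : 'I_d -> F, (\sum_i iota (f i) * g i) / c \in A -> forall i, f i = 0.
have P0 : P 0%N by exists (fun=> 0); split=> [|f _]; case.
have [N hN] := mod_dependence hK cA c0.
have PN : ~ P N.
  move=> [g [hg ind]]; have [i|f [[i fi] fc]] := hN g; first exact: IA.
  by move/eqP: fi; apply; exact: ind.
have [d [[g [hg ind]] Pd1]] : exists d, P d /\ ~ P d.+1.
  apply: contrapT => h; apply: PN; elim: N {hN} => // N IH.
  by apply: contrapT => ?; apply: h; exists N.
exists d, g; split=> // y Iy; apply: contrapT => no; apply: Pd1.
pose g' i := if unlift ord0 i is Some j then g j else y.
exists g'; split=> [i|f]; first by rewrite /g'; case: unlift.
have g'0 : g' ord0 = y by rewrite /g' unlift_none.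
have g'S j : g' (lift ord0 j) = g j by rewrite /g' liftK.
rewrite big_ord_recl g'0; under eq_bigr => j _ do rewrite g'S.
have [f0|f0] := eqVneq (f ord0) 0.
  rewrite f0 rmorph0 mul0r add0r => /ind h i.
  by case: (unliftP ord0 i) => [j|] ->.
move=> h; case: no; exists (fun j => - (f ord0)^-1 * f (lift ord0 j)).
have i0 : iota (f ord0) != 0 by rewrite fmorph_eq0.
have -> : (y - \sum_i iota (- (f ord0)^-1 * f (lift ord0 i)) * g i) / c =
   iota (f ord0)^-1 * ((iota (f ord0) * y + \sum_i iota (f (lift ord0 i)) * g i) / c).
  rewrite mulrA mulrDr fmorphV mulKf //; congr ((_ + _) / _).
  rewrite mulr_sumr -sumrN; apply: eq_bigr => i _.
  by rewrite rmorphM rmorphN fmorphV; ring.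
by rewrite rpredM // const_inA.
Qed.

(** Each g has a power g^m that is idempotent modulo c. The product t of the 1 - g^m is 1 modulo I
    and annihilates these powers modulo c. *)
Lemma idempotent_multiplier (gs : seq K) : (forall g, g \in gs -> I g) ->
  exists t, [/\ t \in A, I (1 - t) & forall g, g \in gs -> exists m, t * g ^+ m / c \in A].
Proof.
elim: gs => [|g gs IH] hgs.
  by exists 1; split; rewrite ?rpred1 // subrr -(mul0r c); apply: IZ => //; rewrite rpred0.
have [|t [tA It ht]] := IH; first by move=> x xg; apply: hgs; rewrite inE xg orbT.
have Ig : I g by apply: hgs; rewrite inE eqxx.
have gA := IA Ig.
have [m m0 hm] := power_idempotent hK cA c0 gA.
exists (t * (1 - g ^+ m)); split.
- by rewrite rpredM ?rpredB ?rpred1 ?rpredX.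
- have -> : 1 - t * (1 - g ^+ m) = (1 - t) + (t * g ^+ m.-1) * g.
    by rewrite -mulrA -exprSr prednK //; ring.
  by apply: ID => //; apply: IZ => //; rewrite rpredM ?rpredX.
- move=> x; rewrite inE => /orP[/eqP ->|xg].
    exists m; have -> : t * (1 - g ^+ m) * g ^+ m / c = - t * ((g ^+ (m + m) - g ^+ m) / c).
      by rewrite exprD; ring.
    by apply: rpredM => //; rewrite rpredN.
  have [k hk] := ht _ xg; exists k.
  have -> : t * (1 - g ^+ m) * x ^+ k / c = (1 - g ^+ m) * (t * x ^+ k / c) by ring.
  by apply: rpredM => //; rewrite rpredB ?rpred1 ?rpredX.
Qed.

(** The elements of [gs] act nilpotently on t modulo c. Multiplying t by the last power of each that
    does not kill it leaves a non-zero element killed by all of them. *)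
Lemma nilpotent_annihilator (gs : seq K) t : t / c \notin A ->
  (forall g, g \in gs -> g \in A /\ exists m, t * g ^+ m / c \in A) ->
  exists2 u, u \in A & t * u / c \notin A /\ forall g, g \in gs -> t * u * g / c \in A.
Proof.
elim: gs t => [|g gs IH] t tc hgs.
  by exists 1; rewrite ?rpred1 // mulr1; split.
have [gA ex] := hgs g (mem_head _ _).
have [m hm mmin] := ex_minnP ex.
case: m hm mmin => [|m] hm mmin; first by rewrite mulr1 (negbTE tc) in hm.
have [||u uA [tu hu]] := IH (t * g ^+ m).
- by apply/negP => /mmin; rewrite ltnn.
- move=> x xg; have [|xA [k hk]] := hgs x; first by rewrite inE xg orbT.
  split=> //; exists k.
  have -> : t * g ^+ m * x ^+ k / c = g ^+ m * (t * x ^+ k / c) by ring.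
  by apply: rpredM => //; rewrite rpredX.
exists (g ^+ m * u); first by rewrite rpredM ?rpredX.
split; first by rewrite mulrA.
move=> x; rewrite inE => /orP[/eqP ->|/hu]; last by rewrite mulrA.
have -> : t * (g ^+ m * u) * g / c = u * (t * g ^+ m.+1 / c) by rewrite exprS; ring.
by apply: rpredM.
Qed.

(** If the t of [idempotent_multiplier] were 0 modulo c, both t and 1 - t would be in I. So t
    survives modulo c, and the generators of I act nilpotently on it. *)
Lemma proper_ideal_annihilator : ~ I 1 ->
  exists2 t, t / c \notin A & forall y, I y -> t * y / c \in A.
Proof.
move=> I1; have [d [g [hg gen]]] := ideal_generators_mod.
have [x /mapP [i _ ->] //|t [tA It ht]] := @idempotent_multiplier (map g (enum 'I_d)).
have tc : t / c \notin A.
  apply/negP => h; apply: I1; rewrite -(subrK t 1); apply: ID => //.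
  by rewrite -(divfK c0 t); apply: IZ.
have [x xg|u uA [tu hu]] := @nilpotent_annihilator (map g (enum 'I_d)) t tc.
  by split; [case/mapP: xg => i _ ->; exact: IA | exact: ht].
exists (t * u) => // y Iy; have [f hf] := gen y Iy.
have -> : t * u * y / c = t * u * ((y - \sum_i iota (f i) * g i) / c)
    + \sum_i iota (f i) * (t * u * g i / c).
  rewrite mulrA -[RHS]addr0.
  have -> : \sum_i iota (f i) * (t * u * g i / c) = t * u * (\sum_i iota (f i) * g i) / c.
    by rewrite mulr_sumr mulr_suml; apply: eq_bigr => i _; ring.
  by ring.
apply: rpredD; first by apply: rpredM => //; rewrite rpredM.
apply: rpred_sum => i _; apply: rpredM; first exact: const_inA.
by apply: hu; apply: map_f; rewrite mem_enum.
Qed.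

End Annihilator.

(** Let I be the product of the ideal (b) with its inverse. If I is proper, its annihilator gives y
    = t / c outside A with y I in A, so that y maps the inverse ideal to itself. Starting from a
    common denominator d, all the y^j d b_k are then in A, and y has no pole outside S: a
    contradiction. *)
Lemma fractional_ideal_invertible m (b : 'I_m -> K) : (exists k, b k != 0) ->
  exists a : 'I_m -> K, (forall k l, a k * b l \in A) /\ \sum_k a k * b k = 1.
Proof.
move=> [k bk0].
pose I x := exists a : 'I_m -> K, (forall k l, a k * b l \in A) /\ x = \sum_k a k * b k.
suff [a [ha /esym e]] : I 1 by exists a.
have single a l : (forall j, a * b j \in A) -> I (a * b l).
  move=> ha; exists (fun j => if j == l then a else 0); split=> [i j|].
    by case: ifP => _ //; rewrite mul0r rpred0.
  rewrite (bigD1 l) //= eqxx big1 ?addr0 // => j /negbTE ->; exact: mul0r.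
have [d /andP[dA d0] hd] := common_denominator b.
set c := d * b k.
apply: contrapT => I1.
have [||||t] := @proper_ideal_annihilator I c _ _ _ (single d k hd) _ I1.
- by move=> x [a [ha ->]]; apply: rpred_sum => i _.
- move=> x y [a [ha ->]] [a' [ha' ->]]; exists (fun i => a i + a' i); split.
    by move=> i j; rewrite mulrDl rpredD.
  by rewrite -big_split; apply: eq_bigr => i _; rewrite mulrDl.
- move=> e x eA [a [ha ->]]; exists (fun i => e * a i); split.
    by move=> i j; rewrite -mulrA rpredM.
  by rewrite mulr_sumr; apply: eq_bigr => i _; rewrite mulrA.
- by rewrite mulf_neq0.
move=> tc ht; case/negP: tc; set y := t / c.
have yI x : I x -> y * x \in A by move=> /ht; rewrite mulrAC.
have pw j l : y ^+ j * d * b l \in A.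
  elim: j l => [|j IH] l; first by rewrite mul1r.
  have -> : y ^+ j.+1 * d * b l = y * (y ^+ j * d * b l) by rewrite exprS; ring.
  by apply: yI; apply: single.
apply/inA_P => v Sv; apply: (@vge_bounded_powers _ _ c); first by rewrite mulf_neq0.
move=> j; have -> : c * y ^+ j = y ^+ j * d * b k by rewrite /c; ring.
by have /inA_P := pw j k; apply.
Qed.

(** The inverse of the ideal (1, r) consists of denominators of r. One term of its partition of
    unity is a unit at v, and so is then its coefficient, as 1 and r have no pole at v. *)
Lemma local_denominator v r : ~ S v -> vge v 0 r ->
  exists s, [/\ s \in A, s != 0, v s = 0 & s * r \in A].
Proof.
move=> Sv vr.
pose b (i : 'I_2) : K := if i == 0 then 1 else r.
have [|a [ha hs]] := @fractional_ideal_invertible 2 b.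
  by exists 0; rewrite /b eqxx oner_neq0.
have aA k : a k \in A by have := ha k 0; rewrite /b eqxx mulr1.
have ar k : a k * r \in A by have := ha k 1; rewrite /b.
have [|i] := @vge_sum_unit _ v _ (fun k => a k * b k) _ hs.
  by move=> i; have /inA_P := ha i i; apply.
rewrite mulf_eq0 negb_or => /andP[ai0 bi0]; rewrite pvalM // => e.
exists (a i); split=> //.
have := aA i; move=> /inA_P/(_ v Sv); rewrite vgeE // => vai.
suff : 0 <= v (b i) by lia.
by move: bi0; rewrite /b; case: (i == 0) => r0; [rewrite pval1 | rewrite -vgeE].
Qed.

Section Congruence.
Variable c : K.
Definition cong x y := (x - y) / c \in A.

Lemma cong_refl x : cong x x. Proof. by rewrite /cong subrr mul0r rpred0. Qed.

Lemma cong_sym x y : cong x y -> cong y x.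
Proof. by rewrite /cong -rpredN -mulNr opprB. Qed.

Lemma cong_trans y x w : cong x y -> cong y w -> cong x w.
Proof. by move=> h /(rpredD h); rewrite -mulrDl addrA subrK. Qed.

Lemma congD x y x' y' : cong x y -> cong x' y' -> cong (x + x') (y + y').
Proof. by move=> h /(rpredD h); rewrite -mulrDl /cong opprD addrACA. Qed.

Lemma congN x y : cong x y -> cong (- x) (- y).
Proof. by rewrite /cong -opprD mulNr rpredN. Qed.

Lemma congM x y x' y' : y \in A -> x' \in A ->
  cong x y -> cong x' y' -> cong (x * x') (y * y').
Proof.
move=> yA xA h h'; have -> : cong (x * x') (y * y') =
    ((x - y) / c * x' + y * ((x' - y') / c) \in A).
  by rewrite /cong; congr (_ \in A); ring.
by apply: rpredD; apply: rpredM.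
Qed.

End Congruence.

(* In the finite ring A / cA the unit ideal generated by the products a_k b_k is
   split into orthogonal idempotents, on each of which one of the a_k generates
   L(D); they are glued to a single generator. *)
Lemma generator_mod_aux (D : place K -> int) c (s : seq (K * K)) w r :
  c \in A -> c != 0 ->
  (forall p, p \in s -> inL S D p.1 /\ inL S (fun v => - D v) p.2) ->
  w \in A -> r \in A -> cong c (r * r) r ->
  cong c r (w * \sum_(p <- s) p.1 * p.2) ->
  exists a b, [/\ inL S D a, inL S (fun v => - D v) b & cong c (a * b) r].
Proof.
move=> cA c0; elim: s w r => [|[a1 b1] s IH] w r hs wA rA rr.
  rewrite big_nil mulr0 => r0; exists 0, 0; split; try exact: inL0.
  by rewrite mul0r; exact: cong_sym.
rewrite big_cons /=; set t := \sum_(p <- s) _ => rt.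
have [/= ha1 hb1] := hs _ (mem_head _ _).
have hs' p : p \in s -> inL S D p.1 /\ inL S (fun v => - D v) p.2.
  by move=> ps; apply: hs; rewrite inE ps orbT.
have qA : w * (a1 * b1) \in A by rewrite rpredM //; exact: inLMA ha1 hb1.
have tA : t \in A.
  rewrite /t big_seq; apply: rpred_sum => x xs; have [h1 h2] := hs' x xs.
  exact: inLMA h1 h2.
rewrite mulrDr in rt; set q := w * (a1 * b1) in rt qA; pose p := r * q.
have pA : p \in A by rewrite rpredM.
have [[//|m] _ idem] := power_idempotent hK cA c0 pA.
(* The idempotent of the part of r on which w a1 b1 is invertible modulo c. On the rest r' = r - e
   it is nilpotent, and the induction takes over. *)
set e := p ^+ m.+1 in idem.
have eA : e \in A by rewrite rpredX.
have ee : cong c (e * e) e by rewrite -exprD.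
have re : cong c (r * e) e.
  rewrite /e exprS mulrA; apply: congM; rewrite ?rpredX //; last exact: cong_refl.
  by rewrite /p mulrA; apply: congM => //; exact: cong_refl.
pose r' := r - e.
have r'A : r' \in A by rewrite rpredB.
have er' : cong c (e * r') 0.
  rewrite mulrBr -(subrr e); apply: congD; first by rewrite mulrC.
  exact: congN.
have r'r' : cong c (r' * r') r'.
  rewrite {1}/r' mulrBl -[X in cong c _ X]subr0; apply: congD; last first.
    exact: congN.
  by rewrite mulrBr; apply: congD => //; apply: congN.
have rX n : cong c r (r ^+ n.+1).
  elim: n => [|n IHn]; first exact: cong_refl.
  apply: cong_trans (cong_sym rr) _; rewrite exprS; apply: congM => //.
  exact: cong_refl.
(* The quotient of r^(m+1) - p^(m+1) by r - p. Modulo c the former is r' and the latter is r w t, so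
   r' is a multiple of the remaining sum t. *)
pose Q := \sum_(i < m.+1) r ^+ (m - i) * p ^+ i.
have QA : Q \in A by apply: rpred_sum => i _; rewrite rpredM ?rpredX.
have r't : cong c r' (r * Q * w * t).
  apply: (@cong_trans _ (r ^+ m.+1 - e)).
    by apply: congD; [exact: rX | exact: cong_refl].
  rewrite /e subrXX -/Q; have -> : r * Q * w * t = (r * (w * t)) * Q by ring.
  apply: congM => //; rewrite ?rpredM //; last exact: cong_refl.
  apply: (@cong_trans _ (r * r - r * q)).
    by apply: congD; [exact: cong_sym | exact: cong_refl].
  rewrite -mulrBr; apply: congM => //; rewrite ?rpredB //; first exact: cong_refl.
  have -> : w * t = q + w * t - q by ring.
  by apply: congD => //; exact: cong_refl.
have [|a [b [ha hb ab]]] := IH _ r' hs' _ r'A r'r' r't; first by rewrite !rpredM.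
have bA : a * b \in A by exact: inLMA ha hb.
have abA : a * b1 \in A by exact: inLMA ha hb1.
have a1bA : a1 * b \in A by exact: inLMA ha1 hb.
(* a1 is the generator on e and a the one on r'; the factor p^m r w turns a1 b1 into e. The cross
   terms vanish because e r' is 0 modulo c. *)
exists (e * a1 + r' * a), (e * (p ^+ m * r * w) * b1 + r' * b); split.
- by apply: inLD; apply: inLZ.
- by apply: inLD; apply: inLZ => //; rewrite !rpredM ?rpredX.
have -> : (e * a1 + r' * a) * (e * (p ^+ m * r * w) * b1 + r' * b) =
    (e * e * e + r' * r' * (a * b)) +
    (e * r') * (a1 * b + (p ^+ m * r * w) * (a * b1)).
  have eE : e = p ^+ m * (r * (w * (a1 * b1))) by rewrite /e exprSr.
  rewrite {3}eE; move: (p ^+ m) (e) (r') => pm e' r''; ring.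
rewrite -[X in cong c _ X]addr0; apply: congD; last first.
  rewrite -[X in cong c _ X](mul0r (a1 * b + (p ^+ m * r * w) * (a * b1))).
  apply: congM; [exact: rpred0 | | exact: er' | exact: cong_refl].
  by apply: rpredD => //; apply: rpredM => //; rewrite !rpredM ?rpredX.
have -> : r = e + r' by rewrite /r' addrC subrK.
apply: congD.
  by apply: (cong_trans _ ee); apply: congM; [exact: eA | exact: eA | exact: ee | exact: cong_refl].
apply: (cong_trans _ r'r'); apply: congM; [exact: r'A | exact: bA | exact: r'r' | exact: ab].
Qed.

Lemma generator_mod (D : place K -> int) c : is_div S D -> c \in A -> c != 0 ->
  exists a b, [/\ inL S D a, inL S (fun v => - D v) b, a * b != 0 & cong c (a * b) 1].
Proof.
move=> [m [a [b [ha hb ab]]]] cA c0.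
have [| | | |a' [b' [ha' hb' c']]] :=
    @generator_mod_aux D c [seq (a k, b k) | k <- enum 'I_m] 1 1 cA c0 _ (rpred1 _).
- by move=> p /mapP[k _ ->]; split; [exact: ha | exact: hb].
- exact: rpred1.
- by rewrite mulr1; exact: cong_refl.
- by rewrite big_map big_enum /= ab mulr1; exact: cong_refl.
(* If the product is 0, the congruence makes c a unit of A, and any non-zero a_k b_k will do. *)
have [z'|nz] := eqVneq (a' * b') 0; last by exists a', b'.
have [k k0] : exists k, a k * b k != 0.
  apply: contrapT => no; move/eqP: (oner_neq0 K); apply; rewrite -ab big1 // => k _.
  by apply/eqP; apply: contrapT => /negP h; apply: no; exists k.
exists (a k), (b k); split => //.
have cVA : c^-1 \in A.
  by move: c'; rewrite /cong z' sub0r mulNr mul1r rpredN.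
by rewrite /cong rpredM // rpredB ?rpred1 //; exact: inLMA (ha k) (hb k).
Qed.

(** Strong approximation by hand: al is chosen with s = al d equal to 1 modulo a, then be with be g
    equal to 1 modulo s. Thus s is coprime to a be g, and the second row is solved for explicitly,
    as multiples of g and d. *)
Lemma sl2_matrix (D I : place K -> int) a : is_div S D -> is_div S I ->
  a \in A -> a != 0 ->
  exists al be ga de, [/\ inL S I al, inL S (fun v => - I v) de,
    inL S (fun v => D v + I v) be, inL S (fun v => - (D v + I v)) ga &
    al * de - a * be * ga = 1].
Proof.
move=> hD hI aA a0.
have [al [d [hal hd s0 hs]]] := generator_mod hI aA a0.
set s := al * d in s0 hs.
have sA : s \in A by exact: inLMA hal hd.
have [be [g [hbe hg _ ht]]] := generator_mod (is_divD hD hI) sA s0.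
pose r := (s - 1) / a; pose r' := (be * g - 1) / s.
have rE : s = 1 + a * r by rewrite /r [a * _]mulrC divfK // addrC subrK.
have r'E : be * g = 1 + s * r' by rewrite /r' [s * _]mulrC divfK // addrC subrK.
exists al, be, (r * g), ((1 - r' + s * r') * d); split=> //.
- by apply: inLZ hd; rewrite rpredD ?rpredB ?rpred1 // rpredM.
- by apply: inLZ hg.
have -> : al * ((1 - r' + s * r') * d) = s * (1 - r' + s * r') by rewrite /s; ring.
have -> : a * be * (r * g) = (a * r) * (be * g) by ring.
have -> : a * r = s - 1 by rewrite rE addrC addKr.
by rewrite r'E; ring.
Qed.

End Dedekind.

(** * Twisting hyperbolic planes *)

(** Give al, be, ga, de the degrees i, d + i, -(d + i), -i, give xi, eta, mu the degrees d, -d, 0,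
    and a degree 0: the three expressions are homogeneous. *)
Lemma sl2_coef_vge (K : fieldType) (v : place K) (d i : int) (a al be ga de xi eta mu : K) :
  vge v 0 a -> vge v i al -> vge v (- i) de -> vge v (d + i) be -> vge v (- (d + i)) ga ->
  vge v d xi -> vge v (- d) eta -> vge v 0 mu ->
  [/\ vge v 0 (mu * be * ga - xi * al * ga + eta * be * de),
      vge v (d + 2 * i) (al ^+ 2 * xi - al * be * mu - a * be ^+ 2 * eta) &
      vge v (- (d + 2 * i)) (de ^+ 2 * eta + ga * de * mu - a * ga ^+ 2 * xi)].
Proof.
move=> va val vde vbe vga vxi veta vmu.
have vM p q p1 p2 m : vge v p p1 -> vge v q p2 -> m = p + q -> vge v m (p1 * p2).
  by move=> h1 h2 ->; apply: vgeM.
split; [apply: vgeD; first apply: vgeB | apply: vgeB; first apply: vgeB |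
        apply: vgeB; first apply: vgeD].
- apply: (vM _ _ _ _ _ (vM _ _ _ _ _ vmu vbe (erefl _)) vga); lia.
- apply: (vM _ _ _ _ _ (vM _ _ _ _ _ vxi val (erefl _)) vga); lia.
- apply: (vM _ _ _ _ _ (vM _ _ _ _ _ veta vbe (erefl _)) vde); lia.
- apply: (vM _ _ _ _ _ (vM _ _ _ _ _ val val (erefl _)) vxi); lia.
- apply: (vM _ _ _ _ _ (vM _ _ _ _ _ val vbe (erefl _)) vmu); lia.
- apply: (vM _ _ _ _ _ (vM _ _ _ _ _ va (vM _ _ _ _ _ vbe vbe (erefl _)) (erefl _)) veta); lia.
- apply: (vM _ _ _ _ _ (vM _ _ _ _ _ vde vde (erefl _)) veta); lia.
- apply: (vM _ _ _ _ _ (vM _ _ _ _ _ vga vde (erefl _)) vmu); lia.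
- apply: (vM _ _ _ _ _ (vM _ _ _ _ _ va (vM _ _ _ _ _ vga vga (erefl _)) (erefl _)) vxi); lia.
Qed.

Section Eichler.
Variables (K : fieldType) (E : lmodType K) (b : E -> E -> K).
Hypotheses (bC : forall u u', b u u' = b u' u)
  (bD : forall u u' w, b (u + u') w = b u w + b u' w)
  (bZ : forall c u w, b (c *: u) w = c * b u w).

Lemma bf0l w : b 0 w = 0.
Proof. by have := bZ 0 0 w; rewrite scale0r mul0r. Qed.

Lemma bfNl u w : b (- u) w = - b u w.
Proof. by rewrite -scaleN1r bZ mulN1r. Qed.

Lemma bfBl u u' w : b (u - u') w = b u w - b u' w.
Proof. by rewrite bD bfNl. Qed.

Lemma bf_suml (I : Type) (r : seq I) (P : pred I) (f : I -> E) w :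
  b (\sum_(i <- r | P i) f i) w = \sum_(i <- r | P i) b (f i) w.
Proof. by elim/big_rec2: _ => [|i y x _ <-]; [exact: bf0l | exact: bD]. Qed.

Lemma bfDr w u u' : b w (u + u') = b w u + b w u'.
Proof. by rewrite !(bC w). Qed.

Lemma bfZr w c u : b w (c *: u) = c * b w u.
Proof. by rewrite !(bC w). Qed.

Lemma bfBr w u u' : b w (u - u') = b w u - b w u'.
Proof. by rewrite !(bC w) bfBl. Qed.

Lemma bf_sumr (I : Type) (r : seq I) (P : pred I) (f : I -> E) w :
  b w (\sum_(i <- r | P i) f i) = \sum_(i <- r | P i) b w (f i).
Proof. by rewrite bC bf_suml; apply: eq_bigr => i _; rewrite bC. Qed.

(* The image in the orthogonal group of the matrix [[al, a be], [ga, de]] of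
   SL_2(K), which acts on the ternary space spanned by x, w, y as on the
   trace-zero matrices, and trivially on its orthogonal complement. *)
Section Ternary.
Variables (x y w : E) (a : K).
Hypotheses (bxx : b x x = 0) (byy : b y y = 0) (bxy : b x y = 1)
  (bwx : b w x = 0) (bwy : b w y = 0) (bww : b w w = 2 * a).

Definition sl2_coef (al be ga de : K) (u : E) : K * K * K :=
  let xi := b u y in let eta := b u x in let mu := b u w in
  (mu * be * ga - xi * al * ga + eta * be * de,
   al ^+ 2 * xi - al * be * mu - a * be ^+ 2 * eta,
   de ^+ 2 * eta + ga * de * mu - a * ga ^+ 2 * xi).

Definition sl2_act (al be ga de : K) (u : E) : E :=
  let: (k, X, Y) := sl2_coef al be ga de u in
  u + (k *: w + (X - b u y) *: x + (Y - b u x) *: y).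

Lemma sl2_act_linear al be ga de c u u' :
  sl2_act al be ga de (c *: u + u') = c *: sl2_act al be ga de u + sl2_act al be ga de u'.
Proof.
have comb l1 l2 l3 m1 m2 m3 : (c *: u + u') +
    ((c * l1 + m1) *: w + (c * l2 + m2) *: x + (c * l3 + m3) *: y) =
    c *: (u + (l1 *: w + l2 *: x + l3 *: y)) + (u' + (m1 *: w + m2 *: x + m3 *: y)).
  rewrite !scalerDl !scalerDr !scalerA [RHS]addrACA; congr (_ + _).
  by rewrite [RHS]addrACA; congr (_ + _); rewrite [RHS]addrACA.
rewrite /sl2_act /sl2_coef -comb !bD !bZ; congr (_ + (_ *: _ + _ *: _ + _ *: _)); ring.
Qed.

Lemma sl2_act_coords al be ga de u :
  let: (k, X, Y) := sl2_coef al be ga de u in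
  [/\ b (sl2_act al be ga de u) y = X, b (sl2_act al be ga de u) x = Y &
      b (sl2_act al be ga de u) w = b u w + 2 * a * k].
Proof.
rewrite /sl2_act /sl2_coef.
have bxw : b x w = 0 by rewrite bC.
have byw : b y w = 0 by rewrite bC.
have byx : b y x = 1 by rewrite bC.
by split; rewrite !bD !bZ ?bxx ?byy ?bxy ?byx ?bwx ?bwy ?bww ?bxw ?byw; ring.
Qed.

Lemma sl2_actK al be ga de : al * de - a * be * ga = 1 ->
  cancel (sl2_act al be ga de) (sl2_act de (- be) (- ga) al).
Proof.
move=> det u; have := sl2_act_coords al be ga de u.
case E1: (sl2_coef al be ga de u) => [[k X] Y] [eX eY ew].
set t := sl2_act al be ga de u in eX eY ew *.
have tE : t = u + (k *: w + (X - b u y) *: x + (Y - b u x) *: y) by rewrite /t /sl2_act E1.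
move: E1; rewrite /sl2_coef => -[kE XE YE]; rewrite XE in eX; rewrite YE in eY; rewrite kE in ew.
rewrite /sl2_act /sl2_coef eX eY ew {}tE.
(* The determinant, equal to 1, is inserted wherever the degree in the matrix entries is too low;
   the identities then become homogeneous and [ring] proves them. *)
have muE : b u w + 2 * a * k = b u w * (al * de - a * be * ga) + 2 * a * k by rewrite det mulr1.
have -> : (b u w + 2 * a * k) * - be * - ga - X * de * - ga + Y * - be * al = - k.
  by rewrite muE -[RHS]mulr1 -[X in _ = _ * X]det -kE -XE -YE; ring.
have -> : de ^+ 2 * X - de * - be * (b u w + 2 * a * k) - a * (- be) ^+ 2 * Y = b u y.
  by rewrite muE -[RHS]mulr1 -(expr1n _ 2) -[X in _ = _ * X ^+ 2]det -kE -XE -YE; ring.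
have -> : al ^+ 2 * Y + - ga * al * (b u w + 2 * a * k) - a * (- ga) ^+ 2 * X = b u x.
  by rewrite muE -[RHS]mulr1 -(expr1n _ 2) -[X in _ = _ * X ^+ 2]det -kE -XE -YE; ring.
rewrite -[RHS]addr0 -addrA; congr (_ + _).
rewrite -(opprB X) -(opprB Y) !scaleNr -!opprD subrr //.
Qed.

Lemma sl2_act_isometry al be ga de u u' : al * de - a * be * ga = 1 ->
  b (sl2_act al be ga de u) (sl2_act al be ga de u') = b u u'.
Proof.
move=> det; have := sl2_act_coords al be ga de u.
case E1: (sl2_coef al be ga de u) => [[k X] Y] [eX eY ew].
case E2: (sl2_coef al be ga de u') => [[k' X'] Y'].
have tE : sl2_act al be ga de u = u + (k *: w + (X - b u y) *: x + (Y - b u x) *: y).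
  by rewrite /sl2_act E1.
have tE' : sl2_act al be ga de u' =
    u' + (k' *: w + (X' - b u' y) *: x + (Y' - b u' x) *: y).
  by rewrite /sl2_act E2.
move: E1 E2; rewrite /sl2_coef => -[kE XE YE] [kE' XE' YE'].
rewrite XE in eX; rewrite YE in eY; rewrite kE in ew.
rewrite tE' !bfDr !bfZr eX eY ew tE !bD !bZ !(bC _ u').
suff e : k * b u' w + k' * b u w + 2 * a * k * k' + X * Y' + X' * Y =
    b u y * b u' x + b u x * b u' y.
  apply/eqP; rewrite -subr_eq0; apply/eqP; move/eqP: e; rewrite -subr_eq0 => /eqP <-; ring.
transitivity ((k * b u' w + k' * b u w) * (al * de - a * be * ga)
    + 2 * a * k * k' + X * Y' + X' * Y); first by rewrite det mulr1.
rewrite -[RHS]mulr1 -(expr1n _ 2) -[X in _ = _ * X ^+ 2]det -kE -XE -YE -kE' -XE' -YE'.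
by ring.
Qed.

End Ternary.
End Eichler.

(** * Self-dual lattices with a torus action, and their hyperbolic frames *)

Section Frames.
Variables (F : finFieldType) (K : fieldType) (iota : {rmorphism F -> K}).
Hypothesis hK : function_field iota.
Variable S : set (place K).
Local Notation A := (S_integral S).
Variable z : K.
Hypotheses (zA : z \in A) (zVA : z^-1 \notin A).
Hypotheses (two0 : (2 : K) != 0) (halfA : (2 : K)^-1 \in A).

Variables (E : lmodType K) (b : E -> E -> K).
Hypotheses (bC : forall u u', b u u' = b u' u)
  (bD : forall u u' w, b (u + u') w = b u w + b u' w)
  (bZ : forall c u w, b (c *: u) w = c * b u w).
Variables (n : nat) (f : {linear E -> 'rV[K]_n}).
Hypothesis f_bij : bijective f.

Variable L : E -> Prop.
Hypotheses (LD : forall u u', L u -> L u' -> L (u + u'))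
  (LZ : forall c u, c \in A -> L u -> L (c *: u))
  (Lgen : exists m (g : 'I_m -> E), (forall i, L (g i)) /\
     forall u, L u -> exists c : 'I_m -> K, (forall i, c i \in A) /\ u = \sum_i c i *: g i)
  (Lspan : forall u, exists2 d, (d \in A) && (d != 0) & L (d *: u))
  (Lint : forall u u', L u -> L u' -> b u u' \in A)
  (Ldual : forall u, (forall u', L u' -> b u u' \in A) -> L u)
  (nondeg : forall u, (forall w, L w -> b u w = 0) -> u = 0).

Local Notation bf0l := (@bf0l K E b bZ).
Local Notation bfNl := (@bfNl K E b bZ).
Local Notation bfBl := (@bfBl K E b bD bZ).
Local Notation bf_suml := (@bf_suml K E b bD bZ).
Local Notation bfDr := (@bfDr K E b bC bD).
Local Notation bfZr := (@bfZr K E b bC bZ).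
Local Notation bfBr := (@bfBr K E b bC bD bZ).
Local Notation bf_sumr := (@bf_sumr K E b bC bD bZ).

Lemma lat0 : L 0.
Proof. by have [d /andP[dA _]] := Lspan 0; rewrite scaler0. Qed.

Lemma lat_sum (I : Type) (r : seq I) (P : pred I) (h : I -> E) :
  (forall i, P i -> L (h i)) -> L (\sum_(i <- r | P i) h i).
Proof. by move=> hh; elim/big_ind: _ => //; exact: lat0. Qed.

Variable rho : K -> E -> E.
Hypotheses (rhoD : forall a u u', a != 0 -> rho a (u + u') = rho a u + rho a u')
  (rhoZ : forall a c u, a != 0 -> rho a (c *: u) = c *: rho a u)
  (rho_iso : forall a u u', a != 0 -> b (rho a u) (rho a u') = b u u').

Definition weight (i : int) (u : E) : Prop := forall a, a != 0 -> rho a u = a ^ i *: u.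

Hypotheses (Ldec : forall u, L u -> exists s : seq E,
    (forall x, x \in s -> L x /\ exists i, weight i x) /\ u = \sum_(x <- s) x)
  (K_big : forall i : int, i != 0 -> exists2 a : K, a != 0 & a ^ i != 1).

Lemma weightD i u u' : weight i u -> weight i u' -> weight i (u + u').
Proof. by move=> h h' a a0; rewrite rhoD // h // h' // scalerDr. Qed.

Lemma weightZ i c u : weight i u -> weight i (c *: u).
Proof. by move=> h a a0; rewrite rhoZ // h // !scalerA mulrC. Qed.

Lemma weight0 i : weight i 0.
Proof. by move=> a a0; have := rhoZ 0 0 a0; rewrite !scale0r scaler0. Qed.

Lemma weight_sum i (I : Type) (r : seq I) (P : pred I) (h : I -> E) :
  (forall k, P k -> weight i (h k)) -> weight i (\sum_(k <- r | P k) h k).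
Proof. by move=> hh; elim/big_ind: _ => //; [exact: weight0 | exact: weightD]. Qed.

Lemma weight_form i j u w : weight i u -> weight j w -> i + j != 0 -> b u w = 0.
Proof.
move=> hu hw /K_big [a a0 ai]; apply/eqP; move: ai; apply: contraNT => buw.
have := rho_iso u w a0; rewrite hu // hw // bZ bfZr mulrA -expfzDr // => /eqP.
by rewrite -subr_eq0 -{2}[b u w]mul1r -mulrBl mulf_eq0 (negbTE buw) orbF subr_eq0.
Qed.

(** The sum of the summands of u of weight i. It is characterized by its pairings, the weights other
    than i being orthogonal to the weight -i. *)
Lemma weight_part i u : L u -> exists u', [/\ L u', weight i u' &
  forall x, weight (- i) x -> b x u' = b x u].
Proof.
move=> /Ldec [s [hs ->]]; elim: s hs => [|x s IH] hs.
  by exists 0; split=> [||x _]; [exact: lat0 | exact: weight0 | rewrite big_nil].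
have [|u' [Lu' wu' hu']] := IH; first by move=> y ys; apply: hs; rewrite inE ys orbT.
have [Lx [j wx]] := hs _ (mem_head _ _).
have [eij|neij] := eqVneq j i.
  exists (x + u'); split; [exact: LD | by apply: weightD => //; rewrite -eij |].
  by move=> y wy; rewrite big_cons !bfDr hu'.
exists u'; split=> // y wy; rewrite big_cons bfDr hu' // (weight_form wy wx) ?add0r //.
by rewrite addrC subr_eq0.
Qed.

Section Residual.
Variables (r : nat) (x y : nat -> E).

(** For hyperbolic pairs x l, y l, the orthogonal projection onto the complement of the planes that
    they span. *)
Definition resid (u : E) : E :=
  u - \sum_(l < r) (b u (y l) *: x l + b u (x l) *: y l).

Lemma residD u u' : resid (u + u') = resid u + resid u'.
Proof.
rewrite /resid addrACA -opprD -big_split /=; congr (_ - _).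
by apply: eq_bigr => l _; rewrite !bD !scalerDl addrACA.
Qed.

Lemma residZ c u : resid (c *: u) = c *: resid u.
Proof.
rewrite /resid scalerBr scaler_sumr; congr (_ - _).
by apply: eq_bigr => l _; rewrite !bZ scalerDr !scalerA.
Qed.

Definition hyperbolic : Prop :=
  [/\ forall l k, (l < r)%N -> (k < r)%N -> b (x l) (y k) = (l == k)%:R,
      forall l k, (l < r)%N -> (k < r)%N -> b (x l) (x k) = 0 &
      forall l k, (l < r)%N -> (k < r)%N -> b (y l) (y k) = 0].

Hypothesis hyp : hyperbolic.

Lemma form_sum_hyp u l (cx cy : 'I_r -> K) : (l < r)%N ->
  b (u - \sum_(k < r) (cx k *: x k + cy k *: y k)) (x l) = b u (x l) - \sum_(k < r | k == l :> nat) cy k /\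
  b (u - \sum_(k < r) (cx k *: x k + cy k *: y k)) (y l) = b u (y l) - \sum_(k < r | k == l :> nat) cx k.
Proof.
have [hxy hxx hyy] := hyp; move=> lr; rewrite !bfBl !bf_suml; split; congr (_ - _).
  rewrite [RHS]big_mkcond; apply: eq_bigr => k _; rewrite bD !bZ hxx // mulr0 add0r.
  by rewrite (bC (y k)) hxy // eq_sym; case: eqP; rewrite ?mulr1 ?mulr0.
rewrite [RHS]big_mkcond; apply: eq_bigr => k _; rewrite bD !bZ hyy // mulr0 addr0.
by rewrite hxy //; case: eqP; rewrite ?mulr1 ?mulr0.
Qed.

Lemma resid_orth u l : (l < r)%N -> b (resid u) (x l) = 0 /\ b (resid u) (y l) = 0.
Proof.
move=> lr.
have [-> ->] := form_sum_hyp u (fun k => b u (y k)) (fun k => b u (x k)) lr.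
by rewrite !(big_pred1 (Ordinal lr)) /= ?subrr // => k; rewrite -val_eqE.
Qed.

Lemma resid_x l : (l < r)%N -> resid (x l) = 0.
Proof.
have [hxy hxx hyy] := hyp; move=> lr; rewrite /resid (bigD1 (Ordinal lr)) //= hxy // eqxx hxx //.
rewrite scale1r scale0r addr0 big1 ?addr0 ?subrr // => k kl.
by rewrite hxy // hxx // eq_sym (negbTE kl : (k == l :> nat) = false) !scale0r addr0.
Qed.

Lemma resid_y l : (l < r)%N -> resid (y l) = 0.
Proof.
have [hxy hxx hyy] := hyp; move=> lr; rewrite /resid (bigD1 (Ordinal lr)) //= hyy // bC hxy // eqxx.
rewrite scale1r scale0r add0r big1 ?addr0 ?subrr // => k kl.
by rewrite hyy // bC hxy // (negbTE kl : (k == l :> nat) = false) !scale0r addr0.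
Qed.

Lemma form_resid u w : b u w = b (resid u) (resid w) +
  \sum_(l < r) (b u (y l) * b w (x l) + b u (x l) * b w (y l)).
Proof.
have -> : b (resid u) (resid w) = b (resid u) w.
  rewrite {2}/resid bfBr bf_sumr big1 ?subr0 // => l _.
  by have [e1 e2] := resid_orth u (ltn_ord l); rewrite bfDr !bfZr e1 e2 !mulr0 addr0.
rewrite /resid bfBl bf_suml.
under [X in _ - X]eq_bigr => l _ do rewrite bD !bZ (bC (x l)) (bC (y l)).
by rewrite subrK.
Qed.

(** The pairings with the y l show that the x l are independent. The bound ends the search for a
    maximal frame. *)
Lemma hyperbolic_bound : (r <= n)%N.
Proof.
have [hxy hxx hyy] := hyp; rewrite leqNgt; apply/negP => nr.
pose M : 'M[K]_(r, n) := \matrix_l f (x l).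
have [u /sub_kermxP uM u0] : exists2 u : 'rV_r, (u <= kermx M)%MS & u != 0.
  apply/rowV0Pn; rewrite -mxrank_eq0 mxrank_ker -lt0n subn_gt0.
  exact: leq_ltn_trans (rank_leq_col M) nr.
have fu : f (\sum_l u 0 l *: x l) = 0.
  rewrite -uM mulmx_sum_row linear_sum; apply: eq_bigr => l _.
  by rewrite linearZ rowK.
have {}fu : \sum_l u 0 l *: x l = 0.
  by apply: (bij_inj f_bij); rewrite fu linear0.
case/rV0Pn: u0 => l /eqP; apply.
have := bf0l (y l); rewrite -fu bf_suml (bigD1 l) //= bZ hxy // eqxx mulr1.
rewrite big1 ?addr0 // => k kl; rewrite bZ hxy //.
by rewrite (negbTE kl : (k == l :> nat) = false) mulr0.
Qed.

End Residual.

(* A splitting of the lattice L into rank one pieces of nonzero weight and a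
   rest: L is the sum of the L(D_l) x_l, of the L(-D_l) y_l and of its
   intersection with the orthogonal complement of all x_l, y_l. *)
Definition frame (r : nat) (x y : nat -> E) (D : nat -> place K -> int) (wt : nat -> int) :=
  [/\ forall l, (l < r)%N -> [/\ 0 < wt l, weight (wt l) (x l), weight (- wt l) (y l) & is_div S (D l)],
      forall l k, (l < r)%N -> (k < r)%N -> b (x l) (y k) = (l == k)%:R &
      forall l c, (l < r)%N -> (inL S (D l) c -> L (c *: x l)) /\
                           (inL S (fun v => - D l v) c -> L (c *: y l))].

Section FrameTheory.
Variables (r : nat) (x y : nat -> E) (D : nat -> place K -> int) (wt : nat -> int).
Hypothesis fr : frame r x y D wt.

Lemma frame_hyperbolic : hyperbolic r x y.
Proof.
have [h1 h2 h3] := fr; split=> // l k /h1[wl xl yl _] /h1[wk xk yk _].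
  by apply: weight_form xl xk _; lia.
by apply: weight_form yl yk _; lia.
Qed.

Lemma frame_coords u l : (l < r)%N -> L u ->
  inL S (D l) (b u (y l)) /\ inL S (fun v => - D l v) (b u (x l)).
Proof.
have [h1 h2 h3] := fr; move=> lr Lu; have [_ _ _ Dl] := h1 l lr.
split.
  by apply: inL_dual => // c hc; rewrite mulrC -bfZr; apply: Lint => //; apply: (h3 l c lr).2.
apply: inL_dual; first exact: is_divN.
move=> c hc; rewrite mulrC -bfZr; apply: Lint => //; apply: (h3 l c lr).1.
by move=> v /hc; rewrite opprK.
Qed.

Lemma frame_resid_lat u : L u -> L (resid r x y u).
Proof.
have [h1 h2 h3] := fr; move=> Lu; rewrite /resid -scaleN1r; apply: LD => //.
apply: LZ; first by rewrite rpredN rpred1.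
apply: lat_sum => l _; have [hx hy] := frame_coords (ltn_ord l) Lu.
by apply: LD; [apply: (h3 l _ (ltn_ord l)).1 | apply: (h3 l _ (ltn_ord l)).2].
Qed.

Lemma frame_resid_weight i u : weight i u -> weight i (resid r x y u).
Proof.
have [h1 h2 h3] := fr; move=> wu; rewrite /resid -scaleN1r; apply: weightD => //; apply: weightZ.
apply: weight_sum => l _; have [_ wx wy _] := h1 l (ltn_ord l).
apply: weightD.
  have [->|ne] := eqVneq i (wt l); first exact: weightZ.
  by rewrite (weight_form wu wy) ?scale0r ?subr_eq0 //; exact: weight0.
have [->|ne] := eqVneq i (- wt l); first exact: weightZ.
by rewrite (weight_form wu wx) ?scale0r -?addr_eq0 ?opprK //; [exact: weight0 | rewrite -(opprK (wt l)) subr_eq0].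
Qed.

(** If the weight is negative, the residual vector pairs non-trivially with some lattice vector; the
    component of opposite weight of the latter, projected off the frame, is still non-zero. *)
Lemma frame_positive_vector u i : i != 0 -> weight i u -> resid r x y u != 0 ->
  exists j x0, [/\ 0 < j, weight j x0, x0 != 0 &
    forall l, (l < r)%N -> b x0 (x l) = 0 /\ b x0 (y l) = 0].
Proof.
move=> i0 wu ru0; have wru := frame_resid_weight wu.
have orth w := resid_orth frame_hyperbolic w.
have [ipos|ineg] := ltP 0 i; first by exists i, (resid r x y u); split=> // l; exact: orth.
have [w Lw bw] : exists2 w, L w & b (resid r x y u) w != 0.
  apply: contrapT => no; move/eqP: ru0; apply; apply: nondeg => w Lw.
  by apply/eqP; apply: contrapT => /negP h; apply: no; exists w.
have [w' [Lw' ww' bw']] := weight_part (- i) Lw.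
exists (- i), (resid r x y w'); split.
- by move: i0 ineg; lia.
- exact: frame_resid_weight.
- apply: contraNneq bw => rw0; rewrite -bw' ?opprK //.
  rewrite (form_resid frame_hyperbolic) rw0 bC bf0l add0r big1 // => l _.
  have [e1 e2] := resid_orth frame_hyperbolic u (ltn_ord l).
  by rewrite e1 e2 !mul0r addr0.
- by move=> l; exact: orth.
Qed.

End FrameTheory.

Lemma lat_coef_sum m (c : 'I_m -> K) (g : 'I_m -> E) :
  (forall i, c i \in A) -> (forall i, L (g i)) -> L (\sum_i c i *: g i).
Proof. by move=> hc hg; apply: lat_sum => i _; apply: LZ. Qed.

(** The ideal b(x0, L) is generated by the b x0 (g k). Its inverse, generated by the a k, consists
    of the scalars carrying x0 into L, as L is self-dual. The partition of unity glues the parts of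
    weight -j of the g k to a partner y0 of x0. *)
Lemma frame_extend r x y D wt u i : frame r x y D wt -> i != 0 -> weight i u ->
  resid r x y u != 0 -> exists x' y' D' wt', frame r.+1 x' y' D' wt'.
Proof.
move=> fr i0 wu ru0; have [j [x0 [j0 wx0 x00 orth]]] := frame_positive_vector fr i0 wu ru0.
have hyp := frame_hyperbolic fr.
have [m [g [gL gen]]] := Lgen.
have b0 : exists k, b x0 (g k) != 0.
  apply: contrapT => no; move/eqP: x00; apply; apply: nondeg => w Lw.
  have [c [_ ->]] := gen w Lw; rewrite bf_sumr big1 // => k _; rewrite bfZr.
  suff -> : b x0 (g k) = 0 by rewrite mulr0.
  by apply/eqP; apply: contrapT => /negP h; apply: no; exists k.
have [a [hab sab]] := fractional_ideal_invertible hK zA zVA b0.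
have [D0 [hD0 haD hbD _]] := div_of_inverse hab sab.
have ax k : L (a k *: x0).
  apply: Ldual => w Lw; have [c [cA ->]] := gen w Lw.
  rewrite bf_sumr rpred_sum // => l _; rewrite bfZr bZ rpredM //.
have /choice [h hP] : forall k, exists h, [/\ L h, weight (- j) h,
    b x0 h = b x0 (g k) & forall l, (l < r)%N -> b h (x l) = 0 /\ b h (y l) = 0].
  move=> k; have [h [Lh wh hh]] := weight_part (- j) (gL k).
  exists (resid r x y h); split.
  - exact: (frame_resid_lat fr).
  - exact: (frame_resid_weight fr).
  - rewrite -hh ?opprK // (form_resid hyp x0 h) big1; last first.
      by move=> l _; have [-> ->] := orth l (ltn_ord l); rewrite !mul0r addr0.
    rewrite addr0; congr b; rewrite /resid big1 ?subr0 // => l _.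
    by have [-> ->] := orth l (ltn_ord l); rewrite !scale0r addr0.
  - by move=> l; exact: (resid_orth hyp).
pose y0 := \sum_k a k *: h k.
have by0 w : (forall k, b (h k) w = 0) -> b y0 w = 0.
  by move=> hw; rewrite bf_suml big1 // => k _; rewrite bZ hw mulr0.
have [h1 h2 h3] := fr.
exists (fun l => if l == r then x0 else x l), (fun l => if l == r then y0 else y l),
  (fun l => if l == r then D0 else D l), (fun l => if l == r then j else wt l).
split.
- move=> l; rewrite ltnS leq_eqVlt; case: eqP => [_ _|_ /= lr]; last exact: h1.
  by split=> //; apply: weight_sum => k _; apply: weightZ; case: (hP k).
- move=> l k; rewrite !ltnS (leq_eqVlt l) (leq_eqVlt k).
  case: (l =P r) => [-> _|lr /= ltl]; case: (k =P r) => [-> _|kr /= ltk].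
  + rewrite eqxx bf_sumr -sab; apply: eq_bigr => k' _.
    by rewrite bfZr; have [_ _ -> _] := hP k'.
  + have [_ ->] := orth k ltk; rewrite eq_sym; by move/eqP/negbTE: kr => ->.
  + rewrite bC by0; first by move/eqP/negbTE: lr => ->.
    by move=> k'; have [_ _ _ /(_ l ltl)[]] := hP k'.
  + exact: h2.
- move=> l c; rewrite ltnS leq_eqVlt; case: eqP => [_ _|_ /= lr]; last exact: h3.
  split=> hc.
    have -> : c *: x0 = \sum_k (c * b x0 (g k)) *: (a k *: x0).
      rewrite -{1}[c]mulr1 -sab mulr_sumr scaler_suml; apply: eq_bigr => k _.
      by rewrite scalerA; congr (_ *: _); ring.
    by apply: lat_coef_sum => // k; exact: inLMA hc (hbD k).
  rewrite scaler_sumr; under eq_bigr => k _ do rewrite scalerA.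
  apply: lat_coef_sum => [k|k]; last by case: (hP k).
  by rewrite mulrC; exact: inLMA (haD k) hc.
Qed.

Lemma frame_maximal : exists r x y D wt, frame r x y D wt /\
  forall u, weight 0 (resid r x y u).
Proof.
pose P r := exists x y D wt, frame r x y D wt.
have P0 : P 0%N by exists (fun=> 0), (fun=> 0), (fun _ _ => 0), (fun=> 0); split.
have PN : ~ P n.+1.
  move=> [x [y [D [wt fr]]]]; have := hyperbolic_bound (frame_hyperbolic fr).
  by rewrite ltnn.
have [r [[x [y [D [wt fr]]]] nP]] : exists r, P r /\ ~ P r.+1.
  apply: contrapT => h; apply: PN; elim: n.+1 => // N IH.
  by apply: contrapT => ?; apply: h; exists N.
exists r, x, y, D, wt; split=> // u.
have [d /andP[dA d0] Ldu] := Lspan u.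
suff : weight 0 (resid r x y (d *: u)).
  by move/(weightZ d^-1); rewrite residZ scalerA mulVf // scale1r.
have [s [hs ->]] := Ldec Ldu.
elim: s hs => [|w s IH] hs.
  rewrite big_nil -(scale0r 0) residZ scale0r; exact: weight0.
rewrite big_cons residD; apply: weightD; last first.
  by apply: IH => v vs; apply: hs; rewrite inE vs orbT.
have [_ [i wi]] := hs _ (mem_head _ _).
have [i0|i0] := eqVneq i 0; first by rewrite i0 in wi; exact: frame_resid_weight fr _ _ wi.
have [->|ne] := eqVneq (resid r x y w) 0; first exact: weight0.
by case: nP; exact: frame_extend fr i0 wi ne.
Qed.

(** The localization of L at v. It stands for the completed lattice, since the local isometries to
    come are defined over K. *)
Definition loc (v : place K) (u : E) : Prop :=
  exists s, [/\ s \in A, s != 0, v s = 0 & L (s *: u)].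

Section Local.
Variable v : place K.
Hypothesis Sv : ~ S v.

Lemma loc_lat u : L u -> loc v u.
Proof. by exists 1; rewrite rpred1 oner_neq0 pval1 scale1r. Qed.

Lemma locD u u' : loc v u -> loc v u' -> loc v (u + u').
Proof.
move=> [s [sA s0 vs Ls]] [t [tA t0 vt Lt]]; exists (s * t); split.
- exact: rpredM.
- by rewrite mulf_neq0.
- by rewrite pvalM // vs vt.
- rewrite scalerDr; apply: LD; last by rewrite -scalerA; apply: LZ.
  by rewrite mulrC -scalerA; apply: LZ.
Qed.

Lemma locZ c u : vge v 0 c -> loc v u -> loc v (c *: u).
Proof.
move=> /(local_denominator hK zA zVA Sv) [t [tA t0 vt tc]] [s [sA s0 vs Ls]].
exists (t * s); split; [exact: rpredM | by rewrite mulf_neq0 | by rewrite pvalM // vs vt |].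
by rewrite scalerA mulrAC -scalerA; apply: LZ.
Qed.

Lemma loc_form u u' : loc v u -> loc v u' -> vge v 0 (b u u').
Proof.
move=> [s [sA s0 vs Ls]] [t [tA t0 vt Lt]].
have /inA_P/(_ v Sv) := Lint Ls Lt; rewrite bZ bfZr mulrA mulrC => /vge_mulr; apply.
  by rewrite mulf_neq0.
by rewrite pvalM // vs vt.
Qed.

End Local.

(** Self-duality turns membership in L into the integrality of pairings, which is tested place by
    place. *)
Lemma lat_of_loc u : (forall v, ~ S v -> loc v u) -> L u.
Proof.
move=> h; apply: Ldual => w Lw; apply/inA_P => v Sv.
by apply: loc_form => //; [exact: h | exact: loc_lat].
Qed.

Section Twists.
Variables (r : nat) (x y : nat -> E) (D0 : nat -> place K -> int) (wt : nat -> int).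
Hypothesis fr : frame r x y D0 wt.
Let hyp := frame_hyperbolic fr.
Local Notation res := (resid r x y).

(** The localization at v of the lattice with the pieces L(D l) x l and L(- D l) y l and the same
    rest as L, described by coordinates. *)
Definition twist (D : nat -> place K -> int) (v : place K) (u : E) : Prop :=
  (forall l, (l < r)%N -> vge v (D l v) (b u (y l)) /\ vge v (- D l v) (b u (x l))) /\
  loc v (res u).

Lemma twist_form D v u u' : ~ S v -> twist D v u -> twist D v u' -> vge v 0 (b u u').
Proof.
move=> Sv [h1 h2] [h1' h2']; rewrite (form_resid hyp); apply: vgeD; first exact: loc_form.
apply: vge_sum => l _; have [? ?] := h1 l (ltn_ord l); have [? ?] := h1' l (ltn_ord l).
apply: vgeD; first by rewrite -(subrr (D l v)); apply: vgeM.
by rewrite -(addNr (D l v)); apply: vgeM.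
Qed.

Lemma twist_frame v u : ~ S v -> twist D0 v u <-> loc v u.
Proof.
have [h1 h2 h3] := fr; move=> Sv; split=> [[hc hr]|[s [sA s0 vs Ls]]].
  rewrite -(subrK (\sum_(l < r) (b u (y l) *: x l + b u (x l) *: y l)) u); apply: locD => //.
  elim/big_ind: _ => //; first by rewrite -(scale0r 0); apply: locZ (vge0 _ _) _ => //; exact: loc_lat lat0.
    exact: locD.
  move=> l _; have [vx vy] := hc l (ltn_ord l); have [_ _ _ Dl] := h1 l (ltn_ord l).
  have [a [b' [ha hb a0 b0 [va vb]]]] := is_div_pick Dl Sv.
  apply: locD.
    rewrite -(divfK a0 (b u (y l))) -scalerA; apply: locZ => //.
      apply: (@vge_mulr _ _ (D0 l v) _ _ a); rewrite ?divfK //; lia.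
    by apply: loc_lat; apply: (h3 l a (ltn_ord l)).1.
  rewrite -(divfK b0 (b u (x l))) -scalerA; apply: locZ => //.
    apply: (@vge_mulr _ _ (- D0 l v) _ _ b'); rewrite ?divfK //; lia.
  by apply: loc_lat; apply: (h3 l b' (ltn_ord l)).2.
split.
  move=> l lr; have [hx hy] := frame_coords fr lr Ls.
  have := hx v Sv; have := hy v Sv; rewrite !bZ ![s * _]mulrC => hy' hx'.
  by split; [apply: vge_mulr hx' s0 _ | apply: vge_mulr hy' s0 _]; rewrite vs subr0.
exists s; split=> //; rewrite -residZ; exact: (frame_resid_lat fr).
Qed.

Lemma twist_denominator D u : (forall l, (l < r)%N -> is_div S (D l)) ->
  exists2 d, (d \in A) && (d != 0) & forall v, ~ S v -> twist D v (d *: u).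
Proof.
move=> hD.
have [d /andP[dA d0] Ld] := Lspan (res u).
have coord (l : 'I_r) : exists2 e, (e \in A) && (e != 0) &
    inL S (D l) (e * b u (y l)) /\ inL S (fun v => - D l v) (e * b u (x l)).
  have nz (D' : place K -> int) c : is_div S D' -> exists2 e, (e \in A) && (e != 0) & inL S D' (e * c).
    move=> [m [a [b' [ha hb ab]]]].
    have [k ak0] : exists k, a k != 0.
      apply: contrapT => no; move/eqP: (oner_neq0 K); apply; rewrite -ab big1 // => k _.
      suff -> : a k = 0 by rewrite mul0r.
      by apply/eqP; apply: contrapT => /negP h; apply: no; exists k.
    have [e /andP[eA e0] he] := frac_A hK zA zVA (c / a k).
    exists e; first by rewrite eA e0.
    by rewrite -(divfK ak0 c) mulrA; apply: inLZ.
  have [e1 /andP[e1A e10] he1] := nz (D l) (b u (y l)) (hD _ (ltn_ord l)).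
  have [e2 /andP[e2A e20] he2] := nz (fun v => - D l v) (b u (x l)) (is_divN (hD _ (ltn_ord l))).
  exists (e1 * e2); first by rewrite rpredM ?mulf_neq0.
  split; last by rewrite -mulrA; apply: inLZ.
  by rewrite mulrAC mulrC; apply: inLZ.
have [e he1 he2] : exists2 e : 'I_r -> K, (forall l, (e l \in A) && (e l != 0)) &
    forall l : 'I_r, inL S (D l) (e l * b u (y l)) /\ inL S (fun v => - D l v) (e l * b u (x l)).
  have /choice [e he] : forall l : 'I_r, exists e, (e \in A) && (e != 0) /\
      (inL S (D l) (e * b u (y l)) /\ inL S (fun v => - D l v) (e * b u (x l))).
    by move=> l; have [e ? ?] := coord l; exists e.
  by exists e => l; case: (he l).
have pA (P : pred 'I_r) : \prod_(l | P l) e l \in A.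
  by apply: rpred_prod => l _; case/andP: (he1 l).
exists (d * \prod_l e l).
  rewrite rpredM // mulf_neq0 //; apply/prodf_neq0 => l _; by case/andP: (he1 l).
move=> v Sv; split; last by rewrite residZ mulrC -scalerA; apply: loc_lat; apply: LZ.
move=> l lr; have [h1 h2] := he2 (Ordinal lr); rewrite !bZ (bigD1 (Ordinal lr)) //=.
have e12 t : d * (e (Ordinal lr) * \prod_(i < r | i != Ordinal lr) e i) * t =
  (d * \prod_(i < r | i != Ordinal lr) e i) * (e (Ordinal lr) * t) by ring.
rewrite !e12; split.
  exact: (inLZ (rpredM dA (pA _)) h1).
exact: (inLZ (rpredM dA (pA _)) h2).
Qed.

Definition shift (D : nat -> place K -> int) (l : nat) (I : place K -> int) k v : int :=
  if k == l then D k v + 2 * I v else D k v.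

(** The coordinates on the plane l move as in [sl2_coef_vge]; elsewhere an integral multiple of w is
    added, and w belongs to the twisted lattice. *)
Lemma sl2_act_twist (D : nat -> place K -> int) l (I : place K -> int) w a al be ga de v u :
  (l < r)%N -> ~ S v -> b w (x l) = 0 -> b w (y l) = 0 -> b w w = 2 * a ->
  twist D v w -> vge v 0 a -> vge v (I v) al -> vge v (- I v) de ->
  vge v (D l v + I v) be -> vge v (- (D l v + I v)) ga ->
  twist D v u -> twist (shift D l I) v (sl2_act b (x l) (y l) w a al be ga de u).
Proof.
move=> lr Sv wx wy ww tw va val vde vbe vga tu.
have [hxy hxx hyy] := hyp.
have [hu ru] := tu; have [hw rw] := tw.
have vmu := twist_form Sv tu tw.
have [vxi veta] := hu l lr.
have xy1 : b (x l) (y l) = 1 by rewrite hxy // eqxx.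
have := @sl2_act_coords K E b bC bD bZ (x l) (y l) w a (hxx _ _ lr lr) (hyy _ _ lr lr)
  xy1 wx wy ww al be ga de u.
rewrite /sl2_act; case E1: sl2_coef => [[k X] Y] [].
move: E1; rewrite /sl2_coef => -[kE XE YE]; rewrite XE YE => bX bY _.
have := sl2_coef_vge va val vde vbe vga vxi veta vmu; rewrite kE XE YE => -[vk vX vY].
split.
  move=> m mr; rewrite /shift; case: eqP => [->|/eqP ml]; first by rewrite bX bY.
  have [h1 h2] := hu m mr; have [h3 h4] := hw m mr.
  rewrite !bD !bZ hxx // hyy // hxy // (bC (y l)) hxy // (negbTE ml) eq_sym (negbTE ml) !mulr0 !addr0.
  split; apply: vgeD => //; first by rewrite -[D m v]add0r; apply: vgeM.
  by rewrite -[- D m v]add0r; apply: vgeM.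
rewrite !residD !residZ (resid_x hyp) // (resid_y hyp) // !scaler0 !addr0.
by apply: locD => //; apply: locZ.
Qed.

(** In dimension at least 3 two linear conditions leave a vector u0. If it is isotropic, take w' in
    the same complement pairing non-trivially with it: w' or u0 + w' is anisotropic. *)
Lemma anisotropic_complement l : (3 <= n)%N -> (l < r)%N ->
  exists w, [/\ b w (x l) = 0, b w (y l) = 0 & b w w != 0].
Proof.
move=> n3 lr; have [hxy hxx hyy] := hyp; have [g fK gK] := f_bij.
have gD c p q : g (c *: p + q) = c *: g p + g q.
  by apply: (can_inj fK); rewrite linearP !gK.
have [u0 uu0 [uux uuy]] : exists2 u, u != 0 & b u (x l) = 0 /\ b u (y l) = 0.
  pose M : 'M[K]_(n, 2) := \matrix_(i, j) b (g (delta_mx 0 i)) (if j == 0 then x l else y l).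
  have [p /sub_kermxP pM p0] : exists2 p : 'rV_n, (p <= kermx M)%MS & p != 0.
    apply/rowV0Pn; rewrite -mxrank_eq0 mxrank_ker -lt0n subn_gt0.
    exact: leq_ltn_trans (rank_leq_col M) n3.
  have g0 : g 0 = 0 by apply: (can_inj fK); rewrite gK linear0.
  have gsum t : b (g p) t = \sum_i p 0 i * b (g (delta_mx 0 i)) t.
    rewrite {1}(row_sum_delta p).
    transitivity (b (\sum_i p 0 i *: g (delta_mx 0 i)) t).
      congr b; elim/big_rec2: _ => // i t1 t2 _ <-; exact: gD.
    by rewrite bf_suml; apply: eq_bigr => i _; rewrite bZ.
  exists (g p); first by apply: contraNneq p0 => e; rewrite -(gK p) e linear0.
  rewrite !gsum; split.
    have /matrixP/(_ 0 0) := pM; rewrite !mxE => pM0; rewrite -[RHS]pM0.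
    by apply: eq_bigr => i _; rewrite mxE eqxx.
  have /matrixP/(_ 0 1) := pM; rewrite !mxE => pM0; rewrite -[RHS]pM0.
  by apply: eq_bigr => i _; rewrite mxE.
have [uu|uu] := eqVneq (b u0 u0) 0; last by exists u0.
have [w bw] : exists w, b u0 w != 0.
  apply: contrapT => no; move/eqP: uu0; apply; apply: nondeg => w Lw.
  by apply/eqP; apply: contrapT => /negP h; apply: no; exists w.
pose w' := w - b w (y l) *: x l - b w (x l) *: y l.
have w'x : b w' (x l) = 0.
  by rewrite !bfBl !bZ hxx // (bC (y l)) hxy // eqxx mulr0 mulr1 subr0 subrr.
have w'y : b w' (y l) = 0.
  by rewrite !bfBl !bZ hyy // hxy // eqxx mulr0 mulr1 subr0 subrr.
have uw' : b u0 w' = b u0 w.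
  by rewrite !bfBr !bfZr uux uuy !mulr0 !subr0.
clearbody w'; have [ww|ww] := eqVneq (b w' w') 0; last by exists w'.
exists (u0 + w'); rewrite !bD uux uuy w'x w'y !addr0; split=> //.
rewrite !bfDr uu ww (bC w') uw' add0r addr0 -mulr2n -mulr_natl.
by rewrite mulf_neq0.
Qed.

Definition isom_pair (sg ta : E -> E) : Prop :=
  [/\ forall c u u', sg (c *: u + u') = c *: sg u + sg u', cancel sg ta, cancel ta sg &
      forall u u', b (sg u) (sg u') = b u u'].

Lemma twist_step (D : nat -> place K -> int) l (I : place K -> int) :
  (3 <= n)%N -> (l < r)%N -> (forall k, (k < r)%N -> is_div S (D k)) -> is_div S I ->
  exists sg ta, isom_pair sg ta /\
    forall v u, ~ S v -> twist D v u <-> twist (shift D l I) v (sg u).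
Proof.
move=> n3 lr hD hI; have [hxy hxx hyy] := hyp.
have [w0 [w0x w0y w00]] := anisotropic_complement n3 lr.
(* A multiple of w0 in the twisted lattice at every place outside S, so that a lies in A as
   [sl2_matrix] requires. *)
have [d /andP[dA d0] tw] := twist_denominator w0 hD.
pose w := d *: w0; pose a := b w w / 2.
have wx : b w (x l) = 0 by rewrite bZ w0x mulr0.
have wy : b w (y l) = 0 by rewrite bZ w0y mulr0.
have ww : b w w = 2 * a by rewrite /a mulrC divfK.
have aA : a \in A.
  apply: rpredM => //; apply/inA_P => v Sv; exact: (twist_form Sv (tw v Sv) (tw v Sv)).
have a0 : a != 0.
  by rewrite /a mulf_neq0 ?invr_eq0 // bZ bfZr !mulf_neq0.
have [al [be [ga [de [hal hde hbe hga det]]]]] := sl2_matrix hK (hD l lr) hI aA a0.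
have det' : de * al - a * (- be) * (- ga) = 1 by rewrite -det; ring.
have xy1 : b (x l) (y l) = 1 by rewrite hxy // eqxx.
have xx := hxx _ _ lr lr; have yy := hyy _ _ lr lr.
set sg := sl2_act b (x l) (y l) w a al be ga de.
set ta := sl2_act b (x l) (y l) w a de (- be) (- ga) al.
have sgK : cancel sg ta by apply: sl2_actK.
have taK : cancel ta sg.
  by have := @sl2_actK K E b bC bD bZ (x l) (y l) w a xx yy xy1 wx wy ww _ _ _ _ det'; rewrite !opprK.
exists sg, ta; split.
  split=> //; first by move=> c u u'; apply: sl2_act_linear.
  by move=> u u'; apply: sl2_act_isometry.
move=> v u Sv; have va : vge v 0 a by have /inA_P := aA; apply.
have step := sl2_act_twist lr Sv wx wy ww.
split=> [tu|tu].
  by apply: step => //; [exact: tw | exact: hal | exact: hde | exact: hbe | exact: hga].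
rewrite -(sgK u).
(* The converse is the same statement for the inverse matrix, which shifts back by - I. *)
have -> : D = shift (shift D l I) l (fun v => - I v).
  apply/funext => k; apply/funext => v'; rewrite /shift; case: eqP => // _; lia.
apply: step => //.
- have [h1 h2] := tw v Sv; split=> // k kr; have [h3 h4] := h1 k kr.
  rewrite /shift; case: eqP => [kl|_] //; rewrite kl wx wy; split; exact: vge0.
- exact: hde.
- by rewrite opprK; exact: hal.
- rewrite vgeN /shift eqxx; have := hbe v Sv; congr vge; lia.
- rewrite vgeN /shift eqxx; have := hga v Sv; congr vge; lia.
Qed.

(** The square of rho(j_v) multiplies x k by the power 2 wt k of a generator of J at v, so the plane
    k is shifted with I = wt k * J. One plane is treated at a time. *)
Lemma twist_steps (J : place K -> int) m : (3 <= n)%N -> is_div S J -> (m <= r)%N ->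
  exists sg ta, isom_pair sg ta /\
    forall v u, ~ S v -> twist D0 v u <->
      twist (fun k v => D0 k v + (if (k < m)%N then 2 * (wt k * J v) else 0)) v (sg u).
Proof.
move=> n3 hJ; have [h1 _ _] := fr; elim: m => [|m IH] mr.
  exists id, id; split; first by split=> //.
  move=> v u Sv; suff -> : (fun k v => D0 k v + (if (k < 0)%N then 2 * (wt k * J v) else 0)) = D0 by [].
  by apply/funext => k; apply/funext => v'; rewrite addr0.
have [sg [ta [[sgL sgK taK sgI] hsg]]] := IH (ltnW mr).
set D := (fun k v => _) in hsg.
have hD k : (k < r)%N -> is_div S (D k).
  move=> kr; have [_ _ _ Dk] := h1 k kr; apply: is_divD => //.
  case: (k < m)%N; last exact: is_div0.
  exact: is_divZ (is_divZ _ hJ).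
have [sg' [ta' [[sgL' sgK' taK' sgI'] hsg']]] := twist_step n3 mr hD (is_divZ (wt m) hJ).
exists (sg' \o sg), (ta \o ta'); split.
  split=> [c u u'|||u u'] /=; first by rewrite sgL sgL'.
  - by move=> u /=; rewrite sgK' sgK.
  - by move=> u /=; rewrite taK taK'.
  - by rewrite sgI' sgI.
move=> v u Sv; apply: iff_trans (hsg v u Sv) _; apply: iff_trans (hsg' v _ Sv) _.
rewrite /=; suff -> : shift D m (fun v0 => wt m * J v0) =
   (fun k v0 => D0 k v0 + (if (k < m.+1)%N then 2 * (wt k * J v0) else 0)) by [].
apply/funext => k; apply/funext => v'; rewrite /shift /D ltnS (leq_eqVlt k).
by case: eqP => [->|_]; rewrite ?ltnn ?addr0 ?orbT ?orFb.
Qed.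

Hypothesis res0 : forall u, weight 0 (res u).

Lemma resid_rho a u : a != 0 -> res (rho a u) = res u.
Proof.
move=> a0; have [h1 _ _] := fr.
have rho0 : rho a 0 = 0 by have := weight0 0 a0; rewrite scaler0.
transitivity (rho a (res u)); last by rewrite (res0 u a0) expr0z scale1r.
rewrite /resid -[in RHS]scaleN1r rhoD // rhoZ // scaleN1r; congr (_ - _).
have -> : rho a (\sum_(l < r) (b u (y l) *: x l + b u (x l) *: y l)) =
   \sum_(l < r) rho a (b u (y l) *: x l + b u (x l) *: y l).
  by elim/big_rec2: _ => // l u1 u2 _ <-; rewrite rhoD.
apply: eq_bigr => l _; have [_ wx wy _] := h1 l (ltn_ord l).
have e i t : weight i t -> b (rho a u) t = a ^ (- i) * b u t.
  by move=> wt'; rewrite -(rho_iso u t a0) wt' // bfZr mulrA -expfzDr // addNr expr0z mul1r.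
by rewrite rhoD // !rhoZ // (wx a a0) (wy a a0) (e _ _ wx) (e _ _ wy) opprK !scalerA ![a ^ _ * _]mulrC.
Qed.

Lemma twist_rho (J : place K -> int) v j u : ~ S v -> j != 0 -> v j = J v ->
  twist (fun k v => D0 k v + (if (k < r)%N then 2 * (wt k * J v) else 0)) v u <->
  loc v (rho (j ^- 2) u).
Proof.
move=> Sv j0 vj; apply: iff_trans (twist_frame _ Sv).
have a0 : j ^- 2 != 0 by rewrite invr_eq0 expf_neq0.
have va : v (j ^- 2) = - (2 * J v) by rewrite pvalV ?expf_neq0 // pvalX // vj mulr_natl.
have [h1 _ _] := fr; rewrite /twist resid_rho //.
have e i t : weight i t -> b (rho (j ^- 2) u) t = (j ^- 2) ^ (- i) * b u t.
  by move=> wt'; rewrite -(rho_iso u t a0) wt' // bfZr mulrA -expfzDr // addNr expr0z mul1r.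
have vm k c i : vge v k ((j ^- 2) ^ i * c) = vge v (k + 2 * (i * J v)) c.
  have ai : (j ^- 2) ^ i != 0 by exact: expfz_neq0.
  rewrite /vge mulf_eq0 (negbTE ai) /=; have [//|c0 /=] := eqVneq c 0.
  by rewrite pvalM // pvalXz // va; lia.
suff E12 l : (l < r)%N ->
  (vge v (D0 l v + (if (l < r)%N then 2 * (wt l * J v) else 0)) (b u (y l)) =
   vge v (D0 l v) (b (rho (j ^- 2) u) (y l))) /\
  (vge v (- (D0 l v + (if (l < r)%N then 2 * (wt l * J v) else 0))) (b u (x l)) =
   vge v (- D0 l v) (b (rho (j ^- 2) u) (x l))).
  split=> -[h hr]; split=> // l lr; have [e1 e2] := E12 l lr; have [] := h l lr.
    by rewrite e1 e2.
  by rewrite e1 e2.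
move=> lr; have [_ wx wy _] := h1 l lr.
rewrite (e _ _ wx) (e _ _ wy) !vm opprK lr; split=> //.
by congr vge; lia.
Qed.

End Twists.

(* The adelic point rho(j_v)^2 of the orthogonal group lies in the class of a
   rational point. *)
Theorem rational_twist (J : place K -> int) : (3 <= n)%N -> is_div S J ->
  exists sg ta, isom_pair sg ta /\
    forall v j u, ~ S v -> j != 0 -> v j = J v -> loc v u <-> loc v (rho (j ^- 2) (sg u)).
Proof.
move=> n3 hJ; have [r [x [y [D [wt [fr res0]]]]]] := frame_maximal.
have [sg [ta [iso h]]] := twist_steps fr n3 hJ (leqnn r).
exists sg, ta; split=> // v j u Sv j0 vj.
apply: iff_trans (iff_sym (twist_frame fr u Sv)) _; apply: iff_trans (h v u Sv) _.
exact: twist_rho.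
Qed.

(** All the powers of c^i times a fixed multiple of x stay in the localized lattice, so their
    pairings with one lattice vector have no pole at v; then c^i has none. *)
Lemma weight_bounded c v i x : ~ S v -> c != 0 -> weight i x -> x != 0 ->
  (forall u, loc v u -> loc v (rho c u)) -> 0 <= i * v c.
Proof.
move=> Sv c0 wx x0 hc.
have [d /andP[dA d0] Ldx] := Lspan x.
have pw m : loc v ((c ^ i) ^+ m *: (d *: x)).
  elim: m => [|m IH]; first by rewrite scale1r; exact: loc_lat.
  by have := hc _ IH; rewrite !rhoZ // wx // exprSr -!scalerA [d *: (c ^ i *: x)]scalerA mulrC -scalerA.
have [w Lw bw] : exists2 w, L w & b (d *: x) w != 0.
  apply: contrapT => no; suff dx0 : d *: x = 0.
    by move/eqP: dx0; rewrite scaler_eq0 (negbTE d0) (negbTE x0).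
  apply: nondeg => w Lw.
  by apply/eqP; apply: contrapT => /negP h; apply: no; exists w.
have : vge v 0 (c ^ i).
  apply: (@vge_bounded_powers _ _ (b (d *: x) w)) => // m.
  by rewrite mulrC -bZ; apply: loc_form => //; exact: loc_lat.
by rewrite vgeE ?expfz_neq0 // pvalXz.
Qed.

(** By non-degeneracy a weight i comes with the weight -i, and the two resulting bounds on i * v c
    are opposite. *)
Lemma loc_stable_unit c v : ~ S v -> c != 0 ->
  (exists i x, [/\ i != 0, x != 0 & weight i x]) ->
  (forall u, loc v u -> loc v (rho c u)) -> v c = 0.
Proof.
move=> Sv c0 [i [x [i0 x0 wx]]] hc.
have h1 := weight_bounded Sv c0 wx x0 hc.
have [w Lw bw] : exists2 w, L w & b x w != 0.
  apply: contrapT => no; move/eqP: x0; apply; apply: nondeg => w Lw.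
  by apply/eqP; apply: contrapT => /negP h; apply: no; exists w.
have [w' [_ ww' bw']] := weight_part (- i) Lw.
have w'0 : w' != 0.
  by apply: contraNneq bw => w'0; rewrite -bw' ?opprK // w'0 bC bf0l.
have h2 := weight_bounded Sv c0 ww' w'0 hc.
by move: i0 h1 h2; move: (v c) => t; nia.
Qed.

End Frames.

(** * Base change of quadratic forms *)

Local Open Scope quotient_scope.

Section TensorTheory.
Variables (A R : comPzRingType) (phi : {rmorphism A -> R}).
Variables (V : lmodType A) (W : lmodType R).
Local Notation T := (tensor phi V W).

Lemma pi_cons p s : \pi_T (p :: s) = tens phi p.1 p.2 + \pi_T s.
Proof. by rewrite -[RHS]/(tadd _ _) tadd_pi; case: p. Qed.

Lemma tensor_ind (P : T -> Prop) : P 0 -> (forall v w, P (tens phi v w)) ->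
  (forall x y, P x -> P y -> P (x + y)) -> forall x, P x.
Proof.
move=> P0 Pt PD; apply: tensorW; elim=> [|p s IH]; first exact: P0.
by rewrite pi_cons; apply: PD.
Qed.

Lemma tlift_linear (X : lmodType R) (g : V -> W -> X) : balanced phi g ->
  (forall v r w, g v (r *: w) = r *: g v w) -> linear (tlift g : T -> X).
Proof.
move=> hg gZ r x y; rewrite tliftD // tliftZ //; congr (_ + _).
by rewrite /tlift /tsum scaler_sumr; apply: eq_bigr => p _; rewrite gZ.
Qed.

Lemma tlift0 (X : zmodType) (g : V -> W -> X) : balanced phi g -> tlift g (0 : T) = 0.
Proof. by move=> hg; apply: (addrI (tlift g (0 : T))); rewrite -tliftD // !addr0. Qed.

Lemma tensDl u v w : tens phi (u + v) w = tens phi u w + tens phi v w :> T.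
Proof. by have [h _ _] := tens_balanced phi V W. Qed.
Lemma tensDr v w w' : tens phi v (w + w') = tens phi v w + tens phi v w' :> T.
Proof. by have [_ h _] := tens_balanced phi V W. Qed.
Lemma tensZl a v w : tens phi (a *: v) w = tens phi v (phi a *: w) :> T.
Proof. by have [_ _ h] := tens_balanced phi V W. Qed.
Lemma tens0r v : tens phi v 0 = 0 :> T.
Proof. by apply: (addrI (tens phi v 0)); rewrite -tensDr !addr0. Qed.
Lemma tens0l w : tens phi 0 w = 0 :> T.
Proof. by apply: (addrI (tens phi 0 w)); rewrite -tensDl !addr0. Qed.
Lemma tens_suml (I : Type) (r : seq I) (f : I -> V) w :
  tens phi (\sum_(i <- r) f i) w = \sum_(i <- r) tens phi (f i) w :> T.
Proof.
elim: r => [|i r IH]; first by rewrite !big_nil tens0l.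
by rewrite !big_cons tensDl IH.
Qed.

Lemma tens_sumr (I : Type) (r : seq I) (f : I -> W) v :
  tens phi v (\sum_(i <- r) f i) = \sum_(i <- r) tens phi v (f i) :> T.
Proof.
elim: r => [|i r IH]; first by rewrite !big_nil tens0r.
by rewrite !big_cons tensDr IH.
Qed.

End TensorTheory.

Lemma tmap_tens (A R : comPzRingType) (phi : {rmorphism A -> R}) (V V' : lmodType A)
  (W : lmodType R) (g : {linear V -> V'}) v w :
  tmap g (tens phi v w : tensor phi V W) = tens phi (g v) w.
Proof. by rewrite /tmap tlift_tens //; exact: tmap_balanced. Qed.

Section Polar.
Variables (A : comPzRingType) (V : lmodType A) (q : V -> A).
Hypothesis q_quad : quadratic q.

Lemma polarC u v : polar q u v = polar q v u.
Proof. by rewrite /polar [u + v]addrC addrAC. Qed.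

Lemma polarDl u v y : polar q (u + v) y = polar q u y + polar q v y.
Proof. by have := q_quad.2 y 1 u v; rewrite scale1r mul1r. Qed.

Lemma polarZl a v y : polar q (a *: v) y = a * polar q v y.
Proof.
have p0 : polar q 0 y = 0.
  by apply: (addrI (polar q 0 y)); rewrite -polarDl !addr0.
by have := q_quad.2 y a v 0; rewrite !addr0 p0 addr0.
Qed.

Lemma polarDr y u v : polar q y (u + v) = polar q y u + polar q y v.
Proof. by rewrite !(polarC y) polarDl. Qed.

Lemma polarZr y a v : polar q y (a *: v) = a * polar q y v.
Proof. by rewrite !(polarC y) polarZl. Qed.

Lemma polarvv v : polar q v v = 2 * q v.
Proof.
have -> : polar q v v = q (2 *: v) - q v - q v by rewrite /polar scaler_nat mulr2n.
by rewrite q_quad.1; ring.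
Qed.

Lemma polar_suml (I : Type) (r : seq I) (f : I -> V) y :
  polar q (\sum_(i <- r) f i) y = \sum_(i <- r) polar q (f i) y.
Proof.
elim/big_rec2: _ => [|i u v _ <-]; last exact: polarDl.
by rewrite -(scale0r (0 : V)) polarZl mul0r.
Qed.

End Polar.

Section FormExtension.
Variables (A : comPzRingType) (R : alg A) (V : lmodType A) (q : V -> A) (half : A).
Hypotheses (q_quad : quadratic q) (halfE : half * 2 = 1).
Local Notation phi := (alg_str R).
Local Notation VR := (ext R V).
Local Notation tn v r := (tens phi v (r : R^o) : VR).

Definition polR1 (v : V) (r : R) (y : VR) : R :=
  tlift (fun w (s : R^o) => r * s * phi (polar q v w)) y.

(** The extension of B_q to a bilinear form over R. As 2 is invertible it determines the extended
    quadratic form, and it is additive in both arguments, unlike [qf_ext]. *)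
Definition polR (x y : VR) : R := tlift (fun v (r : R^o) => polR1 v r y) x.

Lemma polR1_balanced v r :
  balanced phi (fun w (s : R^o) => r * s * phi (polar q v w)).
Proof.
split=> [u w s|w s t|a w s].
- by rewrite polarDr // rmorphD mulrDr.
- by rewrite mulrDr mulrDl.
- by rewrite polarZr // rmorphM /GRing.scale /=; ring.
Qed.

Lemma polR1_tens v r w s : polR1 v r (tn w s) = r * s * phi (polar q v w).
Proof. by rewrite /polR1 tlift_tens //; exact: polR1_balanced. Qed.

Lemma polR1D v r y y' : polR1 v r (y + y') = polR1 v r y + polR1 v r y'.
Proof. by rewrite /polR1 tliftD //; exact: polR1_balanced. Qed.

Lemma polR10 v r : polR1 v r 0 = 0.
Proof. by rewrite /polR1 tlift0 //; exact: polR1_balanced. Qed.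

Lemma polR_balanced y : balanced phi (fun v (r : R^o) => polR1 v r y).
Proof.
split=> [u v r|v r s|a v r]; elim/tensor_ind: y => [|w t|x y IHx IHy];
  rewrite ?polR10 ?addr0 ?polR1_tens ?polR1D ?IHx ?IHy //.
- by rewrite polarDl // rmorphD mulrDr.
- by rewrite addrACA.
- by ring.
- by rewrite addrACA.
- by rewrite polarZl // rmorphM /GRing.scale /=; ring.
Qed.

Lemma polR_tens v r y : polR (tn v r) y = polR1 v r y.
Proof. by rewrite /polR tlift_tens //; exact: polR_balanced. Qed.

Lemma polRDl x x' y : polR (x + x') y = polR x y + polR x' y.
Proof. by rewrite /polR tliftD //; exact: polR_balanced. Qed.

Lemma polR0l y : polR 0 y = 0.
Proof. by rewrite /polR tlift0 //; exact: polR_balanced. Qed.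

Lemma polRDr x y y' : polR x (y + y') = polR x y + polR x y'.
Proof.
elim/tensor_ind: x => [|v r|x x' IH IH']; first by rewrite !polR0l addr0.
  by rewrite !polR_tens polR1D.
by rewrite !polRDl IH IH' addrACA.
Qed.

Lemma polR0r x : polR x 0 = 0.
Proof. by apply: (addrI (polR x 0)); rewrite -polRDr !addr0. Qed.

Lemma polRC x y : polR x y = polR y x.
Proof.
elim/tensor_ind: x => [|v r|x x' IH IH']; first by rewrite polR0l polR0r.
  elim/tensor_ind: y => [|w s|y y' IH IH']; first by rewrite polR0l polR0r.
    by rewrite !polR_tens !polR1_tens polarC; congr (_ * _); rewrite mulrC.
  by rewrite polRDr polRDl IH IH'.
by rewrite polRDr polRDl IH IH'.
Qed.

Lemma polRZl c x y : polR (c *: x) y = c * polR x y.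
Proof.
elim/tensor_ind: x => [|v r|x x' IH IH'].
- by rewrite scaler0 polR0l mulr0.
- rewrite tensZ !polR_tens; elim/tensor_ind: y => [|w s|y y' IH IH'].
  + by rewrite !polR10 mulr0.
  + by rewrite !polR1_tens /GRing.scale /=; ring.
  + by rewrite !polR1D IH IH' mulrDr.
- by rewrite scalerDr !polRDl IH IH' mulrDr.
Qed.

Lemma qf_extE2 x : 2 * qf_ext q x = polR x x.
Proof.
elim/tensorW: x => s; rewrite (qf_ext_pi q_quad halfE).
elim: s => [|p s IH]; first by rewrite /= mulr0 polR0l.
have e : polR1 p.1 p.2 (\pi_VR s) = \sum_(t <- s) (p.2 : R) * t.2 * phi (polar q p.1 t.1).
  by rewrite /polR1 tlift_pi //; exact: polR1_balanced.
rewrite pi_cons /= !mulrDr IH -e; move: (\pi_VR s) => y.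
rewrite !(polRDl, polRDr) (polRC y) !polR_tens polR1_tens polarvv //.
by rewrite rmorphM rmorph_nat; ring.
Qed.

Lemma halfR : phi half * 2 = 1.
Proof. by rewrite -(rmorph_nat phi) -rmorphM halfE rmorph1. Qed.

Lemma qf_extE x : qf_ext q x = phi half * polR x x.
Proof. by rewrite -qf_extE2 mulrA halfR mul1r. Qed.

Lemma polar_qf_ext x y : polar (qf_ext q) x y = polR x y.
Proof.
rewrite /polar !qf_extE !polRDl !polRDr (polRC y x).
by transitivity (polR x y * (phi half * 2)); [ring | rewrite halfR mulr1].
Qed.

Lemma qf_extZ (c : R) (x : VR) : qf_ext q (c *: x) = c ^+ 2 * qf_ext q x.
Proof. by rewrite !qf_extE polRZl (polRC x) polRZl; ring. Qed.

End FormExtension.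

Section IsometryExtension.
Variables (A : comPzRingType) (half : A) (halfE : half * 2 = 1).

Lemma tensE (R : alg A) (V : lmodType A) (v : V) (r : R) :
  tens (alg_str R) v (r : R^o) = r *: (tens (alg_str R) v (1 : R^o)) :> ext R V.
Proof. by rewrite tensZ /GRing.scale /= mulr1. Qed.

Lemma linearDZ (R : pzRingType) (U U' : lmodType R) (g : U -> U') : linear g ->
  (forall x y, g (x + y) = g x + g y) /\ (forall c x, g (c *: x) = c *: g x).
Proof.
move=> hg; have gD x y : g (x + y) = g x + g y by have := hg 1 x y; rewrite !scale1r.
split=> // c x; have g0 : g 0 = 0 by apply: (addrI (g 0)); rewrite -gD !addr0.
by have := hg c x 0; rewrite !addr0 g0 addr0.
Qed.

Lemma tmap_comp_scale (R : alg A) (V V' : lmodType A) (ph : {linear V -> V'})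
    (ps : {linear V' -> V}) (a : A) (x : ext R V) :
  (forall v, ps (ph v) = a *: v) -> tmap ps (tmap ph x) = alg_str R a *: x.
Proof.
move=> h; elim/tensor_ind: x => [|v r|x y IHx IHy]; first by rewrite !linear0 ?scaler0.
  by rewrite !tmap_tens h tensZl tensZ.
by rewrite !linearD /= IHx IHy.
Qed.

Lemma polR_tmap (R : alg A) (V V' : lmodType A) (q : V -> A) (q' : V' -> A)
    (ph : {linear V -> V'}) (a : A) (x y : ext R V) :
  quadratic q -> quadratic q' -> (forall v, q' (ph v) = a * q v) ->
  polR q' (tmap ph x) (tmap ph y) = alg_str R a * polR q x y.
Proof.
move=> hq hq' h; have hp u v : polar q' (ph u) (ph v) = a * polar q u v.
  by rewrite /polar -linearD !h !mulrBr.
elim/tensor_ind: x => [|v r|x x' IH IH']; first by rewrite linear0 !polR0l // mulr0.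
  elim/tensor_ind: y => [|w s|y y' IH IH']; first by rewrite linear0 !polR0r // mulr0.
    by rewrite !tmap_tens !polR_tens // !polR1_tens // hp rmorphM; ring.
  by rewrite linearD !polRDr // IH IH' mulrDr.
by rewrite linearD !polRDl // IH IH' mulrDr.
Qed.

Variable Gamma : finGroupType.

(** An isometry with a denominator s is recorded over A as the similitude [ph] of multiplier s^2.
    Over any R where s becomes invertible, dividing by s restores the isometry; R may be a valuation
    ring or its completion. *)
Lemma similitude_gisometry (R : alg A) (Y X : gform A Gamma) (ph : {linear Y -> X})
    (ps : {linear X -> Y}) (s : A) (s' : R) :
  is_gform Y -> is_gform X -> alg_str R s * s' = 1 ->
  (forall y, ps (ph y) = s ^+ 2 *: y) -> (forall x, ph (ps x) = s ^+ 2 *: x) ->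
  (forall y, qf (ph y) = s ^+ 2 * qf y) ->
  (forall g y, ph (gact Y g y) = gact X g (ph y)) ->
  @gisometry R Gamma (gform_ext R Y) (gform_ext R X) (fun x => s' *: tmap ph x).
Proof.
move=> [[_ qY] _ _ _] [[_ qX] _ _ _] ss psph phps hq heq.
have s2 : s' ^+ 2 * alg_str R (s ^+ 2) = 1.
  by rewrite rmorphXn -exprMn [s' * _]mulrC ss expr1n.
split; last first.
  move=> g x; rewrite /= [RHS]linearZ /=; congr (_ *: _).
  elim/tensor_ind: x => [|v r|x y IHx IHy]; first by rewrite !linear0.
    by rewrite !tmap_tens heq.
  by rewrite !linearD /= IHx IHy.
split.
- move=> c x y /=; rewrite linearP scalerDr !scalerA; congr (_ *: _ + _); exact: mulrC.
- exists (fun x => s' *: tmap ps x) => x.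
    by rewrite linearZ /= (tmap_comp_scale _ psph) !scalerA -expr2 s2 scale1r.
  by rewrite linearZ /= (tmap_comp_scale _ phps) !scalerA -expr2 s2 scale1r.
move=> x; rewrite /= (qf_extZ qX halfE) !(qf_extE _ halfE) // (polR_tmap _ _ qY qX hq).
by rewrite !mulrA [s' ^+ 2 * _]mulrC -[_ * alg_str R (s ^+ 2)]mulrA s2 mulr1.
Qed.

Section Change.
Variables (R R' : alg A) (f : {rmorphism R -> R'}).
Hypothesis f_hom : alg_hom f.

Lemma ext_map_balanced (V : lmodType A) :
  balanced (alg_str R) (fun v (r : R^o) => tens (alg_str R') v (f r : R'^o) : ext R' V).
Proof.
split=> [u w s|w s t|a w s] /=; first by rewrite tensDl.
  by rewrite raddfD tensDr.
by rewrite tensZl /GRing.scale /= rmorphM f_hom.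
Qed.

Lemma ext_mapD (V : lmodType A) (x y : ext R V) :
  ext_map f (x + y) = ext_map f x + ext_map f y.
Proof. by rewrite /ext_map tliftD //; exact: ext_map_balanced. Qed.

Lemma ext_map0 (V : lmodType A) : ext_map f (0 : ext R V) = 0.
Proof. by rewrite /ext_map tlift0 //; exact: ext_map_balanced. Qed.

Lemma ext_mapZ (V : lmodType A) (r : R) (x : ext R V) :
  ext_map f (r *: x) = f r *: ext_map f x.
Proof.
elim/tensor_ind: x => [|v s|x y IHx IHy]; first by rewrite scaler0 ext_map0 scaler0.
  by rewrite tensZ !ext_map_tens // tensZ /GRing.scale /= rmorphM.
by rewrite scalerDr !ext_mapD IHx IHy scalerDr.
Qed.

Lemma ext_map_tmap (V V' : lmodType A) (g : {linear V -> V'}) (x : ext R V) :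
  ext_map f (tmap g x) = tmap g (ext_map f x).
Proof.
elim/tensor_ind: x => [|v s|x y IHx IHy]; first by rewrite !(linear0, ext_map0).
  by rewrite tmap_tens !ext_map_tens // tmap_tens.
by rewrite linearD !ext_mapD IHx IHy linearD.
Qed.

Lemma polR_ext_map (V : lmodType A) (q : V -> A) (x y : ext R V) : quadratic q ->
  polR q (ext_map f x) (ext_map f y) = f (polR q x y).
Proof.
move=> hq; elim/tensor_ind: x => [|v r|x x' IH IH'].
- by rewrite ext_map0 !polR0l // rmorph0.
- elim/tensor_ind: y => [|w s|y y' IH IH']; first by rewrite ext_map0 !polR0r // rmorph0.
    by rewrite !ext_map_tens // !polR_tens // !polR1_tens // !rmorphM f_hom.
  by rewrite ext_mapD !polRDr // IH IH' rmorphD.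
- by rewrite ext_mapD !polRDl // IH IH' rmorphD.
Qed.

Lemma base_change_eq (V : lmodType A) (g : ext R V -> ext R V) (g1 g2 : ext R' V -> ext R' V) :
  linear g1 -> linear g2 -> base_change f g g1 -> base_change f g g2 -> g1 = g2.
Proof.
move=> /linearDZ [D1 Z1] /linearDZ [D2 Z2] h1 h2; apply/funext => x.
elim/tensor_ind: x => [|v r|x y IHx IHy].
- by rewrite -(scale0r 0) Z1 Z2 !scale0r.
- have e : tens (alg_str R') v (r : R'^o) = r *: ext_map f (tens (alg_str R) v (1 : R^o) : ext R V).
    by rewrite ext_map_tens // rmorph1 -tensE.
  by rewrite e Z1 Z2 h1 h2.
- by rewrite D1 D2 IHx IHy.
Qed.

(** The axioms of a subgroup functor only relate given points over R and R'. Here the point over R'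
    is produced, as the linear extension of g. *)
Definition change (V : lmodType A) (g : ext R V -> ext R V) : ext R' V -> ext R' V :=
  tlift (fun v (r : R'^o) => (r : R') *: ext_map f (g (tens (alg_str R) v (1 : R^o)))).

Lemma change_balanced (V : lmodType A) (g : ext R V -> ext R V) : linear g ->
  balanced (alg_str R') (fun v (r : R'^o) =>
    (r : R') *: ext_map f (g (tens (alg_str R) v (1 : R^o))) : ext R' V).
Proof.
move=> /linearDZ [gD gZ]; split=> [u w s|w s t|a w s].
- by rewrite tensDl gD ext_mapD scalerDr.
- by rewrite scalerDl.
- by rewrite tensZl -tensZ gZ ext_mapZ f_hom scalerA mulrC.
Qed.

Lemma change_tens (V : lmodType A) (g : ext R V -> ext R V) v (r : R') : linear g ->
  change g (tens (alg_str R') v (r : R'^o)) = r *: ext_map f (g (tens (alg_str R) v (1 : R^o))).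
Proof. by move=> hg; rewrite /change tlift_tens //; exact: change_balanced. Qed.

Lemma change_linear (V : lmodType A) (g : ext R V -> ext R V) : linear g -> linear (change g).
Proof.
move=> hg; apply: tlift_linear; first exact: change_balanced.
by move=> v r w; rewrite scalerA.
Qed.

Lemma change_base_change (V : lmodType A) (g : ext R V -> ext R V) : linear g ->
  base_change f g (change g).
Proof.
move=> hg x; have [gD gZ] := linearDZ hg; have [cD cZ] := linearDZ (change_linear hg).
elim/tensor_ind: x => [|v r|x y IHx IHy].
- by rewrite -(scale0r 0) gZ !ext_mapZ cZ rmorph0 !scale0r.
- by rewrite tensE gZ !ext_mapZ cZ ext_map_tens // rmorph1 change_tens // scale1r.
- by rewrite gD !ext_mapD cD IHx IHy.
Qed.

Lemma gisometry_change (X : gform A Gamma) (g : ext R X -> ext R X) : is_gform X ->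
  @gisometry R Gamma (gform_ext R X) (gform_ext R X) g ->
  exists2 g', @gisometry R' Gamma (gform_ext R' X) (gform_ext R' X) g' & base_change f g g'.
Proof.
move=> [[_ hq] _ _ _] [[gl [g1 gK g1K] gq] geq].
have g1l : linear g1.
  by move=> c x y; apply: (can_inj gK); rewrite g1K gl !g1K.
exists (change g); last exact: change_base_change.
have comp (h k : ext R X -> ext R X) : linear h -> linear k -> cancel h k ->
    cancel (change h) (change k).
  move=> hl kl hk; have [cD cZ] := linearDZ (change_linear hl).
  have [dD dZ] := linearDZ (change_linear kl).
  elim/tensor_ind => [|v r|x y IHx IHy].
  - by rewrite -(scale0r 0) cZ dZ !scale0r.
  - rewrite change_tens // dZ change_base_change // hk ext_map_tens // rmorph1.
    by rewrite -tensE.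
  - by rewrite cD dD IHx IHy.
have [cD cZ] := linearDZ (change_linear gl).
split; [split|].
- exact: change_linear.
- by exists (change g1); apply: comp.
- have polg x y : polR (@qf _ X) (g x) (g y) = polR (@qf _ X) x y.
    rewrite -!(polar_qf_ext hq halfE) /polar; have [gD _] := linearDZ gl.
    by rewrite -gD; congr (_ - _ - _); exact: gq.
  have pol x y : polR (@qf _ X) (change g x) (change g y) = polR (@qf _ X) x y.
    elim/tensor_ind: x => [|v r|x x' IH IH'].
    + by rewrite -(scale0r 0) cZ !scale0r !polR0l.
    + elim/tensor_ind: y => [|w s|y y' IH IH'].
      * by rewrite -(scale0r 0) [change g (0 *: 0)]cZ !scale0r !polR0r.
      * rewrite !change_tens // polRZl // (polRC hq _ (s *: _)) polRZl // (polRC hq) polR_ext_map //.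
        by rewrite polg !polR_tens // !polR1_tens // !rmorphM !rmorph1 f_hom; ring.
      * by rewrite cD !polRDr // IH IH'.
    + by rewrite cD !polRDl // IH IH'.
  by move=> x /=; rewrite !(qf_extE hq halfE) pol.
- move=> h x /=; elim/tensor_ind: x => [|v r|x y IHx IHy].
  + by rewrite linear0 -(scale0r 0) cZ linearZ /= !scale0r.
  + rewrite tmap_tens !change_tens // linearZ /=; congr (_ *: _).
    by rewrite -ext_map_tmap -geq /= tmap_tens.
  + by rewrite linearD !cD IHx IHy linearD.
Qed.

End Change.
End IsometryExtension.

Definition linear_of (R : pzRingType) (U V : lmodType R) (f : U -> V) (hf : linear f) :
  {linear U -> V} := HB.pack f (GRing.isLinear.Build R U V *:%R f hf).

Definition scalar_of (R : pzRingType) (U : lmodType R) (f : U -> R) (hf : scalar f) :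
  {scalar U} := HB.pack f (GRing.isLinear.Build R U R *%R f hf).

(** Sylvester's identity: both sides come from triangular factorizations of one block matrix. *)
Lemma det_add1_mulmxC (R : comPzRingType) n m (C : 'M[R]_(n, m)) (D : 'M[R]_(m, n)) :
  \det (1%:M + C *m D) = \det (1%:M + D *m C).
Proof.
have e1 : block_mx 1%:M (- C) D 1%:M =
    block_mx 1%:M 0 D 1%:M *m block_mx 1%:M (- C) 0 (1%:M + D *m C).
  by rewrite mulmx_block !mul1mx !mulmx1 ?mul0mx ?mulmx0 !addr0 mulmxN addrCA addNr addr0.
have e2 : block_mx 1%:M (- C) D 1%:M =
    block_mx (1%:M + C *m D) (- C) 0 1%:M *m block_mx 1%:M 0 D 1%:M.
  by rewrite mulmx_block !mul1mx !mulmx1 ?mul0mx ?mulmx0 ?add0r ?addr0 mulNmx addrK.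
have := congr1 determinant e1; rewrite e2 !det_mulmx !det_ublock !det_lblock !det1.
by rewrite !mul1r !mulr1.
Qed.

Lemma mx_ext_row (R : pzRingType) n m (M N : 'M[R]_(n, m)) :
  (forall u : 'rV[R]_n, u *m M = u *m N) -> M = N.
Proof. by move=> h; apply/row_matrixP => i; rewrite !rowE h. Qed.

Section ProjectiveExtension.
Variables (A : comPzRingType) (R : alg A) (V : lmodType A).
Variables (n : nat) (i : {linear V -> 'rV[A]_n}) (p : {linear 'rV[A]_n -> V}).
Hypothesis ipK : cancel i p.
Local Notation phi := (alg_str R).

Definition ext_coords (x : ext R V) : 'rV[R]_n :=
  tlift (fun v (r : R^o) => (r : R) *: map_mx phi (i v)) x.

Lemma ext_coords_balanced :
  balanced phi (fun v (r : R^o) => (r : R) *: map_mx phi (i v)).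
Proof.
split=> [u w s|w s t|a w s].
- by rewrite linearD map_mxD scalerDr.
- by rewrite scalerDl.
- by rewrite linearZ /= map_mxZ scalerA [RHS](congr1 (fun t => t *: _) (mulrC _ _)).
Qed.

Lemma ext_coords_tens v (r : R) :
  ext_coords (tens phi v (r : R^o)) = r *: map_mx phi (i v).
Proof. by rewrite /ext_coords tlift_tens //; exact: ext_coords_balanced. Qed.

Lemma ext_coords_linear : linear ext_coords.
Proof.
apply: tlift_linear; first exact: ext_coords_balanced.
by move=> v r w; rewrite scalerA.
Qed.

Definition ext_proj (u : 'rV[R]_n) : ext R V :=
  \sum_k tens phi (p (delta_mx 0 k)) (u 0 k : R^o).

Lemma ext_proj_linear : linear ext_proj.
Proof.
move=> c u w; rewrite /ext_proj scaler_sumr -big_split; apply: eq_bigr => k _.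
by rewrite tensZ !mxE tensDr.
Qed.

Lemma ext_coordsK : cancel ext_coords ext_proj.
Proof.
have [cD _] := linearDZ ext_coords_linear; have [pD pZ] := linearDZ ext_proj_linear.
elim/tensor_ind => [|v r|x y IHx IHy]; last by rewrite cD pD IHx IHy.
  by rewrite -(scale0r 0) (linearDZ ext_coords_linear).2 pZ !scale0r.
rewrite ext_coords_tens -{2}[v]ipK {2}(row_sum_delta (i v)) linear_sum tens_suml.
apply: eq_bigr => k _; rewrite linearZ /= tensZl !mxE; congr tens.
by rewrite mulrC.
Qed.

Lemma ext_coords_tmap (e : {linear V -> V}) (u : 'rV[R]_n) :
  ext_coords (tmap e (ext_proj u)) =
  u *m map_mx phi (lin1_mx (i \o e \o p)).
Proof.
rewrite /ext_proj linear_sum.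
have -> : ext_coords (\sum_k tmap e (tens phi (p (delta_mx 0 k)) (u 0 k : R^o))) =
    \sum_k ext_coords (tmap e (tens phi (p (delta_mx 0 k)) (u 0 k : R^o))).
  have [cD cZ] := linearDZ ext_coords_linear.
  elim/big_rec2: _ => [|k x y _ <-]; last by rewrite cD.
  by rewrite -(scale0r 0) cZ !scale0r.
rewrite mulmx_sum_row; apply: eq_bigr => k _.
rewrite tmap_tens ext_coords_tens; congr (_ *: _); rewrite -map_row; congr map_mx.
by apply/rowP => l; rewrite !mxE.
Qed.

End ProjectiveExtension.

Lemma has_det_ext (A : comPzRingType) (R : alg A) (V : lmodType A) n
    (i : {linear V -> 'rV[A]_n}) (p : {linear 'rV[A]_n -> V}) (N : 'M[R]_n)
    (g : ext R V -> ext R V) : cancel i p ->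
  (forall u, ext_coords i (g (ext_proj p u)) + (u - ext_coords i (ext_proj p u)) = u *m N) ->
  \det N = 1 -> has_det g 1.
Proof.
move=> ipK hN dN; exists n, (linear_of (@ext_coords_linear _ R _ _ i)), (linear_of (@ext_proj_linear _ R _ _ p)).
split; first exact: ext_coordsK.
rewrite -dN; congr determinant; apply/matrixP => k j.
by rewrite mxE /= hN -rowE mxE.
Qed.

(** * The torus of a plane split into two isotropic lines *)

Section Torus.
Variables (A : comPzRingType) (half : A) (halfE : half * 2 = 1).
Variables (W : qform A) (W_form : is_qform W) (W_reg : regular_form (@qf _ W)).
Variables (ep em : {linear W -> W}).
Hypotheses (epm : forall x, ep x + em x = x) (epp : forall x, ep (ep x) = ep x)
  (qep : forall x, qf (ep x) = 0) (qem : forall x, qf (em x) = 0).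

Local Notation q := (@qf _ W).
Let q_quad : quadratic q := W_form.2.

Lemma emE x : em x = x - ep x. Proof. by rewrite -{2}(epm x) addrAC subrr add0r. Qed.
Lemma epem x : ep (em x) = 0. Proof. by rewrite emE linearB /= epp subrr. Qed.
Lemma emep x : em (ep x) = 0. Proof. by rewrite emE epp subrr. Qed.
Lemma emem x : em (em x) = em x. Proof. by rewrite [LHS]emE epem subr0. Qed.

Lemma polar_ep x y : polar q (ep x) (ep y) = 0.
Proof. by rewrite /polar -linearD !qep !subr0. Qed.
Lemma polar_em x y : polar q (em x) (em y) = 0.
Proof. by rewrite /polar -linearD !qem !subr0. Qed.
Lemma polar_adj x y : polar q (ep x) y = polar q x (em y).
Proof.
rewrite -{1}(epm y) -{2}(epm x) polarDr // polarDl // polar_ep polar_em.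
by rewrite add0r addr0.
Qed.

(** For t t' = 1 these are the points of the multiplicative group in SO(W). The inverse is a
    separate argument, since R has no inversion. *)
Definition torus (R : alg A) (t t' : R) (x : ext R W) : ext R W :=
  t *: tmap ep x + t' *: tmap em x.

Lemma tmap_ep_em (R : alg A) (x : ext R W) : tmap ep x + tmap em x = x.
Proof.
elim/tensor_ind: x => [|v r|x y IHx IHy]; first by rewrite !linear0 addr0.
  by rewrite !tmap_tens -tensDl epm.
by rewrite !linearD addrACA /= IHx IHy.
Qed.

Lemma tmap_comp0 (R : alg A) (f g : {linear W -> W}) (x : ext R W) :
  (forall v, f (g v) = 0) -> tmap f (tmap g x) = 0.
Proof.
move=> h; rewrite (@tmap_comp_scale _ _ _ _ g f 0) ?rmorph0 ?scale0r //.
by move=> v; rewrite h scale0r.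
Qed.

Lemma tmap_idem (R : alg A) (f g : {linear W -> W}) (x : ext R W) :
  (forall v, f (g v) = g v) -> tmap f (tmap g x) = tmap g x.
Proof.
move=> h; elim/tensor_ind: x => [|v r|x y IHx IHy]; first by rewrite !linear0.
  by rewrite !tmap_tens h.
by rewrite !linearD /= IHx IHy.
Qed.

Lemma torusM (R : alg A) (a a' b b' : R) (x : ext R W) :
  torus a a' (torus b b' x) = torus (a * b) (a' * b') x.
Proof.
rewrite /torus !linearD !linearZ /= (tmap_idem _ epp) (tmap_idem _ emem).
by rewrite (tmap_comp0 _ epem) (tmap_comp0 _ emep) !scaler0 addr0 add0r !scalerA (mulrC a) (mulrC a').
Qed.

Lemma torus1 (R : alg A) (x : ext R W) : torus 1 1 x = x.
Proof. by rewrite /torus !scale1r tmap_ep_em. Qed.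

Lemma torus_linear (R : alg A) (a a' : R) : linear (torus a a').
Proof.
move=> c x y; rewrite /torus [tmap ep _]linearP [tmap em _]linearP /=.
by rewrite !scalerDr !scalerA (mulrC a) (mulrC a') [RHS]addrACA.
Qed.

Lemma torus_ext_map (R R' : alg A) (f : {rmorphism R -> R'}) (a a' : R) (x : ext R W) :
  alg_hom f -> torus (f a) (f a') (ext_map f x) = ext_map f (torus a a' x).
Proof. by move=> hf; rewrite /torus ext_mapD // !ext_mapZ // !ext_map_tmap. Qed.

Lemma torus_polR (R : alg A) (t t' : R) (x y : ext R W) : t * t' = 1 ->
  polR q (torus t t' x) (torus t t' y) = polR q x y.
Proof.
move=> tt.
have pp u w : polR q (tmap ep u) (tmap ep w : ext R W) = 0.
  elim/tensor_ind: u => [|v r|u u' IH IH']; first by rewrite linear0 polR0l.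
    elim/tensor_ind: w => [|v' r'|w w' IH IH']; first by rewrite linear0 polR0r.
      by rewrite !tmap_tens polR_tens // polR1_tens // polar_ep rmorph0 mulr0.
    by rewrite linearD polRDr // IH IH' addr0.
  by rewrite linearD polRDl // IH IH' addr0.
have mm u w : polR q (tmap em u) (tmap em w : ext R W) = 0.
  elim/tensor_ind: u => [|v r|u u' IH IH']; first by rewrite linear0 polR0l.
    elim/tensor_ind: w => [|v' r'|w w' IH IH']; first by rewrite linear0 polR0r.
      by rewrite !tmap_tens polR_tens // polR1_tens // polar_em rmorph0 mulr0.
    by rewrite linearD polRDr // IH IH' addr0.
  by rewrite linearD polRDl // IH IH' addr0.
have Zr (c : R) u w : polR q u (c *: w) = c * polR q u w.
  by rewrite !(polRC q_quad u) polRZl.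
rewrite -{2}(tmap_ep_em x) -{2}(tmap_ep_em y) /torus !(polRDl, polRDr) // !polRZl // !Zr !pp !mm.
rewrite !mulr0 !addr0 !add0r; congr (_ + _); rewrite mulrA ?tt ?mul1r //.
by rewrite mulrC [t' * _]mulrC tt mulr1.
Qed.

(** The two lines need not be free, so no diagonal form is at hand. Sylvester's identity replaces Q
    by the transpose of P inside the determinant, and (1 + (t - 1) P)(1 + (t' - 1) P) is the
    identity. *)
Lemma det_torus_mx (R : alg A) n (P Q : 'M[R]_n) (C D : 'M[R]_n) (t t' : R) :
  P *m Q = 0 -> P *m P = P -> C *m D = Q -> D *m C = P^T -> t * t' = 1 ->
  \det (1%:M + (t - 1) *: P + (t' - 1) *: Q) = 1.
Proof.
move=> PQ PP CD DC tt.
have detQ (x : R) : \det (1%:M + x *: Q) = \det (1%:M + x *: P).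
  rewrite -CD scalemxAl det_add1_mulmxC -scalemxAr DC -det_tr.
  by rewrite linearD linearZ /= trmxK trmx1.
have -> : 1%:M + (t - 1) *: P + (t' - 1) *: Q =
    (1%:M + (t - 1) *: P) *m (1%:M + (t' - 1) *: Q).
  rewrite mulmxDl mul1mx mulmxDr mulmx1 -scalemxAl -scalemxAr PQ !scaler0 addr0.
  by rewrite -addrA [X in _ + X]addrC addrA.
rewrite det_mulmx detQ -det_mulmx -[RHS](@det1 R n); congr determinant.
rewrite mulmxDl mul1mx mulmxDr mulmx1 -scalemxAl -scalemxAr PP scalerA -addrA.
rewrite -[RHS]addr0; congr (_ + _); rewrite -!scalerDl -[RHS](scale0r P); congr (_ *: _).
by transitivity (t * t' - 1); [ring | rewrite tt subrr].
Qed.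

Lemma torus_det (R : alg A) (t t' : R) : t * t' = 1 -> has_det (torus t t') 1.
Proof.
move=> tt; have [[n [i [p ipK]]] _] := W_form.
pose phi := alg_str R.
pose P := lin1_mx (i \o ep \o p); pose Q := lin1_mx (i \o em \o p).
have actP u : u *m P = i (ep (p u)) by rewrite /P mul_rV_lin1.
have actQ u : u *m Q = i (em (p u)) by rewrite /Q mul_rV_lin1.
apply: (@has_det_ext _ R _ n i p
  (1%:M + (t - 1) *: map_mx phi P + (t' - 1) *: map_mx phi Q)) => //.
  move=> u; have [cD cZ] := linearDZ (@ext_coords_linear _ R _ _ i).
  rewrite /torus cD !cZ !ext_coords_tmap -/P -/Q.
  have -> : ext_coords i (ext_proj p u) = u *m map_mx phi P + u *m map_mx phi Q.
    rewrite -{1}(tmap_ep_em (ext_proj p u)) cD !ext_coords_tmap //.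
  rewrite !mulmxDr mulmx1 -!scalemxAr !scalerBl !scale1r.
  by move: (u *m _) (u *m _) => a b; rewrite opprD; rewrite !addrA [RHS](AC 5 (2*4*1*3*5)).
have /choice [c hc] : forall l, exists c, forall w, polar q c w = i w 0 l.
  move=> l.
  have hl : scalar (fun w : W => i w 0 l) by move=> a x y; rewrite linearP !mxE.
  by have [c [hc _]] := W_reg (scalar_of hl); exists c.
(* C is the Gram matrix of the generators of W and D holds the coordinates of the ep (c l). That ep
   and em are adjoint gives C D = Q; the dual basis property of the c l gives D C = P^T. *)
pose C := \matrix_(k, m) polar q (p (delta_mx 0 k)) (p (delta_mx 0 m)).
pose D := \matrix_(m, l) i (ep (c l)) 0 m.
have expand x : x = \sum_m i x 0 m *: p (delta_mx 0 m).
  rewrite -{1}[x]ipK {1}(row_sum_delta (i x)) linear_sum.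
  by apply: eq_bigr => k _; rewrite linearZ.
have CD : C *m D = Q.
  apply/matrixP => k l; rewrite !mxE /= -hc.
  rewrite -polar_adj [in RHS](expand (ep (c l))) polar_suml //.
  by apply: eq_bigr => m _; rewrite !mxE polarZl // mulrC polarC.
have dualc x : \sum_k polar q (p (delta_mx 0 k)) x *: c k = x.
  have hx : scalar (polar q x) by move=> a u v; rewrite polarDr // polarZr.
  have [x' [_ uniq]] := W_reg (scalar_of hx).
  transitivity x'; [apply/esym; apply: uniq|by apply: uniq] => w.
  rewrite polar_suml // [RHS]polarC [in RHS](expand w) polar_suml //.
  by apply: eq_bigr => k _; rewrite !polarZl // hc mulrC.
have DC : D *m C = P^T.
  apply/matrixP => m l; rewrite !mxE /= -{1}(dualc (p (delta_mx 0 l))).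
  rewrite !linear_sum summxE; apply: eq_bigr => k _.
  by rewrite !mxE !linearZ !mxE mulrC.
apply: (@det_torus_mx R n _ _ (map_mx phi C) (map_mx phi D)) => //.
- rewrite -map_mxM; suff -> : P *m Q = 0 by rewrite map_mx0.
  by apply: mx_ext_row => u; rewrite mulmxA actP actQ ipK emep linear0 mulmx0.
- rewrite -map_mxM; congr map_mx.
  by apply: mx_ext_row => u; rewrite mulmxA !actP ipK epp.
- by rewrite -map_mxM CD.
- by rewrite -map_mxM DC map_trmx.
Qed.

Lemma torus_SO (R : alg A) (t t' : R) : t * t' = 1 -> SO W R (torus t t').
Proof.
move=> tt; split; last exact: torus_det.
split; first exact: torus_linear.
- by exists (torus t' t) => x; rewrite torusM ?[t' * t]mulrC tt torus1.
- by move=> x; rewrite /= !(qf_extE q_quad halfE) torus_polR.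
Qed.

End Torus.

(** * The lattice of a regular form *)

Section RegularLattice.
Variables (F : finFieldType) (K : fieldType) (iota : {rmorphism F -> K}).
Hypothesis hK : function_field iota.
Variable S : set (place K).
Local Notation A := (S_integral S).
Variable z : K.
Hypotheses (zA : z \in A) (zVA : z^-1 \notin A).
Variables (half : O_S S) (halfE : half * 2 = 1).
Variables (X : qform (O_S S)) (X_form : is_qform X) (X_reg : regular_form (@qf _ X)).

Local Notation KA := (K_alg S).
Local Notation E := (ext KA X).
Local Notation q := (@qf _ X).
Let q_quad : quadratic q := X_form.2.

Definition emb (v : X) : E := tens (alg_str KA) v (1 : K^o).

Definition lat (u : E) : Prop := exists v, u = emb v.

Local Notation b := (@polR _ KA X q).

Lemma embD u v : emb (u + v) = emb u + emb v.
Proof. exact: tensDl. Qed.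

Lemma embZ (a : O_S S) v : emb (a *: v) = val a *: emb v.
Proof. by rewrite /emb tensZl tensZ. Qed.

Lemma inA_val (c : K) : c \in A -> exists a : O_S S, c = val a.
Proof. by move=> cA; exists (Sub c cA). Qed.

Lemma valA (a : O_S S) : val a \in A.
Proof. exact: (valP a). Qed.

Lemma emb_inj : injective emb.
Proof.
have [[n [i [p ipK]]] _] := X_form.
move=> u v e; apply: (can_inj ipK); apply/rowP => k; apply: val_inj.
have := congr1 (fun x => ext_coords i x 0 k) e.
by rewrite /emb !ext_coords_tens !scale1r !mxE.
Qed.

Lemma emb_form u v : b (emb u) (emb v) = val (polar q u v).
Proof. by rewrite polR_tens // polR1_tens // !mul1r. Qed.

Lemma lat_emb v : lat (emb v). Proof. by exists v. Qed.

Lemma latD u u' : lat u -> lat u' -> lat (u + u').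
Proof. by move=> [v ->] [v' ->]; exists (v + v'); rewrite embD. Qed.

Lemma latZ c u : c \in A -> lat u -> lat (c *: u).
Proof. by move=> /inA_val [a ->] [v ->]; exists (a *: v); rewrite embZ. Qed.

Lemma lat_gen : exists m (g : 'I_m -> E), (forall i, lat (g i)) /\
  forall u, lat u -> exists c : 'I_m -> K, (forall i, c i \in A) /\ u = \sum_i c i *: g i.
Proof.
have [[n [i [p ipK]]] _] := X_form.
exists n, (fun k => emb (p (delta_mx 0 k))); split=> [k|u [v ->]]; first exact: lat_emb.
exists (fun k => val (i v 0 k)); split=> [k|]; first exact: valA.
rewrite -{1}[v]ipK {1}(row_sum_delta (i v)) linear_sum /=.
elim/big_rec2: _ => [|k x y _ <-]; first by rewrite /emb tens0l.
by rewrite embD linearZ embZ.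
Qed.

Lemma lat_span u : exists2 d, (d \in A) && (d != 0) & lat (d *: u).
Proof.
elim/tensor_ind: u => [|v r|u u' [d /andP[dA d0] h] [d' /andP[dA' d0'] h']].
- exists 1; first by rewrite rpred1 oner_neq0.
  by exists 0; rewrite scaler0 /emb tens0l.
- have [d dd dr] := frac_A hK zA zVA r; exists d => //.
  have [a e] := inA_val dr; exists (a *: v).
  by rewrite embZ tensE scalerA e.
- exists (d * d'); first by rewrite rpredM ?mulf_neq0.
  rewrite scalerDr; apply: latD; last by rewrite -scalerA; apply: latZ.
  by rewrite mulrC -scalerA; apply: latZ.
Qed.

Lemma lat_int u u' : lat u -> lat u' -> b u u' \in A.
Proof. by move=> [v ->] [v' ->]; rewrite emb_form valA. Qed.

Lemma lat_nondeg u : (forall w, lat w -> b u w = 0) -> u = 0.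
Proof.
move=> h; have [d /andP[dA d0] [v e]] := lat_span u.
suff v0 : v = 0.
  have : d *: u = 0 by rewrite e v0 /emb tens0l.
  by move/eqP; rewrite scaler_eq0 (negbTE d0) => /eqP.
have h0 : scalar (fun _ : X => 0 : O_S S) by move=> a x y; rewrite mulr0 addr0.
have [v' [_ uniq]] := X_reg (scalar_of h0).
transitivity v'; [apply/esym; apply: uniq => w | apply: uniq => w]; last first.
  by rewrite /= -(scale0r (0 : X)) polarZl // mul0r.
apply: val_inj; rewrite -emb_form -e polRZl // h ?mulr0 //.
by exists w.
Qed.

(** Integral pairings define a linear form on X, which regularity represents by a vector of X;
    non-degeneracy identifies it with u. *)
Lemma lat_dual u : (forall u', lat u' -> b u u' \in A) -> lat u.
Proof.
move=> h.
have /choice [f hf] : forall v, exists a : O_S S, b u (emb v) = val a.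
  by move=> v; apply: inA_val; apply: h; exact: lat_emb.
have hs : scalar f.
  move=> a x y; apply: val_inj; rewrite rmorphD rmorphM /= -!hf embD embZ.
  by rewrite polRDr // (polRC q_quad u) polRZl // polRC.
have [v [hv _]] := X_reg (scalar_of hs).
exists v; apply/eqP; rewrite -subr_eq0; apply/eqP; apply: lat_nondeg => w [v' ->].
rewrite polRDl // -scaleN1r polRZl // emb_form hv /= -hf mulN1r subrr //.
Qed.

Lemma ext_span (g1 g2 : E -> E) : linear g1 -> linear g2 ->
  (forall v, g1 (emb v) = g2 (emb v)) -> g1 =1 g2.
Proof.
move=> /linearDZ [D1 Z1] /linearDZ [D2 Z2] h u.
elim/tensor_ind: u => [|v r|u u' IH IH']; first by rewrite -(scale0r 0) Z1 Z2 !scale0r.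
  by rewrite tensE Z1 Z2 h.
by rewrite D1 D2 IH IH'.
Qed.

End RegularLattice.

(** * Isotropic planes and their special orthogonal group *)

Section HyperbolicPlane.
Variables (F : finFieldType) (K : fieldType) (iota : {rmorphism F -> K}).
Hypothesis hK : function_field iota.
Variable S : set (place K).
Local Notation A := (S_integral S).
Variable z : K.
Hypotheses (zA : z \in A) (zVA : z^-1 \notin A) (two0 : (2 : K) != 0).
Variables (half : O_S S) (halfE : half * 2 = 1).
Variables (W : qform (O_S S)) (W_form : is_qform W) (W_reg : regular_form (@qf _ W)).
Hypotheses (W_rank : has_rank W 2) (W_iso : isotropic (@qf _ W)).

Local Notation KA := (K_alg S).
Local Notation E := (ext KA W).
Local Notation q := (@qf _ W).
Local Notation b := (@polR _ KA W q).
Let q_quad : quadratic q := W_form.2.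

Let bC u u' : b u u' = b u' u. Proof. exact: polRC. Qed.
Let bD u u' w : b (u + u') w = b u w + b u' w. Proof. exact: polRDl. Qed.
Let bZ c u w : b (c *: u) w = c * b u w. Proof. exact: polRZl. Qed.
Let bDr w u u' : b w (u + u') = b w u + b w u'. Proof. exact: polRDr. Qed.
Let bZr c u w : b w (c *: u) = c * b w u. Proof. by rewrite bC bZ bC. Qed.

Let bB u u' w : b (u - u') w = b u w - b u' w. Proof. exact: bfBl bD bZ _ _ _. Qed.

Lemma isotropic_basis : exists e1 e2 : E,
  [/\ b e1 e1 = 0, b e2 e2 = 0, b e1 e2 = 1 & forall u, u = b u e2 *: e1 + b u e1 *: e2].
Proof.
have [w w0 qw] := W_iso.
have [y cy] : exists y, polar q w y != 0.
  apply: contrapT => no; move/eqP: w0; apply.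
  apply: (emb_inj W_form); rewrite [RHS]tens0l.
  apply: (lat_nondeg hK zA zVA W_form W_reg) => u [y ->]; rewrite emb_form //.
  have -> : polar q w y = 0 by apply/eqP; apply: contrapT => /negP h; apply: no; exists y.
  by [].
pose c := val (polar q w y); have c0 : c != 0 by [].
(* The multiple of w is chosen to make the partner isotropic: it contributes - 2 q(y) / c^2 to b e2
   e2. *)
pose e1 := emb w; pose e2 := c^-1 *: emb y + - (val (q y) / c ^+ 2) *: emb w.
have b11 : b e1 e1 = 0 by rewrite emb_form // polarvv // qw mulr0.
have bwy : b (emb w) (emb y) = c by rewrite emb_form.
have byy : b (emb y) (emb y) = 2 * val (q y).
  by rewrite emb_form // polarvv // rmorphM rmorph_nat.
have b12 : b e1 e2 = 1 by rewrite /e2 bDr !bZr bwy b11 mulr0 addr0 mulVf.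
have b22 : b e2 e2 = 0.
  rewrite /e2 !(bD, bZ, bDr, bZr) (bC (emb y) (emb w)) bwy byy b11.
  by field.
clearbody e1 e2; exists e1, e2; split=> // u.
have [f [g fK gK]] := W_rank (\val : {rmorphism O_S S -> K}).
pose f' : E -> 'rV[K]_2 := f.
have f'D x x' : f' (x + x') = f' x + f' x' by exact: linearD.
have f'Z k x : f' (k *: x) = k *: f' x by exact: linearZ.
have f'inj : injective f' := can_inj fK.
pose M : 'M[K]_2 := \matrix_i (if i == 0 then f' e1 else f' e2).
have rowM (x : 'rV[K]_2) : x *m M = f' (x 0 0 *: e1 + x 0 1 *: e2).
  rewrite mulmx_sum_row big_ord_recl big_ord1 !rowK f'D !f'Z /=.
  by congr (_ + x 0 _ *: _); apply: val_inj.
have Mfree : row_free M.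
  rewrite -kermx_eq0; apply/rowV0P => x /sub_kermxP; rewrite rowM => xM.
  have {}xM : x 0 0 *: e1 + x 0 1 *: e2 = 0.
    by apply: f'inj; rewrite xM; apply/esym; exact: linear0.
  have x00 : x 0 0 = 0.
    have := congr1 (b^~ e2) xM; rewrite bD !bZ b12 b22 mulr0 mulr1 addr0 => ->.
    by rewrite polR0l.
  have x01 : x 0 1 = 0.
    have := congr1 (b^~ e1) xM; rewrite bD !bZ (bC e2) b12 b11 mulr0 mulr1 add0r => ->.
    by rewrite polR0l.
  apply/rowP => j; rewrite mxE; case: j => [[|[|//]] jlt].
    by rewrite -[RHS]x00; congr (x _ _); apply: val_inj.
  by rewrite -[RHS]x01; congr (x _ _); apply: val_inj.
rewrite row_free_unit in Mfree.
have [x ex] : exists x : 'rV[K]_2, u = x 0 0 *: e1 + x 0 1 *: e2.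
  exists (f' u *m invmx M); apply: f'inj.
  by rewrite -rowM mulmxKV.
have xu1 : b u e2 = x 0 0 by rewrite ex bD !bZ b12 b22 mulr0 mulr1 addr0.
have xu2 : b u e1 = x 0 1 by rewrite {1}ex bD !bZ (bC e2) b12 b11 mulr0 mulr1 add0r.
by rewrite xu1 xu2.
Qed.

Variables (e1 e2 : E).
Hypotheses (b11 : b e1 e1 = 0) (b22 : b e2 e2 = 0) (b12 : b e1 e2 = 1)
  (e12 : forall u, u = b u e2 *: e1 + b u e1 *: e2).

(** The two projections of v have sum v, and their difference is in the lattice because its pairings
    have squares in A. As 2 is invertible, the splitting of the plane into isotropic lines exists
    over A. *)
Lemma projector_lat v : lat (b (emb v) e2 *: e1) /\ lat (b (emb v) e1 *: e2).
Proof.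
have b21 : b e2 e1 = 1 by rewrite bC.
have halfK : val half * 2 = 1 by rewrite -(rmorph_nat (\val : O_S S -> K)) -rmorphM halfE.
have Dlat : lat (b (emb v) e2 *: e1 - b (emb v) e1 *: e2).
  apply: (lat_dual hK zA zVA W_form W_reg) => _ [w ->].
  (* The square of this coordinate is the discriminant of the plane spanned by
     v and w, so A being integrally closed contains it. *)
  apply: sqr_inA.
  rewrite bB !bZ.
  have ev := e12 (emb v); have ew := e12 (emb w).
  have vv : 2 * (b (emb v) e2 * b (emb v) e1) = b (emb v) (emb v).
    by rewrite {3 4}ev !(bD, bDr, bZ, bZr) b11 b22 b12 b21; ring.
  have ww : 2 * (b (emb w) e2 * b (emb w) e1) = b (emb w) (emb w).
    by rewrite {3 4}ew !(bD, bDr, bZ, bZr) b11 b22 b12 b21; ring.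
  have vw : b (emb v) e2 * b (emb w) e1 + b (emb v) e1 * b (emb w) e2 = b (emb v) (emb w).
    by rewrite {3}ev {3}ew !(bD, bDr, bZ, bZr) b11 b22 b12 b21; ring.
  rewrite (bC e1) (bC e2).
  have -> : (b (emb v) e2 * b (emb w) e1 - b (emb v) e1 * b (emb w) e2) ^+ 2 =
     b (emb v) (emb w) ^+ 2 - b (emb v) (emb v) * b (emb w) (emb w).
    by rewrite -vv -ww -vw; ring.
  by rewrite !emb_form // rpredB ?rpredX ?rpredM ?valA.
have D1 : b (emb v) e2 *: e1 = val half *: (emb v + (b (emb v) e2 *: e1 - b (emb v) e1 *: e2)).
  rewrite {2}(e12 (emb v)) addrACA subrr addr0 -scalerDl scalerA.
  by congr (_ *: _); rewrite -mulr2n -mulr_natl mulrA halfK mul1r.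
have D2 : b (emb v) e1 *: e2 = val half *: (emb v - (b (emb v) e2 *: e1 - b (emb v) e1 *: e2)).
  rewrite {2}(e12 (emb v)) opprB addrC addrA addrNK -scalerDl scalerA.
  by congr (_ *: _); rewrite -mulr2n -mulr_natl mulrA halfK mul1r.
have nl u : lat u -> lat (- u) by move=> h; rewrite -scaleN1r; apply: latZ h; rewrite rpredN rpred1.
split; [rewrite D1 | rewrite D2]; apply: latZ (valA _) _; apply: latD.
- exact: lat_emb.
- exact: Dlat.
- exact: lat_emb.
- exact: nl.
Qed.

Lemma projectors : exists ep em : {linear W -> W},
  [/\ forall x, ep x + em x = x, forall x, ep (ep x) = ep x,
      forall x, q (ep x) = 0, forall x, q (em x) = 0 &
      (forall u, tmap ep u = b u e2 *: e1) /\ (forall u, tmap em u = b u e1 *: e2)].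
Proof.
have b21 : b e2 e1 = 1 by rewrite bC.
have inj := emb_inj W_form.
have /choice [f hf] : forall v, exists w : W, b (emb v) e2 *: e1 = emb w.
  by move=> v; have [] := projector_lat v.
have /choice [g hg] : forall v, exists w : W, b (emb v) e1 *: e2 = emb w.
  by move=> v; have [] := projector_lat v.
have fl : linear f.
  by move=> a x y; apply: inj; rewrite embD embZ -!hf embD embZ bD bZ scalerDl scalerA.
have gl : linear g.
  by move=> a x y; apply: inj; rewrite embD embZ -!hg embD embZ bD bZ scalerDl scalerA.
have q0 u : b (emb u) (emb u) = 0 -> q u = 0.
  rewrite emb_form // polarvv // => h; have /val_inj h2 : val (2 * q u) = val (0 : O_S S) by [].
  by rewrite -[q u]mul1r -halfE -mulrA h2 mulr0.
exists (linear_of fl), (linear_of gl); split=> /=.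
- by move=> x; apply: inj; rewrite embD -hf -hg -e12.
- by move=> x; apply: inj; rewrite -!hf bZ b12 mulr1.
- by move=> x; apply: q0; rewrite -hf bZ bZr b11 !mulr0.
- by move=> x; apply: q0; rewrite -hg bZ bZr b22 !mulr0.
split.
  apply: ext_span; first exact: linearP.
    by move=> a x y; rewrite bD bZ scalerDl scalerA.
  by move=> v; rewrite hf tmap_tens.
apply: ext_span; first exact: linearP.
  by move=> a x y; rewrite bD bZ scalerDl scalerA.
by move=> v; rewrite hg tmap_tens.
Qed.

(** An isometry of the plane preserves or exchanges its two isotropic lines, and an exchange has
    determinant -1. *)
Lemma SO_torus (ep em : {linear W -> W}) g :
  (forall u, tmap ep u = b u e2 *: e1) -> (forall u, tmap em u = b u e1 *: e2) ->
  SO W KA g -> exists2 u : K, u != 0 & g = torus ep em (u : KA) (u^-1 : KA).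
Proof.
move=> epE emE [[gl gb gq] gdet].
have b21 : b e2 e1 = 1 by rewrite bC.
have [gD gZ] := linearDZ gl.
have polg x y : b (g x) (g y) = b x y.
  rewrite -!(polar_qf_ext q_quad halfE) /polar -gD; congr (_ - _ - _); exact: gq.
have g11 : b (g e1) (g e1) = 0 by rewrite polg.
have g22 : b (g e2) (g e2) = 0 by rewrite polg.
have g12 : b (g e1) (g e2) = 1 by rewrite polg.
have h1 := e12 (g e1); have h2 := e12 (g e2).
move: h1 h2; set al := b (g e1) e2; set be := b (g e1) e1; set ga := b (g e2) e2; set de := b (g e2) e1.
move=> h1 h2.
rewrite h1 h2 !(bD, bDr, bZ, bZr) b11 b22 b12 b21 in g11 g22 g12.
have r1 : al * be = 0 by apply: (mulfI two0); rewrite mulr0 -[RHS]g11; ring.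
have r2 : ga * de = 0 by apply: (mulfI two0); rewrite mulr0 -[RHS]g22; ring.
have r3 : al * de + be * ga = 1 by rewrite -[RHS]g12; ring.
have [be0|be0] := eqVneq be 0.
  have ad : al * de = 1 by rewrite -[RHS]r3 be0; ring.
  have al0 : al != 0 by apply: contra_eq_neq ad => ->; rewrite mul0r eq_sym oner_neq0.
  have de0 : de != 0 by apply: contra_eq_neq ad => ->; rewrite mulr0 eq_sym oner_neq0.
  have ga0 : ga = 0 by move/eqP: r2; rewrite mulf_eq0 (negbTE de0) orbF => /eqP.
  exists al => //; apply/funext => u.
  rewrite {1}(e12 u) gD !gZ h1 h2 be0 ga0 !scale0r addr0 add0r /torus epE emE.
  by rewrite !scalerA ![_ * b u _]mulrC -(mulKf al0 de) ad mulr1.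
have al0 : al = 0 by move/eqP: r1; rewrite mulf_eq0 (negbTE be0) orbF => /eqP.
have bg : be * ga = 1 by rewrite -[RHS]r3 al0; ring.
have de0 : de = 0.
  have ga0 : ga != 0 by apply: contra_eq_neq bg => ->; rewrite mulr0 eq_sym oner_neq0.
  by move/eqP: r2; rewrite mulf_eq0 (negbTE ga0) => /eqP.
case: gdet => n [i [p [ipK dt]]].
(* In coordinates g - 1 factors through the two forms b(., e2) and b(., e1), so Sylvester's identity
   brings the determinant from size n down to size 2. *)
pose C : 'M[K]_(n, 2) := \matrix_(k, j) b (p (delta_mx 0 k)) (if j == 0 then e2 else e1).
pose D : 'M[K]_(2, n) := \matrix_j (if j == 0 then i (g e1 - e1) else i (g e2 - e2)).
have rowC (r : 'rV[K]_n) j : (r *m C) 0 j = b (p r) (if j == 0 then e2 else e1).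
  rewrite mxE [in RHS](row_sum_delta r) linear_sum.
  have -> t : b (\sum_k p (r 0 k *: delta_mx 0 k)) t = \sum_k r 0 k * b (p (delta_mx 0 k)) t.
    elim/big_rec2: _ => [|k x y _ <-]; first exact: polR0l.
    by rewrite bD linearZ bZ.
  by apply: eq_bigr => k _; rewrite mxE.
have : \det (1%:M + C *m D) = 1.
  rewrite [RHS]dt; congr determinant; apply/matrixP => k l; rewrite [RHS]mxE.
  rewrite mxE [X in X + _]mxE; set r := delta_mx 0 k.
  have -> : (C *m D) k l = (i (g (p r)) - i (p r)) 0 l.
    have -> : (C *m D) k l = (r *m C *m D) 0 l by rewrite -mulmxA /r -rowE [RHS]mxE.
    rewrite mulmx_sum_row big_ord_recl big_ord1 !rowC !rowK /=.
    have key u : g u - u = b u e2 *: (g e1 - e1) + b u e1 *: (g e2 - e2).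
      transitivity (g (b u e2 *: e1 + b u e1 *: e2) - (b u e2 *: e1 + b u e1 *: e2)).
        by rewrite -e12.
      by rewrite gD !gZ opprD addrACA !scalerBr.
    suff -> : i (g (p r)) - i (p r) =
      b (p r) e2 *: i (g e1 - e1) + b (p r) e1 *: i (g e2 - e2) by [].
    have [iD iZ] := linearDZ (linearP i).
    have iN u u' : i (u - u') = i u - i u' by rewrite -scaleN1r iD iZ scaleN1r.
    by rewrite -!iZ -iD -key iN.
  by rewrite !mxE eqxx /= eq_sym; ring.
(* Adding 1 leaves a matrix with zero diagonal and determinant - be ga = -1. *)
rewrite det_add1_mulmxC; have -> : D *m C = \matrix_(j, l)
    (if j == l then -1 else if j == 0 then be else ga).
  apply/matrixP => j l; rewrite mxE.
  have -> : (\sum_k D j k * C k l) = (row j D *m C) 0 l by rewrite -row_mul !mxE.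
  rewrite rowC rowK; case: j => [[|[|//]] jlt]; case: l => [[|[|//]] llt] /=;
    rewrite ipK bB ?h1 ?h2 !bD !bZ ?b11 ?b22 ?b12 ?b21 ?al0 ?de0 mxE -?val_eqE /=; ring.
rewrite (expand_det_row _ ord0) big_ord_recl big_ord1 /cofactor !det_mx11 !mxE /=.
rewrite subrr mul0r !add0r /bump /= addn0 expr1 mulN1r mulrN bg => d1.
by move/eqP: two0; case; rewrite mulr2n -[X in _ + X]d1 subrr.
Qed.

End HyperbolicPlane.

(** * Squares in the Picard group *)

Section InvertibleModules.
Variables (K : fieldType) (S : set (place K)).
Local Notation A := (O_S S).

Lemma O_S_domain (x y : A) : x != 0 -> x * y = 0 -> y = 0.
Proof.
move=> x0 /(congr1 val); rewrite rmorphM rmorph0 => /eqP; rewrite mulf_eq0.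
by rewrite (negbTE (x0 : val x != 0)) => /= /eqP h; apply: val_inj.
Qed.

Lemma O_S_valD (x y : A) : \val (x + y) = \val x + \val y.
Proof. exact: rmorphD. Qed.
Lemma O_S_valM (x y : A) : \val (x * y) = \val x * \val y.
Proof. exact: rmorphM. Qed.
Lemma O_S_val_sum (I : Type) (r : seq I) (g : I -> A) :
  \val (\sum_(i <- r) g i) = \sum_(i <- r) \val (g i).
Proof. exact: rmorph_sum. Qed.

Variables (L M : lmodType A) (f : {linear tensor idfun L M -> A^o}).
Hypothesis f_bij : bijective f.

Local Notation tn m n := (tens (idfun : {rmorphism A -> A}) m n : tensor idfun L M).

Definition pairing (m : L) (n : M) : A := f (tn m n).
Local Notation "<| m , n |>" := (pairing m n).

Lemma pairingDl m m' n : <|m + m', n|> = <|m, n|> + <|m', n|>.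
Proof. by rewrite /pairing tensDl linearD. Qed.
Lemma pairingDr m n n' : <|m, n + n'|> = <|m, n|> + <|m, n'|>.
Proof. by rewrite /pairing tensDr linearD. Qed.
Lemma pairingZr a m n : <|m, a *: n|> = a * <|m, n|>.
Proof. by rewrite /pairing -tensZ linearZ. Qed.
Lemma pairingZl a m n : <|a *: m, n|> = a * <|m, n|>.
Proof. by rewrite -pairingZr /pairing tensZl. Qed.

Lemma pairing_suml (I : Type) (r : seq I) (g : I -> L) n :
  <|\sum_(i <- r) g i, n|> = \sum_(i <- r) <|g i, n|>.
Proof. by rewrite /pairing tens_suml linear_sum. Qed.

Lemma pairing_one : exists d (mm : 'I_d -> L) (nn : 'I_d -> M),
  f (\sum_k tn (mm k) (nn k)) = 1.
Proof.
have [g fK gK] := f_bij.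
have pis s : \pi_(tensor idfun L M) s = \sum_(p <- s) tn p.1 p.2.
  elim: s => [|p s IH]; first by rewrite big_nil.
  by rewrite pi_cons big_cons IH.
have [s es] : exists s, g 1 = \pi_(tensor idfun L M) s.
  by elim/tensorW: (g 1) => s; exists s.
exists (size s), (fun k => (tnth (in_tuple s) k).1), (fun k => (tnth (in_tuple s) k).2).
by rewrite -[RHS]gK es pis (big_tnth _ _ s).
Qed.

Variables (d : nat) (mm : 'I_d -> L) (nn : 'I_d -> M).
Hypothesis f_one : f (\sum_k tn (mm k) (nn k)) = 1.

Lemma pairing_sum1 : \sum_k <|mm k, nn k|> = 1.
Proof. by rewrite -f_one linear_sum. Qed.

(** All the tensors of y with some n vanish. The form <|m', .|> turns this into <|m', n|> *: y = 0,
    and the <|mm k, nn k|> add up to 1. *)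
Lemma pairing_nondeg y : (forall n, <|y, n|> = 0) -> y = 0.
Proof.
move=> h; have [g fK gK] := f_bij.
have t0 n : tn y n = 0.
  by apply: (can_inj fK); rewrite linear0; exact: h.
have kill m' n : <|m', n|> *: y = 0.
  have hb : balanced (idfun : {rmorphism A -> A}) (fun y n => <|m', n|> *: y : L).
    split=> [u v w|v w w'|a v w] /=; first by rewrite scalerDr.
      by rewrite pairingDr scalerDl.
    by rewrite pairingZr !scalerA mulrC.
  by have := tlift_tens y n hb; rewrite t0 (tlift0 hb).
by rewrite -[y]scale1r -pairing_sum1 scaler_suml big1.
Qed.

(** The tensor product is free of rank one on the sum of the tensors of mm k and nn k, so a bilinear
    map is determined by its value there. *)
Lemma bilinear_multiple (g : L -> M -> A) : balanced (idfun : {rmorphism A -> A}) (g : L -> M -> A^o) ->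
  (forall a m n, g m (a *: n) = a * g m n) ->
  forall m n, g m n = (\sum_k g (mm k) (nn k)) * <|m, n|>.
Proof.
move=> hg gZ m n; have [h fK hK] := f_bij.
have e : tn m n = <|m, n|> *: \sum_k tn (mm k) (nn k).
  by apply: (can_inj fK); rewrite linearZ /= f_one [RHS]mulr1.
have lin : linear (tlift (g : L -> M -> A^o) : tensor idfun L M -> A^o).
  by apply: tlift_linear => // v r w; exact: gZ.
have [tD tZ] := linearDZ lin.
rewrite -(tlift_tens m n hg) e tZ mulrC; congr (_ * _).
elim: (index_enum _) => [|k r IH]; first by rewrite !big_nil (tlift0 hg).
by rewrite !big_cons tD IH tlift_tens.
Qed.

(* L has rank one. *)
Lemma pairing_exchange m n m' n' : <|m', n|> * <|m, n'|> = <|m', n'|> * <|m, n|>.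
Proof.
pose c m' n' := \sum_k <|m', nn k|> * <|mm k, n'|>.
have e1 u v u' v' : <|u', v|> * <|u, v'|> = c u' v' * <|u, v|>.
  apply: (@bilinear_multiple (fun u v => <|u', v|> * <|u, v'|>)) => [|a p r].
    split=> [p r s|p r s|a p r]; rewrite ?pairingDl ?pairingDr ?pairingZl ?pairingZr /=.
    - by rewrite mulrDr.
    - by rewrite mulrDl.
    - by rewrite mulrCA mulrA.
  by rewrite pairingZr mulrA.
(* A second use of [bilinear_multiple]: the two sides of the exchange differ by a constant factor,
   which is 1 by comparison at a pair with non-zero pairing. *)
have [eps e2] : exists eps, forall u v, c u v = eps * <|u, v|>.
  exists (\sum_k c (mm k) (nn k)).
  apply: (@bilinear_multiple c) => [|a p r].
    split=> [p r s|p r s|a p r]; rewrite /c.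
    - by rewrite -big_split; apply: eq_bigr => k _; rewrite pairingDl mulrDl.
    - by rewrite -big_split; apply: eq_bigr => k _; rewrite pairingDr mulrDr.
    - by apply: eq_bigr => k _; rewrite pairingZl pairingZr /=; ring.
  by rewrite /c mulr_sumr; apply: eq_bigr => k _; rewrite pairingZr; ring.
have [[u v] uv0] : exists p : L * M, <|p.1, p.2|> != 0.
  apply: contrapT => no; move/eqP: (oner_neq0 A); apply; rewrite -pairing_sum1 big1 // => k _.
  by apply/eqP; apply: contrapT => /negP h; apply: no; exists (mm k, nn k).
have eps1 : eps = 1.
  have := e1 u v u v; rewrite e2 => /eqP; rewrite eq_sym -subr_eq0 -mulrA.
  have -> : eps * (<|u, v|> * <|u, v|>) - <|u, v|> * <|u, v|> =
    <|u, v|> * (<|u, v|> * (eps - 1)) by ring.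
  by move/eqP/(O_S_domain uv0)/(O_S_domain uv0)/eqP; rewrite subr_eq0 => /eqP.
by rewrite e1 e2 eps1 mul1r.
Qed.

Lemma pairing_expand m : m = \sum_k <|m, nn k|> *: mm k.
Proof.
apply/eqP; rewrite -subr_eq0; apply/eqP; apply: pairing_nondeg => n.
rewrite -scaleN1r pairingDl pairingZl pairing_suml mulN1r.
apply/eqP; rewrite subr_eq0; apply/eqP; rewrite -[LHS]mulr1 -pairing_sum1 mulr_sumr.
by apply: eq_bigr => k _; rewrite pairingZl mulrC pairing_exchange mulrC.
Qed.

Variables (m0 : L) (n0 : M).
Hypothesis d0 : <|m0, n0|> != 0.

(** Pairing with n0 realizes L as the fractional ideal with these generators; the [inverse_gen]
    generate the inverse ideal. *)
Definition ideal_gen k : K := val <|mm k, n0|>.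
Definition inverse_gen k : K := val <|m0, nn k|> / val <|m0, n0|>.
Local Notation a := ideal_gen.
Local Notation b := inverse_gen.

Lemma coord_gen m k : val <|m, n0|> * b k = val <|m, nn k|>.
Proof.
rewrite /b mulrA; apply: (mulIf (d0 : val <|m0, n0|> != 0)); rewrite divfK //.
by rewrite -!O_S_valM pairing_exchange.
Qed.

(** The hypotheses say that u generates the square of the ideal. The tensor of m and m' goes to the
    product of their images divided by u; the inverse map has the coefficients u b_k b_l on the
    tensors of mm k and mm l. *)
Lemma tpow2_trivial (u : K) : u != 0 -> (forall k l, a k * a l / u \in S_integral S) ->
  (forall k l, u * b k * b l \in S_integral S) -> lin_iso (tpow L 2) A^o.
Proof.
move=> u0 aau ubb.
have alE m : val <|m, n0|> = \sum_k val <|m, nn k|> * a k.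
  rewrite {1}(pairing_expand m) pairing_suml O_S_val_sum.
  by apply: eq_bigr => k _; rewrite pairingZl O_S_valM.
have /choice [th hth] : forall p : L * L, exists t : A, val t = val <|p.1, n0|> * val <|p.2, n0|> / u.
  move=> [m m'] /=; suff h : val <|m, n0|> * val <|m', n0|> / u \in S_integral S by exists (exist (fun x : K => x \in S_integral S) _ h).
  rewrite (alE m) (alE m') mulr_suml mulr_suml; apply: rpred_sum => k _.
  rewrite mulr_sumr mulr_suml; apply: rpred_sum => l _.
  have -> : val <|m, nn k|> * a k * (val <|m', nn l|> * a l) / u =
    (val <|m, nn k|> * val <|m', nn l|>) * (a k * a l / u) by ring.
  by rewrite rpredM // rpredM // (valP (_ : A)).
have /choice [be hbe] : forall p : 'I_d * 'I_d, exists t : A, val t = u * b p.1 * b p.2.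
  by move=> [k l]; exists (exist (fun x : K => x \in S_integral S) _ (ubb k l)).
have {}hth m m' : \val (th (m, m')) = \val <|m, n0|> * \val <|m', n0|> / u by exact: hth (m, m').
have {}hbe k l : \val (be (k, l)) = u * b k * b l by exact: hbe (k, l).
have thDl m1 m2 m : th (m1 + m2, m) = th (m1, m) + th (m2, m).
  by apply: val_inj; rewrite O_S_valD !hth pairingDl O_S_valD; ring.
have thDr m1 m2 m : th (m, m1 + m2) = th (m, m1) + th (m, m2).
  by apply: val_inj; rewrite O_S_valD !hth pairingDl O_S_valD; ring.
have thZl c m1 m : th (c *: m1, m) = c * th (m1, m).
  by apply: val_inj; rewrite O_S_valM !hth pairingZl O_S_valM; ring.
have thZr c m1 m : th (m, c *: m1) = c * th (m, m1).
  by apply: val_inj; rewrite O_S_valM !hth pairingZl O_S_valM; ring.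
pose id' := (idfun : {rmorphism A -> A}).
pose T1 := tensor id' L A^o; pose T2 := tensor id' L T1.
pose g1 m (t : T1) : A^o := tlift (fun m' (r : A^o) => (r : A) * th (m, m') : A^o) t.
have bal1 m : balanced id' (fun m' (r : A^o) => (r : A) * th (m, m') : A^o).
  split=> [p q r|p q r|c p q] /=; first by rewrite thDr mulrDr.
    by rewrite mulrDl.
  by rewrite thZr /GRing.scale /=; ring.
have g1lin m : linear (g1 m).
  by apply: tlift_linear => // p r w; rewrite /GRing.scale /= mulrA.
have g10 m : g1 m 0 = 0 by exact: (tlift0 (bal1 m)).
have g1t m m' (r : A) : g1 m (tens id' m' (r : A^o)) = r * th (m, m').
  exact: (tlift_tens m' (r : A^o) (bal1 m)).
have bal2 : balanced id' g1.
  split=> [p q t|p t t'|c p t].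
  - elim/tensor_ind: t => [|m r|t t' IH IH'].
    + by rewrite !g10 addr0.
    + by rewrite !g1t thDl mulrDr.
    + have [D1 _] := linearDZ (g1lin (p + q)); have [D2 _] := linearDZ (g1lin p).
      have [D3 _] := linearDZ (g1lin q).
      by rewrite D1 D2 D3 IH IH' addrACA.
  - by have [D1 _] := linearDZ (g1lin p); rewrite D1.
  - have [D2 Z2] := linearDZ (g1lin p); have [D1 _] := linearDZ (g1lin (c *: p)).
    rewrite Z2; elim/tensor_ind: t => [|m r|t t' IH IH'].
    + by rewrite !g10 scaler0.
    + by rewrite !g1t thZl /GRing.scale /=; ring.
    + by rewrite D1 D2 IH IH' scalerDr.
pose h (x : T2) : A^o := tlift g1 x.
have hlin : linear h.
  by apply: tlift_linear => // m r t; have [_ ->] := linearDZ (g1lin m).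
pose hi (r : A) : T2 := \sum_k \sum_l tens id' (mm k) (tens id' (mm l) (r * be (k, l) : A^o) : T1).
have hiD r r' : hi (r + r') = hi r + hi r'.
  rewrite /hi -big_split; apply: eq_bigr => k _; rewrite -big_split; apply: eq_bigr => l _.
  by rewrite mulrDl !tensDr.
exists (linear_of hlin); exists hi => [x|r] /=.
  have [hD _] := linearDZ hlin; have h0 : hi 0 = 0.
    by apply: (addrI (hi 0)); rewrite -hiD !addr0.
  elim/tensor_ind: x => [|m t|x y IHx IHy]; last by rewrite hD hiD IHx IHy.
    by rewrite /h (tlift0 bal2).
  have [gD _] := linearDZ (g1lin m).
  rewrite /h tlift_tens //; elim/tensor_ind: t => [|m' r|x y IHx IHy].
  - by rewrite g10 h0 tens0r.
  - rewrite g1t {2}(pairing_expand m) tens_suml; apply: eq_bigr => k _.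
    rewrite {2}(pairing_expand m') tens_suml tens_sumr; apply: eq_bigr => l _.
    rewrite !tensZl -[in RHS]tensZ !tensZ; congr (tens _ _ (tens _ _ _)).
    apply: val_inj; rewrite !O_S_valM hth hbe -(coord_gen m k) -(coord_gen m' l).
    by field.
  - by rewrite gD hiD IHx IHy tensDr.
have [hD _] := linearDZ hlin.
have hsum (I : Type) (s : seq I) (G : I -> T2) : h (\sum_(i <- s) G i) = \sum_(i <- s) h (G i).
  elim: s => [|i s IH]; first by rewrite !big_nil /h (tlift0 bal2).
  by rewrite !big_cons hD IH.
rewrite /hi hsum; under eq_bigr => k _ do rewrite hsum.
apply: val_inj; rewrite O_S_val_sum.
have one : \sum_k a k * b k = 1.
  transitivity (\val (1 : A)); last exact: rmorph1.
  rewrite -pairing_sum1 O_S_val_sum.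
  by apply: eq_bigr => k _; rewrite /a coord_gen.
transitivity (val r * ((\sum_k a k * b k) * (\sum_k a k * b k))); last by rewrite one !mulr1.
rewrite mulr_suml mulr_sumr; apply: eq_bigr => k _.
rewrite O_S_val_sum !mulr_sumr; apply: eq_bigr => l _.
rewrite /h tlift_tens // g1t !O_S_valM hth hbe -/(a k) -/(a l).
by field.
Qed.

End InvertibleModules.

Section PicardData.
Variables (K : fieldType) (S : set (place K)).
Local Notation A := (S_integral S).

(** The last clause says that no u generates the square of the fractional ideal (a). *)
Lemma nontrivial_square : ~ Pic_killed_by (O_S S) 2 ->
  exists m (a b : 'I_m -> K), [/\ forall k l, a k * b l \in A, \sum_k a k * b k = 1 &
    forall u, u != 0 -> (forall k l, a k * a l / u \in A) ->
      (forall k l, u * b k * b l \in A) -> False].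
Proof.
move=> nk; apply: contrapT => no; apply: nk => L [M [f fb]].
have [d [mm [nn f1]]] := pairing_one fb.
have s1 := pairing_sum1 f1.
have [[m0 n0] d0] : exists p : L * M, pairing f p.1 p.2 != 0.
  apply: contrapT => no'; move/eqP: (oner_neq0 (O_S S)); apply; rewrite -s1 big1 // => k _.
  by apply/eqP; apply: contrapT => /negP h; apply: no'; exists (mm k, nn k).
have ab k l : ideal_gen f mm n0 k * inverse_gen f nn m0 n0 l = \val (pairing f (mm k) (nn l)).
  by rewrite /ideal_gen (coord_gen fb f1 d0).
apply: contrapT => nt; apply: no.
exists d, (ideal_gen f mm n0), (inverse_gen f nn m0 n0); split.
- by move=> k l; rewrite ab; exact: (valP (_ : O_S S)).
- transitivity (\val (1 : O_S S)); last exact: rmorph1.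
  by rewrite -s1 O_S_val_sum; apply: eq_bigr => k _.
- move=> u u0 h1 h2; apply: nt; exact: (tpow2_trivial fb f1 d0 u0 h1 h2).
Qed.

(** If A were a field, a_k^2 would generate the square of the ideal, for any k with a_k b_k
    non-zero. *)
Lemma exists_nonunit m (a b : 'I_m -> K) :
  (forall k l, a k * b l \in A) -> \sum_k a k * b k = 1 ->
  (forall u, u != 0 -> (forall k l, a k * a l / u \in A) ->
      (forall k l, u * b k * b l \in A) -> False) ->
  exists2 z, z \in A & z^-1 \notin A.
Proof.
move=> ab s1 h; apply: contrapT => no.
have inv z : z \in A -> z^-1 \in A.
  by move=> zA; apply: contrapT => /negP zV; apply: no; exists z.
have [k] : exists k, a k * b k != 0.
  apply: contrapT => no'; move/eqP: (oner_neq0 K); apply; rewrite -s1 big1 // => k _.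
  by apply/eqP; apply: contrapT => /negP h'; apply: no'; exists k.
move=> sk; have := sk; rewrite mulf_eq0 negb_or => /andP[ak bk].
apply: (h (a k ^+ 2)); first by rewrite expf_neq0.
  move=> i j; have -> : a i * a j / a k ^+ 2 =
    (a i * b k * (a k * b k)^-1) * (a j * b k * (a k * b k)^-1) by field; rewrite ak bk.
  by apply: rpredM; apply: rpredM => //; apply: inv.
move=> i j; have -> : a k ^+ 2 * b i * b j = (a k * b i) * (a k * b j) by ring.
by rewrite rpredM.
Qed.

End PicardData.

(** * Weights *)

(* The coordinate ring A[t, 1/t] of the multiplicative group, realized as
   functions on K^*; K is infinite, so no information is lost. *)
Section Laurent.
Variables (K : fieldType) (S : set (place K)).
Local Notation A := (S_integral S).

Definition nonzero : Type := {a : K | a != 0}.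

Definition laurent : {pred nonzero -> K} :=
  fun f => `[< exists N (p : {poly K}), p \is a polyOver A /\
                 forall a : nonzero, f a * sval a ^+ N = p.[sval a] >].

Lemma laurent_subring : subring_closed laurent.
Proof.
split=> [|f g /asboolP [N [p [pA hp]]] /asboolP [N' [p' [pA' hp']]]|
          f g /asboolP [N [p [pA hp]]] /asboolP [N' [p' [pA' hp']]]]; apply/asboolP.
- exists 0%N, 1; split; first exact: rpred1.
  by move=> a; rewrite hornerC mulr1.
- exists (N + N')%N, (p * 'X^N' - p' * 'X^N); split.
    by rewrite rpredB ?rpredM ?rpredX ?polyOverX.
  move=> a; rewrite hornerD hornerN !hornerM !hornerXn -hp -hp' exprD.
  by rewrite -[(f - g) a]/(f a - g a); ring.
- exists (N + N')%N, (p * p'); split; first by rewrite rpredM.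
  move=> a; rewrite hornerM -hp -hp' exprD.
  by rewrite -[(f * g) a]/(f a * g a); ring.
Qed.

HB.instance Definition _ :=
  GRing.isSubringClosed.Build (nonzero -> K) laurent laurent_subring.

Definition laurent_ring : Type := {f : nonzero -> K | f \in laurent}.
HB.instance Definition _ := [isSub of laurent_ring for @sval (nonzero -> K) _].
HB.instance Definition _ := [Choice of laurent_ring by <:].
HB.instance Definition _ :=
  GRing.SubChoice_isSubComPzRing.Build _ _ laurent_ring (subringClosedP _).

Lemma const_laurent (c : O_S S) : (fun=> val c) \in laurent.
Proof.
apply/asboolP; exists 0%N, (val c)%:P; split; first by rewrite polyOverC; exact: (valP c).
by move=> a; rewrite hornerC mulr1.
Qed.

Definition mk_laurent (f : nonzero -> K) (fL : f \in laurent) : laurent_ring :=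
  exist (fun f => f \in laurent) f fL.

Definition laurent_const (c : O_S S) : laurent_ring := mk_laurent (const_laurent c).

Lemma laurent_const_zmod : zmod_morphism laurent_const.
Proof. by move=> x y; apply: val_inj; apply/funext => a. Qed.

Lemma laurent_const_monoid : monoid_morphism laurent_const.
Proof. by split=> [|x y]; apply: val_inj; apply/funext => a. Qed.

HB.instance Definition _ := GRing.isZmodMorphism.Build (O_S S) laurent_ring
  laurent_const laurent_const_zmod.
HB.instance Definition _ := GRing.isMonoidMorphism.Build (O_S S) laurent_ring
  laurent_const laurent_const_monoid.

Definition laurent_alg : alg (O_S S) := @Alg (O_S S) laurent_ring laurent_const.

Definition laurent_ev (a : nonzero) (f : laurent_ring) : K := sval f a.

Lemma laurent_ev_zmod a : zmod_morphism (laurent_ev a). Proof. by []. Qed.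
Lemma laurent_ev_monoid a : monoid_morphism (laurent_ev a). Proof. by []. Qed.

HB.instance Definition _ a := GRing.isZmodMorphism.Build laurent_ring K
  (laurent_ev a) (laurent_ev_zmod a).
HB.instance Definition _ a := GRing.isMonoidMorphism.Build laurent_ring K
  (laurent_ev a) (laurent_ev_monoid a).

Definition laurent_eval (a : nonzero) : {rmorphism laurent_alg -> K_alg S} := laurent_ev a.

Lemma laurent_eval_hom a : alg_hom (laurent_eval a).
Proof. by []. Qed.

Lemma laurent_X : (fun a : nonzero => sval a) \in laurent.
Proof.
apply/asboolP; exists 0%N, 'X; split; first exact: polyOverX.
by move=> a; rewrite hornerX mulr1.
Qed.

Lemma laurent_V : (fun a : nonzero => (sval a)^-1) \in laurent.
Proof.
apply/asboolP; exists 1%N, 1; split; first exact: rpred1.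
by move=> a; rewrite hornerC mulVf // (svalP a).
Qed.

Definition laurent_t : laurent_alg := mk_laurent laurent_X.
Definition laurent_tV : laurent_alg := mk_laurent laurent_V.

Lemma laurent_tK : laurent_t * laurent_tV = 1.
Proof.
apply: val_inj; apply/funext => a.
by rewrite -[LHS]/(sval a * (sval a)^-1) divff // (svalP a).
Qed.

Lemma laurent_expansion (X : qform (O_S S)) (x : ext laurent_alg X) :
  exists s : seq (int * X), forall a : nonzero,
    ext_map (laurent_eval a) x = \sum_(p <- s) sval a ^ p.1 *: emb p.2.
Proof.
elim/tensor_ind: x => [|v r|x y [s hs] [s' hs']].
- by exists [::] => a; rewrite big_nil ext_map0 //; exact: laurent_eval_hom.
- have /asboolP [N [p [pA hp]]] := valP r.
  have /choice [c hc] : forall k, exists c : O_S S, p`_k = val c.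
    by move=> k; have pk := (polyOverP pA) k; exists (exist (fun x : K => x \in A) _ pk).
  exists [seq (Posz k - Posz N, c k *: v) | k <- index_iota 0 (size p)] => a.
  have a0 : sval a != 0 by exact: (svalP a).
  rewrite ext_map_tens; last exact: laurent_eval_hom.
  have -> : laurent_eval a r = \sum_(k <- index_iota 0 (size p)) p`_k * sval a ^ (Posz k - Posz N).
    apply: (mulIf (expf_neq0 N a0)); rewrite [LHS]hp horner_coef mulr_suml.
    rewrite big_mkord; apply: eq_bigr => k _.
    by rewrite -mulrA [_ ^+ N]exprnP -expfzDr // subrK.
  rewrite big_map tens_sumr; apply: eq_bigr => k _.
  by rewrite embZ scalerA [LHS]tensE hc mulrC.
- exists (s ++ s') => a; rewrite ext_mapD ?hs ?hs' ?big_cat //.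
Qed.

End Laurent.

Section Characters.
Variables (F K : fieldType) (iota : {rmorphism F -> K}).
Hypothesis hK : function_field iota.

Lemma transcendental_powers : exists x : K, x != 0 /\ forall i j : nat, x ^+ i = x ^+ j -> i = j.
Proof.
have [[x [n [b [xtr _]]]] _] := hK; exists x.
have x0 : x != 0.
  apply/eqP => x0; apply: xtr; exists 'X; first by rewrite polyX_eq0.
  by rewrite /root map_polyX hornerX x0.
split=> // i j e; apply: contrapT => ij; apply: xtr; exists ('X^i - 'X^j).
  rewrite subr_eq0; apply: contra_notN ij => /eqP /(congr1 (size \o val)) /=.
  by rewrite !size_polyXn => -[].
by rewrite /root rmorphB /= !map_polyXn hornerD hornerN !hornerXn e subrr.
Qed.

Lemma poly_vanish (p : {poly K}) : (forall a, a != 0 -> p.[a] = 0) -> p = 0.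
Proof.
have [x [x0 xinj]] := transcendental_powers; move=> h; apply/eqP; apply: contrapT => /negP p0.
pose rs := [seq x ^+ k | k <- index_iota 0 (size p)].
have rr : all (root p) rs.
  by apply/allP => _ /mapP[k _ ->]; apply/rootP/h; rewrite expf_neq0.
have ru : uniq rs by rewrite map_inj_uniq ?iota_uniq //; exact: xinj.
by have := max_poly_roots p0 rr ru; rewrite size_map size_iota subn0 ltnn.
Qed.

Lemma power_neq1 (i : int) : i != 0 -> exists2 a : K, a != 0 & a ^ i != 1.
Proof.
have [x [x0 xinj]] := transcendental_powers; move=> i0; exists x => //.
case: i i0 => n n0; apply/eqP => e.
  by move/eqP: n0; apply; congr Posz; apply: xinj; rewrite exprnP e.
rewrite NegzE -exprnN in e; have /xinj // : x ^+ n.+1 = x ^+ 0.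
by apply: invr_inj; rewrite e expr0 invr1.
Qed.

Variables (E : lmodType K) (n : nat) (f : {linear E -> 'rV[K]_n}).
Hypothesis f_inj : injective f.

(** Multiplied by a large power of a, each coordinate of the relation is a polynomial vanishing on
    the infinite set K^*. *)
Lemma characters_independent (I : seq int) (w : int -> E) : uniq I ->
  (forall a, a != 0 -> \sum_(i <- I) a ^ i *: w i = 0) -> forall i, i \in I -> w i = 0.
Proof.
move=> Iu h i iI; apply: f_inj; rewrite linear0; apply/rowP => k; rewrite mxE.
pose N := (\sum_(j <- I) absz j)%N.
have N_ge j : j \in I -> 0 <= j + N%:Z.
  move=> jI; have : (absz j <= N)%N by rewrite /N (big_rem j) //= leq_addr.
  by lia.
pose p := \sum_(j <- I) (f (w j) 0 k) *: 'X^((absz (j + N%:Z))).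
have p0 : p = 0.
  apply: poly_vanish => a a0; rewrite horner_sum.
  transitivity (a ^ (N%:Z) * (f (\sum_(j <- I) a ^ j *: w j)) 0 k); last first.
    by rewrite h // linear0 mxE mulr0.
  rewrite linear_sum summxE mulr_sumr !big_seq; apply: eq_bigr => j jI.
  rewrite hornerZ hornerXn linearZ !mxE mulrA -expfzDr // [(N%:Z) + _]addrC mulrC.
  by rewrite exprnP gez0_abs // N_ge.
have := congr1 (fun p : {poly K} => p`_(absz (i + N%:Z))) p0.
rewrite coef0 coef_sum (big_rem i) //= coefZ coefXn eqxx mulr1 big_seq big1 ?addr0 //.
move=> j; rewrite mem_rem_uniq // inE => /andP[ji jI].
rewrite coefZ coefXn; case: eqP => [e|_]; last by rewrite mulr0.
by case/eqP: ji; have := N_ge _ jI; have := N_ge _ iI; lia.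
Qed.

End Characters.

Section WeightDecomposition.
Variables (F K : fieldType) (iota : {rmorphism F -> K}).
Hypothesis hK : function_field iota.
Variables (S : set (place K)) (X : qform (O_S S)).
Local Notation E := (ext (K_alg S) X).
Variables (n : nat) (f : {linear E -> 'rV[K]_n}).
Hypothesis f_inj : injective f.
Variables (rho : K -> E -> E) (g : ext (laurent_alg S) X -> ext (laurent_alg S) X).
Hypotheses (rho_lin : forall a, a != 0 -> linear (rho a)) (rho1 : rho 1 = id)
  (rhoM : forall a b u, a != 0 -> b != 0 -> rho a (rho b u) = rho (a * b) u)
  (g_rho : forall a : nonzero K, base_change (laurent_eval S a) g (rho (sval a))).

(** The point g over A[t, 1/t] sends v to a Laurent polynomial with coefficients w_i in the lattice,
    so rho a v is the sum of the a^i w_i. At a = 1 this decomposes v; rho c (rho a v) = rho (c a) v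
    and the independence of characters give w_i the weight i. *)
Lemma weight_decomposition u : lat u -> exists s : seq E,
  (forall x, x \in s -> lat x /\ exists i, weight rho i x) /\ u = \sum_(x <- s) x.
Proof.
move=> [v ->].
have [s hs] := laurent_expansion (g (tens (alg_str (laurent_alg S)) v (1 : (laurent_alg S)^o))).
pose I := undup [seq p.1 | p <- s].
pose w i : E := \sum_(p <- s | p.1 == i) emb p.2.
have rho_v a : a != 0 -> rho a (emb v) = \sum_(i <- I) a ^ i *: w i.
  move=> a0; pose a' : nonzero K := exist _ a a0.
  have := g_rho a' (tens (alg_str (laurent_alg S)) v (1 : (laurent_alg S)^o)).
  rewrite ext_map_tens; last exact: laurent_eval_hom.
  rewrite rmorph1 hs /= => ->.
  under [RHS]eq_bigr => i _ do rewrite /w scaler_sumr.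
  rewrite (exchange_big_dep xpredT) //= big_seq [RHS]big_seq; apply: eq_bigr => p ps.
  have pI : p.1 \in I by rewrite mem_undup map_f.
  rewrite (big_rem _ pI) /= eqxx big1_seq ?addr0 // => i /andP[/eqP <-].
  by rewrite mem_rem_uniq ?undup_uniq // inE eqxx.
exists [seq w i | i <- I]; split; last first.
  have := rho_v 1 (oner_neq0 K); rewrite rho1 big_map => ->.
  by apply: eq_bigr => i _; rewrite exp1rz scale1r.
move=> _ /mapP[i iI ->]; split.
  rewrite /w; elim/big_rec: _ => [|p x _ Lx]; first by exists 0; rewrite /emb tens0l.
  by apply: latD => //; exact: lat_emb.
exists i => c c0; apply/eqP; rewrite -subr_eq0; apply/eqP; move: i iI.
apply: (characters_independent hK f_inj (w := fun i => rho c (w i) - c ^ i *: w i) (undup_uniq _)).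
move=> a a0; have [cD cZ] := linearDZ (rho_lin c0).
transitivity (rho c (rho a (emb v)) - rho (c * a) (emb v)); last by rewrite rhoM // subrr.
rewrite (rho_v _ a0) (rho_v _ (mulf_neq0 c0 a0)).
have -> : rho c (\sum_(i <- I) a ^ i *: w i) = \sum_(i <- I) a ^ i *: rho c (w i).
  elim: (I) => [|i I' IH]; last by rewrite !big_cons cD cZ IH.
  by rewrite !big_nil -(scale0r 0) cZ !scale0r.
rewrite -sumrB; apply: eq_bigr => i _.
by rewrite scalerBr scalerA expfzMl mulrC.
Qed.

End WeightDecomposition.

(** * Operations on equivariant isometries *)

Section Gisometries.
Variables (A : comPzRingType) (Gamma : finGroupType).

Lemma gisometry_comp (X Y Z : gform A Gamma) (g : Y -> Z) (f : X -> Y) :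
  gisometry g -> gisometry f -> @gisometry A Gamma X Z (g \o f).
Proof.
move=> [[gl gb gq] ge] [[fl fb fq] fe]; split; last by move=> a x; rewrite /= fe ge.
split; last by move=> x; rewrite /= gq fq.
  by move=> c x y; rewrite /= fl gl.
exact: bij_comp.
Qed.

Lemma gisometry_inv (X Y : gform A Gamma) (f : X -> Y) (g : Y -> X) :
  gisometry f -> cancel f g -> cancel g f -> gisometry g.
Proof.
move=> [[fl fb fq] fe] fK gK; split; last first.
  by move=> a x; apply: (can_inj fK); rewrite fe !gK.
split; last by move=> x; rewrite -fq gK.
  by move=> c x y; apply: (can_inj fK); rewrite fl !gK.
by exists f.
Qed.

Lemma gisometry_ext (half : A) (R : alg A) (X Y : gform A Gamma) (f : {linear X -> Y}) :
  half * 2 = 1 -> is_gform X -> is_gform Y -> gisometry f ->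
  @gisometry R Gamma (gform_ext R X) (gform_ext R Y) (tmap f).
Proof.
move=> halfE hX hY hf; have [[fl fb fq] fe] := hf; have [g fK gK] := fb.
have [[gl _ _] _] := gisometry_inv hf fK gK.
have -> : (tmap f : ext R X -> ext R Y) = (fun x => 1 *: tmap f x).
  by apply/funext => x; rewrite scale1r.
apply: (similitude_gisometry halfE (ps := linear_of gl) (s := 1)) => //.
- by rewrite rmorph1 mulr1.
- by move=> y; rewrite /= fK expr1n scale1r.
- by move=> y; rewrite /= gK expr1n scale1r.
- by move=> y; rewrite fq expr1n mul1r.
Qed.

Lemma gisometry_polR (half : A) (R : alg A) (X Y : gform A Gamma) (g : ext R X -> ext R Y) :
  half * 2 = 1 -> is_gform X -> is_gform Y ->
  @gisometry R Gamma (gform_ext R X) (gform_ext R Y) g ->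
  forall x y, polR (@qf _ Y) (g x) (g y) = polR (@qf _ X) x y.
Proof.
move=> halfE [[_ qX] _ _ _] [[_ qY] _ _ _] [[gl _ gq] _] x y.
have [gD _] := linearDZ gl.
rewrite -!(polar_qf_ext _ halfE) // /polar -gD.
by congr (_ - _ - _); exact: gq.
Qed.

End Gisometries.

(** * Units of the valuation rings and of their completions *)

Section ValuationRing.
Variables (K : fieldType) (v : place K).

Definition vring : {pred K} := fun x => vge v 0 x.

Lemma vring_subring : subring_closed vring.
Proof.
split=> [|x y xR yR|x y xR yR]; rewrite unfold_in.
- by rewrite /vge pval1 lexx orbT.
- exact: vgeB.
- by rewrite -[0](addr0 0); exact: vgeM.
Qed.

HB.instance Definition _ := GRing.isSubringClosed.Build K vring vring_subring.

Definition vring_of : Type := {x : K | x \in vring}.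
HB.instance Definition _ := [isSub of vring_of for @sval K _].
HB.instance Definition _ := [Choice of vring_of by <:].
HB.instance Definition _ :=
  GRing.SubChoice_isSubComPzRing.Build _ _ vring_of (subringClosedP _).

Variables (S : set (place K)) (Sv : ~ S v).

Lemma vring_const (x : O_S S) : val x \in vring.
Proof. by have /inA_P /(_ v Sv) := valP x. Qed.

Definition to_vring (x : O_S S) : vring_of :=
  exist (fun x : K => x \in vring) (val x) (vring_const x).

Lemma to_vring_zmod : zmod_morphism to_vring.
Proof. by move=> x y; apply: val_inj. Qed.

Lemma to_vring_monoid : monoid_morphism to_vring.
Proof. by split=> [|x y]; apply: val_inj. Qed.

HB.instance Definition _ := GRing.isZmodMorphism.Build (O_S S) vring_of to_vring to_vring_zmod.
HB.instance Definition _ := GRing.isMonoidMorphism.Build (O_S S) vring_of to_vring to_vring_monoid.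

(** Besides the completion, in which the genus is stated, the valuation ring is used because it maps
    to K, where local and generic decompositions are compared. *)
Definition vring_alg : alg (O_S S) := @Alg (O_S S) vring_of to_vring.

Definition vring_val : {rmorphism vring_alg -> K_alg S} := (\val : vring_of -> K).

Lemma vring_val_hom : alg_hom vring_val.
Proof. by []. Qed.

Lemma vring_unit (s : O_S S) : val s != 0 -> v (val s) = 0 ->
  exists2 s' : vring_alg, alg_str vring_alg s * s' = 1 & vring_val s' = (val s)^-1.
Proof.
move=> s0 vs; have sV : (val s)^-1 \in vring.
  by rewrite unfold_in /vge pvalV // vs oppr0 lexx orbT.
exists (exist (fun x : K => x \in vring) _ sV) => //.
by apply: val_inj; rewrite -[LHS]/(val s * (val s)^-1) divff.
Qed.

Lemma completion_unit (s : O_S S) : val s != 0 -> v (val s) = 0 ->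
  exists s' : completion_alg Sv, alg_str (completion_alg Sv) s * s' = 1.
Proof.
move=> s0 vs; have sV : (fun=> (val s)^-1) \in coherent v.
  apply/asboolP => n; split; last by rewrite subrr; exact: val_ge0.
  by right; rewrite pvalV // vs oppr0.
exists (\pi_({ideal_quot (@null_seq K v)})%qT (Sub (fun=> (val s)^-1) sV)).
rewrite -[LHS](rmorphM (\pi_({ideal_quot (@null_seq K v)}))%qT).
rewrite -[RHS](rmorph1 (\pi_({ideal_quot (@null_seq K v)}))%qT); congr (\pi_ _ _)%qT.
by apply: val_inj; apply/funext => n; rewrite -[LHS]/(val s * (val s)^-1) divff.
Qed.

End ValuationRing.

(** * The twisted form *)

Section LocalDenominators.
Variables (K : fieldType) (S : set (place K)) (X : qform (O_S S)).
Hypothesis X_form : is_qform X.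
Local Notation E := (ext (K_alg S) X).
Local Notation L := (@lat K S X).

Lemma loc_common_denominator v (theta : E -> E) : linear theta ->
  (forall x, loc S L v (theta (emb x))) ->
  exists s : O_S S, [/\ val s != 0, v (val s) = 0 & forall u, lat u -> lat (val s *: theta u)].
Proof.
move=> /linearDZ [tD tZ] h; have [m [g [Lg gen]]] := lat_gen X_form.
have /choice [s hs] : forall i, exists s : O_S S, [/\ val s != 0, v (val s) = 0 & lat (val s *: theta (g i))].
  move=> i; have [x ->] := Lg i; have [s [/inA_val[s' ->] ? ? ?]] := h x.
  by exists s'.
exists (\prod_i s i); have s0 (P : pred 'I_m) : val (\prod_(i | P i) s i) != 0 /\ v (val (\prod_(i | P i) s i)) = 0.
  elim/big_ind: _ => [|x y [x0 vx] [y0 vy]|i _]; last by have [] := hs i.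
    by rewrite /= oner_neq0 pval1.
  by rewrite /= mulf_neq0 ?pvalM // vx vy.
split; [exact: (s0 xpredT).1 | exact: (s0 xpredT).2 |].
move=> u /gen [c [cA ->]].
have -> : theta (\sum_i c i *: g i) = \sum_i c i *: theta (g i).
  elim/big_rec2: _ => [|i x y _ <-]; last by rewrite tD tZ.
  by rewrite -(scale0r 0) tZ !scale0r.
rewrite scaler_sumr; apply: (big_ind L) => [||i _]; first by exists 0; rewrite /emb tens0l.
  exact: latD.
have [_ _ h'] := hs i; rewrite scalerA (bigD1 i) //= -mulrA mulrC -scalerA.
by apply: latZ h'; rewrite rpredM ?valA.
Qed.

End LocalDenominators.

Section TwistedForm.
Variables (F : finFieldType) (K : fieldType) (iota : {rmorphism F -> K}).
Hypothesis hK : function_field iota.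
Variable S : set (place K).
Local Notation A := (S_integral S).
Variable z : K.
Hypotheses (zA : z \in A) (zVA : z^-1 \notin A).
Variables (half : O_S S) (halfE : half * 2 = 1).
Variables (Gamma : finGroupType) (X : gform (O_S S) Gamma).
Hypotheses (X_form : is_gform X) (X_reg : regular_form (@qf _ X)).

Local Notation KA := (K_alg S).
Local Notation E := (ext KA X).
Local Notation q := (@qf _ X).
Local Notation b := (@polR _ KA X q).
Local Notation L := (@lat K S X).

Let X_qform : is_qform X. Proof. by have [] := X_form. Qed.
Let q_quad : quadratic q := X_qform.2.
Let bC u u' : b u u' = b u' u. Proof. exact: polRC. Qed.
Let bZ c u w : b (c *: u) w = c * b u w. Proof. exact: polRZl. Qed.

Variables (sg ta : E -> E) (th th' : place K -> E -> E).
Hypotheses (iso : isom_pair b sg ta)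
  (th_lin : forall v, linear (th v)) (thK : forall v, cancel (th v) (th' v))
  (th'K : forall v, cancel (th' v) (th v))
  (th_iso : forall v u u', b (th v u) (th v u') = b u u')
  (th_act : forall v g u, th v (tmap (gact X g) u) = tmap (gact X g) (th v u))
  (loc_sg : forall v u, ~ S v -> loc S L v u <-> loc S L v (th v (sg u))).

Local Notation gK g := (tmap (gact X g) : E -> E).

Lemma ta_linear : linear ta.
Proof.
have [sl sK tK _] := iso.
by move=> c x y; apply: (can_inj sK); rewrite sl !tK.
Qed.

Lemma gact_loc v g u : loc S L v u -> loc S L v (gK g u).
Proof.
move=> [s [sA s0 vs [x e]]]; exists s; split=> //; exists (gact X g x).
by rewrite -(linearDZ (tmap_is_linear (gact X g))).2 e; exact: tmap_tens.
Qed.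

(** At v, sg may be replaced by th v \o sg, since th v commutes with Gamma; this map preserves the
    localized lattice, and so does the conjugated action. *)
Lemma twisted_lat g x : lat (ta (gK g (sg (emb x)))).
Proof.
have [sl sK tK _] := iso.
apply: (lat_of_loc (b := b)).
- exact: bC.
- exact: bZ.
- exact: lat_int.
- by move=> u; exact: (lat_dual hK zA zVA X_qform X_reg).
move=> v Sv; rewrite loc_sg // tK th_act; apply: gact_loc.
by apply: (loc_sg _ Sv).1; apply: loc_lat; exists x.
Qed.

Lemma twisted_action : exists act : Gamma -> {linear X -> X},
  forall g x, emb (act g x) = ta (gK g (sg (emb x))).
Proof.
have [sl sK tK _] := iso.
have /choice [h hh] : forall p : Gamma * X, exists x, emb x = ta (gK p.1 (sg (emb p.2))).
  by move=> [g x]; have [y e] := twisted_lat g x; exists y.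
have hl g : linear (fun x => h (g, x)).
  move=> c x y; apply: (emb_inj X_qform).
  by rewrite embD embZ !hh /= embD embZ sl linearP ta_linear.
by exists (fun g => linear_of (hl g)) => g x; rewrite /= hh.
Qed.

Variable act : Gamma -> {linear X -> X}.
Hypothesis actE : forall g x, emb (act g x) = ta (gK g (sg (emb x))).

Definition twisted : gform (O_S S) Gamma := @GForm _ _ X act.

Lemma twisted_act_ext g u : sg (tmap (act g) u) = gK g (sg u).
Proof.
have [sl sK tK _] := iso; rewrite -[RHS]tK; congr (sg _).
move: u; apply: ext_span; first exact: linearP.
  by move=> c x y; rewrite sl linearP ta_linear.
by move=> x; rewrite -actE; exact: tmap_tens.
Qed.

Lemma twisted_gform : is_gform twisted.
Proof.
have [sl sK tK siso] := iso; have [_ a1 aM aq] := X_form.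
have inj := emb_inj X_qform.
have gKemb g x : gK g (emb x) = emb (gact X g x) by exact: tmap_tens.
have tiso u u' : b (ta u) (ta u') = b u u' by rewrite -siso !tK.
have actq g u u' : b (gK g u) (gK g u') = b u u'.
  by rewrite (polR_tmap (q := q) (a := 1)) ?rmorph1 ?mul1r // => w; rewrite mul1r.
have gK1 u : gK 1%g u = u.
  move: u; apply: ext_span; [exact: tmap_is_linear | by [] |].
  by move=> x; rewrite gKemb a1.
have gKM g h u : gK (g * h)%g u = gK g (gK h u).
  move: u; apply: ext_span; [exact: tmap_is_linear | |].
    by move=> c x y; rewrite !tmap_is_linear.
  by move=> x; rewrite !gKemb aM.
split=> // [x|g h x|g x].
- by apply: inj; rewrite actE gK1 sK.
- by apply: inj; rewrite !actE tK gKM.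
have h : 2 * q (act g x) = 2 * q x.
  rewrite -!polarvv //; apply: val_inj; rewrite -!emb_form // actE.
  by rewrite tiso actq siso.
by rewrite -[LHS]mul1r -[RHS]mul1r -halfE -!mulrA [LHS]/= h.
Qed.

Lemma twisted_generic : @gisometry KA Gamma (gform_ext KA twisted) (gform_ext KA X) sg.
Proof.
have [sl sK tK siso] := iso; split; last exact: twisted_act_ext.
split; [exact: sl | by exists ta |].
by move=> u; rewrite /= !(qf_extE q_quad halfE) siso.
Qed.

(** X being finitely generated, one denominator s, a unit at v, makes th v \o sg and its inverse
    into endomorphisms of X itself. *)
Lemma twisted_local v : ~ S v -> exists (s : O_S S) (ph ps : {linear X -> X}),
  [/\ val s != 0, v (val s) = 0,
      forall u, tmap ph u = val s *: th v (sg u) &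
      forall u, tmap ps u = val s *: ta (th' v u)].
Proof.
move=> Sv; have [sl sK tK siso] := iso; have inj := emb_inj X_qform.
have tl := ta_linear.
have th'l : linear (th' v) by move=> c x y; apply: (can_inj (thK v)); rewrite th_lin !th'K.
have [s1 [s10 vs1 h1]] : exists s : O_S S, [/\ val s != 0, v (val s) = 0 &
    forall u, lat u -> lat (val s *: th v (sg u))].
  apply: (loc_common_denominator X_qform (theta := th v \o sg)) => [c x y|x].
    by rewrite /= sl th_lin.
  by apply: (loc_sg _ Sv).1; apply: loc_lat; exists x.
have [s2 [s20 vs2 h2]] : exists s : O_S S, [/\ val s != 0, v (val s) = 0 &
    forall u, lat u -> lat (val s *: ta (th' v u))].
  apply: (loc_common_denominator X_qform (theta := ta \o th' v)) => [c x y|x].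
    by rewrite /= th'l tl.
  by apply: (loc_sg _ Sv).2; rewrite /= tK th'K; apply: loc_lat; exists x.
exists (s1 * s2).
have /choice [f hf] : forall x, exists y, emb y = val (s1 * s2) *: th v (sg (emb x)).
  move=> x; have [|y e] := latZ (valA s2) (h1 (emb x) _); first by exists x.
  by exists y; rewrite -e scalerA mulrC.
have /choice [f' hf'] : forall x, exists y, emb y = val (s1 * s2) *: ta (th' v (emb x)).
  move=> x; have [|y e] := latZ (valA s1) (h2 (emb x) _); first by exists x.
  by exists y; rewrite -e scalerA.
have fl : linear f.
  move=> c x y; apply: inj; rewrite embD embZ !hf embD embZ sl th_lin scalerDr !scalerA.
  by rewrite [val c * _]mulrC.
have f'l : linear f'.
  move=> c x y; apply: inj; rewrite embD embZ !hf' embD embZ th'l tl scalerDr !scalerA.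
  by rewrite [val c * _]mulrC.
exists (linear_of fl), (linear_of f'l); split.
- by rewrite /= mulf_neq0.
- by rewrite /= pvalM // vs1 vs2.
- apply: ext_span; first exact: tmap_is_linear.
    by move=> c x y; rewrite sl th_lin scalerDr !scalerA [c * _]mulrC.
  by move=> x; rewrite -hf; exact: tmap_tens.
- apply: ext_span; first exact: tmap_is_linear.
    by move=> c x y; rewrite th'l tl scalerDr !scalerA [c * _]mulrC.
  by move=> x; rewrite -hf'; exact: tmap_tens.
Qed.

Lemma twisted_local_gisometry v (s : O_S S) (ph ps : {linear X -> X}) (R : alg (O_S S)) (s' : R) :
  alg_str R s * s' = 1 ->
  (forall u, tmap ph u = val s *: th v (sg u) :> E) ->
  (forall u, tmap ps u = val s *: ta (th' v u) :> E) ->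
  @gisometry R Gamma (gform_ext R twisted) (gform_ext R X) (fun u => s' *: tmap ph u).
Proof.
move=> ss hph hps; have [sl sK tK siso] := iso; have inj := emb_inj X_qform.
have [tD tZ] := linearDZ ta_linear; have [sD sZ] := linearDZ sl.
have [hD hZ] := linearDZ (th_lin v).
have eph x : emb (ph x) = val s *: th v (sg (emb x)) by rewrite -hph; apply/esym; exact: tmap_tens.
have eps x : emb (ps x) = val s *: ta (th' v (emb x)) by rewrite -hps; apply/esym; exact: tmap_tens.
have th'Z c u : th' v (c *: u) = c *: th' v u.
  by apply: (can_inj (thK v)); rewrite hZ !th'K.
apply: (@similitude_gisometry _ _ halfE _ _ twisted X ph ps s s') => //.
- exact: twisted_gform.
- by move=> x; apply: inj; rewrite eps eph th'Z thK tZ sK scalerA embZ.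
- by move=> x; apply: inj; rewrite eph eps sZ tK hZ th'K scalerA embZ.
- move=> x; have h : 2 * q (ph x) = s ^+ 2 * (2 * q x).
    rewrite -!polarvv //; apply: val_inj.
    transitivity (val s * val s * val (polar q x x)); last by [].
    by rewrite -!emb_form // eph bZ bC bZ th_iso siso mulrA.
  have e2 (c : O_S S) : c = half * (2 * c) by rewrite mulrA halfE mul1r.
  by rewrite (e2 (q (ph x))) h mulrCA -e2.
- move=> g x; apply: inj; rewrite eph actE tK th_act.
  have -> : emb (gact X g (ph x)) = gK g (emb (ph x)) by apply/esym; exact: tmap_tens.
  rewrite eph.
  by rewrite (linearDZ (tmap_is_linear (gact X g))).2.
Qed.

Lemma twisted_genus : Gamma_genus X twisted.
Proof.
split; first exact: twisted_gform.
  by exists sg; exact: twisted_generic.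
move=> v Sv; have [s [ph [ps [s0 vs hph hps]]]] := twisted_local Sv.
have [s' ss] := completion_unit Sv s0 vs.
by exists (fun u => s' *: tmap ph u); exact: twisted_local_gisometry ss hph hps.
Qed.

Lemma twisted_isometric : isometric X twisted.
Proof. by exists id; split=> //; exists id. Qed.

Section NotEquivariant.
Variables (G0 Q : efunctor X) (rho : K -> E -> E) (j : place K -> K).
Arguments G0 : clear implicits.
Arguments Q : clear implicits.
Hypotheses (sd : semidirect (OGamma X) G0 Q)
  (rho1 : rho 1 = id)
  (rhoM : forall a c u, a != 0 -> c != 0 -> rho a (rho c u) = rho (a * c) u)
  (rhoG : forall a, a != 0 -> G0 KA (rho a))
  (Grho : forall g, G0 KA g -> exists2 a, a != 0 & g = rho a)
  (j0 : forall v, j v != 0) (thE : forall v u, th v u = rho (j v ^- 2) u)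
  (stable : forall v c, ~ S v -> c != 0 ->
     (forall u, loc S L v u -> loc S L v (rho c u)) -> v c = 0).

Lemma vring_loc v (Sv : ~ S v) (x : ext (vring_alg Sv) X) :
  loc S L v (ext_map (vring_val Sv) x).
Proof.
have hom := vring_val_hom Sv.
have lZ (c : K) u : vge v 0 c -> loc S L v u -> loc S L v (c *: u).
  by apply: (locZ hK zA zVA) => // c' u' c'A; exact: latZ.
elim/tensor_ind: x => [|y r|x y IHx IHy].
- by rewrite ext_map0 //; apply: loc_lat; exists 0; rewrite /emb tens0l.
- rewrite ext_map_tens // tensE; apply: lZ; first exact: (valP r).
  by apply: loc_lat; exists y.
- rewrite ext_mapD //; apply: locD IHx IHy; first exact: latD.
  by move=> c u cA; exact: latZ.
Qed.

Lemma vring_loc_stable v (Sv : ~ S v) (n : ext (vring_alg Sv) X -> ext (vring_alg Sv) X)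
    (n' : E -> E) : linear n' -> base_change (vring_val Sv) n n' ->
  forall u, loc S L v u -> loc S L v (n' u).
Proof.
move=> /linearDZ [_ nZ] bc u [s [sA s0 vs [x e]]].
have -> : u = s^-1 *: emb x by rewrite -e scalerA mulVf ?scale1r.
rewrite nZ; have -> : emb x = ext_map (vring_val Sv) (tens (alg_str (vring_alg Sv)) x (1 : (vring_alg Sv)^o)).
  by rewrite ext_map_tens ?rmorph1 //; exact: vring_val_hom.
rewrite bc; apply: (locZ hK zA zVA) => //; first by move=> c' u' c'A; exact: latZ.
  by rewrite /vge pvalV // vs oppr0 lexx orbT.
exact: vring_loc.
Qed.

(* An equivariant isometry composed with sg is n \o h over K, and rho (j v ^- 2)
   times it is n_v \o h_v over the valuation ring of v.  By uniqueness of the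
   decomposition rho (j v ^- 2) \o n = n_v stabilizes the lattice at v. *)
Lemma equivariant_square : gisometric X twisted ->
  exists2 u, u != 0 & forall v, ~ S v -> v u = 2 * v (j v).
Proof.
move=> [f0 f0i]; have [[f0l _ _] _] := f0i; pose f := linear_of f0l.
have fi : @gisometry _ Gamma X twisted f by exact: f0i.
have fR (R : alg (O_S S)) := gisometry_ext R halfE X_form twisted_gform fi.
have [[sub0 id0 comp0 inv0 bc0] [subQ idQ compQ invQ bcQ] _ triv dec] := sd.
have h0 : OGamma X KA (sg \o tmap f) := gisometry_comp twisted_generic (fR KA).
have [n [h [nG hQ e0]]] := dec _ _ h0.
have [u u0 nu] := Grho nG; exists u => // v Sv.
have [s [ph [ps [s0 vs hph hps]]]] := twisted_local Sv.
have [s' ss s'E] := vring_unit Sv s0 vs.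
pose R := vring_alg Sv; pose val_v := vring_val Sv; have hom : alg_hom val_v := vring_val_hom Sv.
pose gv : ext R X -> ext R X := (fun x => s' *: tmap ph x) \o tmap f.
have gvO : OGamma X R gv := gisometry_comp (twisted_local_gisometry ss hph hps) (fR R).
have [nv [hv [nvG hvQ gvE]]] := dec _ _ gvO.
have [nK nKO nKbc] := gisometry_change halfE hom X_form (sub0 _ _ nvG).
have [hK' hKO hKbc] := gisometry_change halfE hom X_form (subQ _ _ hvQ).
have nKG : G0 KA nK := bc0 _ _ _ _ _ hom nvG nKO nKbc.
have hKQ : Q KA hK' := bcQ _ _ _ _ _ hom hvQ hKO hKbc.
have [[nKl _ _] _] := nKO; have [[hKl hKb _] _] := hKO.
have [hi hiK hKi] := hKb.
have hiO : OGamma X KA hi := gisometry_inv hKO hiK hKi.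
have hiQ : Q KA hi := invQ _ _ _ hKQ hiO hiK.
have jj0 : j v ^- 2 != 0 by rewrite invr_eq0 expf_neq0.
have thlin := th_lin v.
have eK : nK \o hK' = th v \o (sg \o tmap f).
  have [[h0l _ _] _] := h0.
  apply: (base_change_eq hom (g := gv)).
  - by move=> c x y; rewrite /= hKl nKl.
  - by move=> c x y; have := h0l c x y; rewrite /= => ->; rewrite thlin.
  - by move=> x; rewrite gvE /= hKbc nKbc.
  move=> x; rewrite /gv /= ext_mapZ // !ext_map_tmap // hph s'E scalerA mulVf // scale1r.
  by [].
pose c := j v ^- 2 * u.
have c0 : c != 0 by rewrite mulf_neq0.
have cV0 : c^-1 != 0 by rewrite invr_eq0.
have eK2 x : nK (hK' x) = rho c (h x).
  have := congr1 (fun k => k x) eK; rewrite /= => ->.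
  have := congr1 (fun k => k x) e0; rewrite /= => ->.
  by rewrite thE nu rhoM.
(* The left side lies in G0 and the right side in Q, so both are the identity. *)
have eq1 : rho c^-1 \o nK = h \o hi.
  apply/funext => x /=; rewrite -{1}[x]hKi eK2 rhoM // mulVf // rho1 //.
have id1 : rho c^-1 \o nK = idfun.
  apply: triv; first by apply: comp0 => //; exact: rhoG.
  by rewrite eq1; apply: compQ.
have nKc : nK = rho c.
  apply/funext => x; have := congr1 (fun k => rho c (k x)) id1 => /=.
  by rewrite rhoM // divff // rho1.
have /stable : forall w, loc S L v w -> loc S L v (rho c w).
  by rewrite -nKc; apply: vring_loc_stable nKbc.
move=> /(_ Sv c0); rewrite /c pvalM // pvalV ?expf_neq0 // expr2 pvalM //; lia.
Qed.

End NotEquivariant.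

End TwistedForm.

Local Open Scope classical_set_scope.

(** * Transport of the torus to the generic fibre of V *)

Section TorusAction.
Variables (F : finFieldType) (K : fieldType) (iota : {rmorphism F -> K}).
Hypothesis hK : function_field iota.
Variable S : set (place K).
Local Notation A := (S_integral S).
Variable z : K.
Hypotheses (zA : z \in A) (zVA : z^-1 \notin A) (two0 : (2 : K) != 0).
Variables (half : O_S S) (halfE : half * 2 = 1).
Variables (W X : qform (O_S S)).
Hypotheses (W_form : is_qform W) (W_reg : regular_form (@qf _ W))
  (W_rank : has_rank W 2) (W_iso : isotropic (@qf _ W)).
Variables (G G0 : efunctor X).
Arguments G : clear implicits.
Arguments G0 : clear implicits.
Hypotheses (G0_sub : subgroup_functor G G0)
  (G0_iso : group_iso (SO W) G0).
Local Notation KA := (K_alg S).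
Local Notation E := (ext KA X).

(** Here g is the image of the universal point t of the torus over A[t, 1/t]. Naturality of the
    isomorphism makes every rho a a specialization of it, which yields the integral weight
    decomposition. *)
Lemma torus_action : exists (rho : K -> E -> E)
    (g : ext (laurent_alg S) X -> ext (laurent_alg S) X),
  [/\ rho 1 = id,
      forall a c u, a != 0 -> c != 0 -> rho a (rho c u) = rho (a * c) u,
      (forall a, a != 0 -> G0 KA (rho a)) /\
        (forall h, G0 KA h -> exists2 a, a != 0 & h = rho a),
      forall a : nonzero K, base_change (laurent_eval S a) g (rho (sval a)) &
      forall a, a != 0 -> rho a = id -> a = 1].
Proof.
have [e1 [e2 [b11 b22 b12 e12]]] := isotropic_basis hK zA zVA W_form W_reg W_rank W_iso.
have [ep [em [epm epp qep qem [epE emE]]]] :=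
  projectors hK zA zVA halfE W_form W_reg b11 b22 b12 e12.
have TSO (R : alg (O_S S)) (s s' : R) : s * s' = 1 -> SO W R (torus ep em s s').
  exact: (torus_SO halfE W_form W_reg epm epp qep qem).
have [t [tbij tM tbc]] := G0_iso.
pose T (a : K) : ext KA W -> ext KA W := torus ep em (a : KA) (a^-1 : KA).
have TG a : a != 0 -> SO W KA (T a) by move=> a0; apply: TSO; exact: mulfV.
have T1 : T 1 = id by apply/funext => x; rewrite /T invr1; exact: torus1.
have TM a c : a != 0 -> c != 0 -> T a \o T c = T (a * c).
  by move=> a0 c0; apply/funext => x; rewrite /T invfM; apply: torusM.
have [tf ti ts] := tbij KA.
have tT1 : t KA (T 1) = id.
  have [_ id0 _ _ _] := G0_sub.
  have [g SOg tg] := ts _ (id0 KA).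
  transitivity (t KA (T 1) \o t KA g); first by rewrite tg.
  by rewrite -tM //; [rewrite T1; exact: tg | exact: TG (oner_neq0 K)].
have [sub0 _ _ _ _] := G0_sub.
pose gl := t (laurent_alg S) (torus ep em (laurent_t S) (laurent_tV S)).
exists (fun a => t KA (T a)), gl; split.
- exact: tT1.
- move=> a c u a0 c0; rewrite -TM // tM //; exact: TG.
- split=> [a a0|h /ts [g SOg <-]]; first by apply: tf; exact: TG.
  have [u u0 ->] := SO_torus two0 halfE W_form b11 b22 b12 e12 epE emE SOg.
  by exists u.
- move=> a; apply: tbc; first exact: laurent_eval_hom.
  + by apply: TSO; exact: laurent_tK.
  + exact: TG (svalP a).
  + move=> x; exact: (torus_ext_map ep em (laurent_t S) (laurent_tV S) x (laurent_eval_hom a)).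
- move=> a a0; rewrite -tT1 => /ti -/(_ _ _) ta.
  have {ta} : T a = T 1 by apply: ta; apply: mem_set; apply: TG; rewrite ?oner_neq0.
  move/(congr1 (fun k => polR (@qf _ W) (k e1) e2)).
  have q_quad := W_form.2.
  rewrite T1 b12 /T /torus epE emE b12 b11 scale0r scaler0 addr0 scale1r.
  by rewrite polRZl // b12 mulr1.
Qed.

End TorusAction.

Theorem proposition4p1
  (p : nat) (F : finFieldType) (K : fieldType) (iota : {rmorphism F -> K})
  (hp : p \in [pchar K]) (hodd : odd p) (hK : function_field iota)
  (S : set (place K)) (S_fin : finite_set S) (S_neq0 : S !=set0)
  (Gamma : finGroupType) (hGamma : coprime #|Gamma| p)
  (X : gform (O_S S) Gamma)
  (X_form : is_gform X) (X_reg : regular_form (@qf _ X))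
  (X_faithful : faithful_action X)
  (n : nat) (hn : (3 <= n)%N) (X_rank : has_rank X n)
  (G0 : efunctor X) (hG0 : neutral_component (OGamma X) G0)
  (hSO : exists W : qform (O_S S),
     [/\ is_qform W, regular_form (@qf _ W), has_rank W 2,
         isotropic (@qf _ W) & group_iso (SO W) G0])
  (hQ : exists Q : efunctor X,
     semidirect (OGamma X) G0 Q /\ finite_functor Q)
  (hsq : exists a : F, a ^+ 2 = - 1)
  (e : nat) (he : Pic_exponent (O_S S) e) (he2 : (2 < e)%N) :
  exists Y1 Y2 : gform (O_S S) Gamma,
    [/\ Gamma_genus X Y1, Gamma_genus X Y2,
        ~ gisometric Y1 Y2 & isometric Y1 Y2].
Proof.
have noPic : ~ Pic_killed_by (O_S S) 2.
  by move=> h; have [_ _ /(_ 2%N isT h)] := he; rewrite leqNgt he2.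
have [m [a [b [hab ab1 nt]]]] := nontrivial_square noPic.
have [z zA zVA] := exists_nonunit hab ab1 nt.
have [J [Jdiv aJ bJ Jpick]] := div_of_inverse hab ab1.
(* At v outside S a generator of J; at the places of S the default value 1. *)
have /choice [j hj] : forall v, exists x : K, x != 0 /\ (~ S v -> v x = J v).
  move=> v; have [Sv|Sv] := pselect (S v); first by exists 1; rewrite oner_neq0.
  by have [k [ak _ vk _]] := Jpick v Sv; exists (a k).
have pK : p%:R = 0 :> K by apply/eqP; have /andP[] := hp.
(* As p is odd, (p + 1) / 2 is the inverse of 2 in characteristic p. *)
pose half : O_S S := (p.+1)./2%:R.
have halfE : half * 2 = 1.
  apply: val_inj; rewrite rmorphM !rmorph_nat -natrM muln2 halfK /= hodd subn0.
  by rewrite -addn1 natrD pK add0r.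
have halfK2 : val half * 2 = 1 by rewrite -(rmorph_nat (\val : O_S S -> K)) -rmorphM halfE.
have two0 : (2 : K) != 0.
  by apply: contra_eq_neq halfK2 => ->; rewrite mulr0 eq_sym oner_neq0.
have halfA : (2 : K)^-1 \in S_integral S.
  have -> : (2 : K)^-1 = val half by apply: (mulIf two0); rewrite mulVf.
  exact: (valP half).
have [W [W_form W_reg W_rank W_iso G0_iso]] := hSO.
have [Q [sd _]] := hQ; have [G0_sub _ _ _ _] := sd.
have [rho [g [rho1 rhoM [rhoG Grho] g_rho rho_faithful]]] :=
  torus_action hK zA zVA two0 halfE W_form W_reg W_rank W_iso G0_sub
    G0_iso.
have X_qform : is_qform X by case: X_form.
have q_quad := X_qform.2.
have rhoO c : c != 0 -> OGamma X (K_alg S) (rho c).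
  by move=> c0; have [sub0 _ _ _ _] := G0_sub; apply: sub0; exact: rhoG.
have rho_lin c : c != 0 -> linear (rho c) by move=> /rhoO [[]].
have rho_iso c u u' : c != 0 -> polR (@qf _ X) (rho c u) (rho c u') = polR (@qf _ X) u u'.
  by move=> /rhoO h; exact: (gisometry_polR halfE X_form X_form h).
have rho_act c gm u : c != 0 -> rho c (tmap (gact X gm) u) = tmap (gact X gm) (rho c u).
  by move=> /rhoO [_ h]; exact: h.
have [f f_bij] := X_rank K (\val : {rmorphism O_S S -> K}).

have fE : injective f := bij_inj f_bij.
have bC u u' : polR (R := K_alg S) (@qf _ X) u u' = polR (@qf _ X) u' u by exact: polRC.
have bD u u' w : polR (R := K_alg S) (@qf _ X) (u + u') w =
    polR (@qf _ X) u w + polR (@qf _ X) u' w by exact: polRDl.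
have bZ c u w : polR (R := K_alg S) (@qf _ X) (c *: u) w = c * polR (@qf _ X) u w by exact: polRZl.
have Ldec := weight_decomposition hK fE rho_lin rho1 rhoM g_rho.
have LD (u u' : ext (K_alg S) X) : lat u -> lat u' -> lat (u + u') by exact: latD.
have LZ (c : K) (u : ext (K_alg S) X) : c \in S_integral S -> lat u -> lat (c *: u) by exact: latZ.
have Lspan := lat_span hK zA zVA (X := X).
have Lint := lat_int X_qform.
have Lnondeg := lat_nondeg hK zA zVA X_qform X_reg.
have rhoD c u u' : c != 0 -> rho c (u + u') = rho c u + rho c u'.
  by move=> c0; exact: (linearDZ (rho_lin c c0)).1.
have rhoZ c d u : c != 0 -> rho c (d *: u) = d *: rho c u.
  by move=> c0; exact: (linearDZ (rho_lin c c0)).2.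
have [sg [ta [iso loc_sg]]] := rational_twist hK zA zVA two0 halfA bC bD bZ f_bij LD LZ
  (lat_gen X_qform) Lspan Lint (lat_dual hK zA zVA X_qform X_reg) Lnondeg
  rhoD rhoZ rho_iso Ldec (power_neq1 hK) hn Jdiv.

pose th v := rho (j v ^- 2); pose th' v := rho (j v ^+ 2).
have j0 v : j v != 0 := (hj v).1.
have j2 v : j v ^- 2 != 0 by rewrite invr_eq0 expf_neq0.
have thK v : cancel (th v) (th' v).
  by move=> u; rewrite /th /th' rhoM ?expf_neq0 // divff ?expf_neq0 // rho1.
have th'K v : cancel (th' v) (th v).
  by move=> u; rewrite /th /th' rhoM ?expf_neq0 // mulVf ?expf_neq0 // rho1.
have th_lin v : linear (th v) by exact: rho_lin.
have th_iso v u u' : polR (@qf _ X) (th v u) (th v u') = polR (@qf _ X) u u' by exact: rho_iso.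
have th_act v gm u : th v (tmap (gact X gm) u) = tmap (gact X gm) (th v u) by exact: rho_act.
have loc_th v u : ~ S v -> loc S (@lat K S X) v u <-> loc S (@lat K S X) v (th v (sg u)).
  by move=> Sv; apply: loc_sg => //; exact: (hj v).2.
have [act actE] := twisted_action hK zA zVA X_form X_reg iso th_act loc_th.
(* With the weight 0 alone rho would be trivial, although it is faithful and K^* has an element
   other than 1. *)
have wt_neq0 : exists i x, [/\ i != 0, x != 0 & weight rho i x].
  apply: contrapT => no.
  have rho_id c : c != 0 -> rho c = id.
    move=> c0; apply/funext; apply: ext_span; [exact: rho_lin | by [] |] => x.
    have [s [hs ->]] := Ldec _ (lat_emb x).
    have [cD cZ] := linearDZ (rho_lin c c0).
    elim: s hs => [|y s IH] hs; first by rewrite !big_nil -(scale0r 0) cZ !scale0r.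
    rewrite !big_cons cD IH; last by move=> y' ys; apply: hs; rewrite inE ys orbT.
    congr (_ + _); have [_ [i wi]] := hs y (mem_head _ _).
    rewrite (wi c c0); have [->|i0] := eqVneq i 0; first by rewrite expr0z scale1r.
    have [->|y0] := eqVneq y 0; first by rewrite scaler0.
    by case: no; exists i, y.
  have [c c0 c1] := power_neq1 hK (oner_neq0 int).
  by move: c1; rewrite (rho_faithful c c0 (rho_id c c0)) exp1rz eqxx.
have stable v c : ~ S v -> c != 0 -> (forall u, loc S (@lat K S X) v u ->
    loc S (@lat K S X) v (rho c u)) -> v c = 0.
  move=> Sv c0; exact: (loc_stable_unit zA zVA two0 halfA bC bD bZ LD Lspan Lint Lnondeg
    rhoD rhoZ rho_iso Ldec (power_neq1 hK) Sv c0 wt_neq0).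
exists X, (twisted act); split.
- split=> //; first by exists id; split=> //; split=> //; exists id.
  by move=> v Sv; exists id; split=> //; split=> //; exists id.
- exact: (twisted_genus halfE X_form iso th_lin thK th'K th_iso th_act loc_th actE).
- move=> hiso.
  have [u u0 hu] := equivariant_square hK zA zVA halfE X_form iso th_lin thK th'K
    th_iso th_act loc_th actE sd rho1 rhoM rhoG Grho j0 (fun v u => erefl) stable hiso.
  (* The values v u = 2 * J v make u a generator of the square of the ideal (a), against the choice
     of that ideal. *)
  apply: (nt u u0) => k l; apply/inA_P => v Sv.
    have := vgeM (aJ k v Sv) (aJ l v Sv); have := hu v Sv; rewrite (hj v).2 // => vu.
    have : vge v (- v u) u^-1 by rewrite /vge pvalV // lexx orbT.
    by move=> h1 h2; have := vgeM h2 h1; rewrite vu; apply: vgeW; lia.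
  have := hu v Sv; rewrite (hj v).2 // => vu.
  have h1 : vge v (v u) u by rewrite /vge lexx orbT.
  by have := vgeM (vgeM h1 (bJ k v Sv)) (bJ l v Sv); rewrite vu; apply: vgeW; lia.
- exact: twisted_isometric.
Qed.
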